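(* Let $B>0$, $\bar\gamma>1+d/2$, $\mu\in[0,1]$, and $$\Theta_{\bar\gamma}(B)=\{\theta\in H^{\bar\gamma}(\Omega):\|\theta\|_{H^{\bar\gamma}(\Omega)}\le B\}.$$ Assume the forward Lipschitz estimate $$\|u_\theta-u_\vartheta\|_{L^2(0,T;L^2(\Omega))}\le C_0\,\|\theta-\vartheta\|_{H^{-\mu}(\Omega)}$$ for $\theta,\vartheta\in H^{\bar\gamma}(\Omega)$ and all exponents $\mu\in[0,1]$, with a constant $C_0$ that is uniform over $\theta,\vartheta$ in bounded subsets of $H^{\bar\gamma}(\Omega)$. Let $-1\le\xi<\bar\gamma$. Then there exists $C>0$ such that, for every sufficiently small $\epsilon>0$, $$\liminf_{N\to\infty}\ \inf_{\widehat\theta_N}\ \sup_{\theta\in\Theta_{\bar\gamma}(B)}\mathbb{P}^N_\theta\Big(\|\widehat\theta_N-\theta\|_{H^\xi(\Omega)}>C\,N^{-\frac{\bar\gamma-\xi}{2\bar\gamma+2\mu+d}}\Big)\ge1-\epsilon,$$ where the infimum is over all measurable estimators $\widehat\theta_N=\widehat\theta_N(D_N)$.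
   Context: Let $\Omega=(0,1)^d$ with $1\le d\le 3$, let $A=-\Delta$ with homogeneous Dirichlet boundary conditions on $\Omega$, with eigenpairs $\{(\lambda_j,e_j)\}_{j\ge1}$, $\{e_j\}$ an orthonormal basis of $L^2(\Omega)$. For $s\in\mathbb{R}$, $\dot H^s(\Omega)$ is the Hilbert space with norm $\|v\|_{\dot H^s}^2=\sum_j\lambda_j^s|(v,e_j)_{L^2}|^2$; $H^s(\Omega)$ denotes the standard integer or fractional Sobolev space, and for $s\in[-1,0)$ it is identified with $\dot H^s(\Omega)$. Fix $\alpha\in(0,1)$ and $T>0$. For an admissible initial state $\theta$, $u_\theta$ denotes the corresponding solution of $$\partial_t^\alpha u+Au=f(u)\ \text{in }(0,T]\times\Omega,\qquad u=0\ \text{on }(0,T]\times\partial\Omega,\qquad u(0)=\theta\ \text{in }\Omega,$$ where $\partial_t^\alpha u(t)=\frac{1}{\Gamma(1-\alpha)}\int_0^t(t-s)^{-\alpha}u'(s)\,ds$ is the Djrbashian–Caputo derivative and $f$ is the nonlinear source term. The solution is understood as the mild solution $$u(t)=F(t)\theta+\int_0^tE(t-s)f(u(s))\,ds,$$ with $$F(t)=\frac1{2\pi\mathrm i}\int_{\Gamma_{\beta,\tau}}e^{zt}z^{\alpha-1}(z^\alpha+A)^{-1}dz,\qquad E(t)=\frac1{2\pi\mathrm i}\int_{\Gamma_{\beta,\tau}}e^{zt}(z^\alpha+A)^{-1}dz,$$ where $\Gamma_{\beta,\tau}=\{|z|=\tau,\ |\arg z|\le\beta\}\cup\{z=\rho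 e^{\pm\mathrm i\beta},\ \rho\ge\tau\}$, oriented counterclockwise, with $\tau\ge0$ and $\pi/2<\beta<\pi$. Observations: the design points $(t_i,x_i)$, $i=1,\dots,N$, are i.i.d. uniform on $(0,T]\times\Omega$ and $Y_i=u_\theta(t_i,x_i)+\epsilon_i$ with $\epsilon_i$ i.i.d. $N(0,1)$, independent of the design. Write $D_N=\{(Y_i,x_i,t_i):1\le i\le N\}$, and let $\mathbb{P}^N_\theta$ be the joint law of $D_N$ when the true parameter is $\theta$. *)

(* Defs.v *)
From HB Require Import structures.
From mathcomp Require Import all_boot all_order all_algebra.
From mathcomp Require Import all_classical all_reals all_analysis.
From mathcomp Require Import complex.

Set Implicit Arguments.
Unset Strict Implicit.
Unset Printing Implicit Defensive.
Import Order.TTheory GRing.Theory Num.Theory.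
Import numFieldNormedType.Exports.
Local Open Scope classical_set_scope.
Local Open Scope ring_scope.

Section ConsTuple.
Context {disp : measure_display} {X : measurableType disp}.

Definition cons_tuple n (p : X * n.-tuple X) : n.+1.-tuple X :=
  [tuple of p.1 :: p.2].

Lemma measurable_cons_tuple n : measurable_fun [set: _] (@cons_tuple n).
Proof. by apply: measurable_cons. Qed.

HB.instance Definition _ n :=
  isMeasurableFun.Build _ _ _ _ (@cons_tuple n) (@measurable_cons_tuple n).
End ConsTuple.

Fixpoint iid {disp : measure_display} {X : measurableType disp} {R : realType}
    (P : probability X R) (n : nat) : probability (n.-tuple X) R :=
  match n with
  | 0 => @dirac _ (0.-tuple X) [tuple] R
  | n'.+1 => distribution (P \x iid P n')%E (@cons_tuple _ X n')
  end.

Notation pt R d := (d.-tuple (measurableTypeR R)).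

(* an observation (Y, x, t) *)
Notation obs R d := (measurableTypeR R * pt R d * measurableTypeR R)%type.

Section Domain.
Context {R : realType} {d : nat}.
Local Notation pt := (pt R d).

(* Lebesgue measure on (0,1)^d: the product of d copies of Lebesgue measure on
   the unit interval (its boundary is null), which is at the same time the
   uniform law on (0,1)^d. All functions on the domain are total functions on
   [pt], and only their values up to [vol]-null sets matter. *)
Definition vol : probability pt R := iid (uniform_prob (@ltr01 R)) d.

Definition rv (x : pt) : 'rV[R]_d := \row_i tnth x i.

Definition L2 (v : pt -> R) : Prop := v \in Lfun vol 2%:E.

Definition L2norm (v : pt -> R) : \bar R := 'N[vol]_2%:E[EFin \o v].

Definition inner (v w : pt -> R) : R := \int[vol]_x (v x * w x).

Definition pderiv (i : 'I_d) (phi : 'rV[R]_d -> R) : 'rV[R]_d -> R :=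
  fun x => 'D_(delta_mx 0 i) phi x.

Definition smooth (phi : 'rV[R]_d -> R) : Prop :=
  forall s : seq 'I_d, let psi := foldr pderiv phi s in
    continuous psi /\ forall i x, derivable psi x (delta_mx 0 i).

Definition cube : set 'rV[R]_d := [set x | forall i, 0 < x 0 i < 1].

(* C_c^oo((0,1)^d), extended by zero *)
Definition test_fun (phi : 'rV[R]_d -> R) : Prop :=
  smooth phi /\
  exists K, [/\ compact K, K `<=` cube & forall x, ~ K x -> phi x = 0].

Definition mideriv m (a : {ffun 'I_d -> 'I_m.+1}) (phi : 'rV[R]_d -> R) :=
  foldr (fun i psi => iter (a i) (pderiv i) psi) phi (enum 'I_d).

Definition miorder m (a : {ffun 'I_d -> 'I_m.+1}) : nat := (\sum_i a i)%N.

Definition weak_deriv m (a : {ffun 'I_d -> 'I_m.+1}) (v g : pt -> R) : Prop :=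
  forall phi, test_fun phi ->
    inner v (mideriv a phi \o rv) =
    (-1) ^+ miorder a * inner g (phi \o rv).

Definition edist (x y : pt) : R :=
  Num.sqrt (\sum_i (tnth x i - tnth y i) ^+ 2).

Definition slobodeckij (sigma : R) (v : pt -> R) : \bar R :=
  (\int[vol]_x \int[vol]_y
     ((v x - v y) ^+ 2 / edist x y `^ (d%:R + 2 * sigma))%:E)%E.

(* For s = m + sigma with m integer and 0 <= sigma < 1, the square root of
     sum_{|a| <= m} ||D^a v||_{L^2}^2 + sum_{|a| = m} [D^a v]_sigma^2,
   the second sum being present only when sigma > 0. Weak derivatives being
   unique up to null sets, all admissible families [g] give the same value, and
   the infimum is +oo exactly when v does not belong to H^s. *)
Definition sobolev_norm (s : R) (v : pt -> R) : \bar R :=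
  let m := Num.truncn s in
  let sigma := s - m%:R in
  ereal_inf
    [set sqrte (\sum_(a : {ffun 'I_d -> 'I_m.+1} | (miorder a <= m)%N)
                   L2norm (g a) ^+ 2
                + if (0 < sigma)%R then
                    \sum_(a : {ffun 'I_d -> 'I_m.+1} | miorder a == m)
                      slobodeckij sigma (g a)
                  else 0)%E
     | g in [set g : {ffun 'I_d -> 'I_m.+1} -> pt -> R | L2 v /\
         forall a, (miorder a <= m)%N -> L2 (g a) /\ weak_deriv a v (g a)]].

(* v belongs to H^1_0, the closure of the test functions in H^1, and has weak
   gradient g. *)
Definition H10_grad (v : pt -> R) (g : 'I_d -> pt -> R) : Prop :=
  [/\ L2 v, forall i, L2 (g i) &
  exists phi : nat -> 'rV[R]_d -> R, [/\ forall n, test_fun (phi n),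
    L2norm (fun x => phi n (rv x) - v x) @[n --> \oo] --> 0%E &
    forall i, L2norm (fun x => pderiv i (phi n) (rv x) - g i x)
                @[n --> \oo] --> 0%E]].

(* v is a (weak) solution in H^1_0 of - Laplacian v = mu v. *)
Definition dirichlet_eigen (mu : R) (v : pt -> R) : Prop :=
  exists2 g, H10_grad v g &
    forall phi, test_fun phi ->
      \sum_i inner (g i) (pderiv i phi \o rv) = mu * inner v (phi \o rv).

(* v = sum_j c_j e_j, with convergence in L^2 *)
Definition L2_expansion (e : nat -> pt -> R) (c : nat -> R) (v : pt -> R) :=
  L2 v /\
  L2norm (fun x => v x - \sum_(j < n) c j * e j x) @[n --> \oo] --> 0%E.

Definition coef (e : nat -> pt -> R) (v : pt -> R) : nat -> R :=
  fun j => inner v (e j).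

Definition orthonormal_basis (e : nat -> pt -> R) : Prop :=
  [/\ forall j, L2 (e j),
      forall i j, inner (e i) (e j) = (i == j)%:R &
      forall v, L2 v -> L2_expansion e (coef e v) v].

Definition dirichlet_eigenpairs (lam : nat -> R) (e : nat -> pt -> R) : Prop :=
  orthonormal_basis e /\ forall j, 0 < lam j /\ dirichlet_eigen (lam j) (e j).

(* norm of \dot H^s, of the generalized function with coefficients c *)
Definition doth_norm (lam : nat -> R) (s : R) (c : nat -> R) : \bar R :=
  sqrte (\sum_(0 <= j <oo) (lam j `^ s * c j ^+ 2)%:E)%E.

(* Elements of H^s are functions if s >= 0; if s < 0, H^s is \dot H^s, whose
   elements are generalized functions given by their coefficients in the
   eigenbasis. *)
Definition Helt (s : R) : Type := (if 0 <= s then pt else nat) -> R.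

Definition Hnorm (lam : nat -> R) (s : R) : Helt s -> \bar R :=
  (if 0 <= s as b return ((if b then pt else nat) -> R) -> \bar R
   then sobolev_norm s else doth_norm lam s).

Definition Hemb (e : nat -> pt -> R) (s : R) (v : pt -> R) : Helt s :=
  (if 0 <= s as b return (if b then pt else nat) -> R
   then v else coef e v).

Definition Hdist (lam : nat -> R) (s : R) (v w : Helt s) : \bar R :=
  Hnorm lam (fun k => v k - w k).

Definition Hopen (lam : nat -> R) (s : R) (U : set (Helt s)) : Prop :=
  forall v, U v -> exists2 r : R, 0 < r &
    forall w, (Hdist lam w v < r%:E)%E -> U w.

End Domain.
Arguments Hemb {R d} e s v.

Section Contour.
Context {R : realType}.
Local Open Scope complex_scope.

Definition cexp (z : R[i]) : R[i] :=
  (expR (complex.Re z) * cos (complex.Im z)) +i*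
  (expR (complex.Re z) * sin (complex.Im z)).

Definition polar (r phi : R) : R[i] := (r * cos phi) +i* (r * sin phi).

(* principal power z^a of z = r e^{i phi}, -pi < phi < pi *)
Definition cpow (r phi a : R) : R[i] := polar (r `^ a) (a * phi).

Definition cintegral (D : set R) (h : R -> R[i]) : R[i] :=
  (\int[lebesgue_measure]_(x in D) complex.Re (h x)) +i*
  (\int[lebesgue_measure]_(x in D) complex.Im (h x)).

(* Integral over Gamma_{beta,tau}, counterclockwise, of a function g given in
   the polar coordinates (r, phi) of z: the ray of angle -beta is run inwards,
   then the arc, then the ray of angle beta outwards. *)
Definition contour (beta tau : R) (g : R -> R -> R[i]) : R[i] :=
  cintegral `[tau, +oo[ (fun r => g r beta * polar 1 beta
                                  - g r (- beta) * polar 1 (- beta)) +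
  cintegral `[- beta, beta] (fun phi => g tau phi * ((0 +i* 1) * polar tau phi)).

Variables (alpha beta tau : R) (lam : nat -> R).

(* (z^alpha + A)^{-1}, acting on coefficients in the eigenbasis of A *)
Definition resolvent (r phi : R) (c : nat -> R) (j : nat) : R[i] :=
  (c j)%:C / (cpow r phi alpha + (lam j)%:C).

(* F(t) and E(t), acting on coefficients in the eigenbasis of A. The contour
   being symmetric, the integrals are real: Re drops no information. *)
Definition Fop (t : R) (c : nat -> R) (j : nat) : R :=
  complex.Re ((0 +i* (2 * pi))^-1 * contour beta tau (fun r phi =>
    cexp (t%:C * polar r phi) * cpow r phi (alpha - 1) * resolvent r phi c j)).

Definition Eop (t : R) (c : nat -> R) (j : nat) : R :=
  complex.Re ((0 +i* (2 * pi))^-1 * contour beta tau (fun r phi =>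
    cexp (t%:C * polar r phi) * resolvent r phi c j)).

End Contour.

Section Model.
Context {R : realType} {d : nat}.
Implicit Types (theta : pt R d -> R) (u : R -> pt R d -> R).

(* u(t) = F(t) theta + int_0^t E(t - s) f(u(s)) ds in L^2, 0 < t <= T. The
   integrand is required to be Bochner integrable: it is L^2-valued, weakly
   measurable (L^2 is separable) and has integrable norm; the coefficients of
   the integral are then the integrals of the coefficients. *)
Definition mild_solution (alpha beta tau T : R) (lam : nat -> R)
    (e : nat -> pt R d -> R) (f : R -> R) theta u : Prop :=
  let fu s := coef e (fun x => f (u s x)) in
  let duhamel t s := Eop alpha beta tau lam (t - s) (fu s) in
  [/\ measurable_fun [set: measurableTypeR R * pt R d] (fun p => u p.1 p.2),
      {ae vol, forall x, u 0 x = theta x},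
      {ae lebesgue_measure, forall s, 0 < s < T -> L2 (fun x => f (u s x))} &
      forall t, 0 < t <= T ->
        [/\ forall j, measurable_fun `]0, t[ (fun s => duhamel t s j),
            (\int[lebesgue_measure]_(s in `]0%R, t[)
               sqrte (\sum_(0 <= j <oo) (duhamel t s j ^+ 2)%:E) < +oo)%E &
            L2_expansion e (fun j =>
               Fop alpha beta tau lam t (coef e theta) j +
               \int[lebesgue_measure]_(s in `]0, t[) duhamel t s j) (u t)]].

Definition L2L2norm (T : R) u : \bar R :=
  sqrte (\int[lebesgue_measure]_(t in `]0%R, T]) L2norm (u t) ^+ 2)%E.

Section Observations.
Variables (T : R) (T_gt0 : 0 < T).

(* The sample space of one observation consists of triples (noise, x, t). *)
Definition sampling : probability (obs R d) R :=
  ((normal_prob 0 1 \x vol) \x uniform_prob T_gt0)%E.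

Definition observe u (w : obs R d) : obs R d :=
  (u w.2 w.1.2 + w.1.1, w.1.2, w.2).

Definition data_law u (N : nat) (S : set (N.-tuple (obs R d))) :
    \bar R :=
  pushforward (iid sampling N)
    (fun w : N.-tuple (obs R d) => map_tuple (observe u) w) S.

(* Estimators: Borel measurable H^s-valued functions of the data *)
Definition estimator (lam : nat -> R) (s : R) (N : nat)
    (est : N.-tuple (obs R d) -> @Helt R d s) : Prop :=
  (forall D, (Hnorm lam (est D) < +oo)%E) /\
  forall U, Hopen lam U -> measurable (est @^-1` U).

Definition minimax_prob (lam : nat -> R) (e : nat -> pt R d -> R)
    (u : (pt R d -> R) -> R -> pt R d -> R)
    (Theta : set (pt R d -> R)) (s : R) (N : nat) (r : R) : \bar R :=
  ereal_inf [set
    ereal_sup [set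
      data_law (u theta)
        [set D | (r%:E < Hdist lam (est D) (Hemb e s theta))%E]
    | theta in Theta]
  | est in @estimator lam s N].
End Observations.

End Model.

(* Main.v *)
Require Import Defs.
From HB Require Import structures.
From mathcomp Require Import all_boot all_order all_algebra.
From mathcomp Require Import all_classical all_reals all_analysis.
From mathcomp Require Import measurable_realfun.
From mathcomp Require Import ring lra zify.

(* Fano-type lower bound, in the strong-converse form: the error probability tends
   to 1. Cut the cube into J^d cells (J = 2^j) and put theta_b = delta J^(-gam-1) times
   the sum, over the cells l with b(l) = 1, of a fixed smooth bump rescaled to l and
   differentiated once. Then ||theta_b||_{H^gam} <= B. The derivative gives
   ||theta_b - theta_b'||_{H^-mu} <= C J^(-gam-mu): by Bessel's inequality for the
   gradients of the eigenfunctions, the H^-1 norm of d_1 W is at most ||W||_{L^2}. And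
   ||theta_b - theta_b'||_{H^xi} >= c J^(-gam+xi) as soon as b and b' differ on 1/8 of
   the cells; such vectors b are spread so well that a Hamming ball of radius J^d / 8
   contains a fraction at most (3/4)^(J^d) of the hypercube.

   An estimator of accuracy (c/2) J^(-gam+xi) confines b to such a ball. For data
   which do not depend on b, it is thus right for some b with probability at most
   (3/4)^(J^d). The law of the data is compared with such a reference law by
   Hoelder's inequality, which tensorizes: P^N(A) <= C^N Q^N(A)^(s/(1+s)), C being
   controlled by the moment of order 1 + s of the likelihood ratio of one observation.
   Only the L^2 norm of u_theta - u_0 is controlled (it may be unbounded), so the
   Gaussian noise of the reference law is mixed with a Cauchy law of weight eta, which
   makes that moment 1 + O(s (eta + |u_theta - u_0|^2)), uniformly. With
   N <= kappa J^(2 gam + 2 mu + d), s = 1/(j+2) and eta = J^-(2 gam + 2 mu + d) / 2,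
   C^N is beaten by the small factor. *)

Set Implicit Arguments.
Unset Strict Implicit.
Unset Printing Implicit Defensive.
Import Order.TTheory GRing.Theory Num.Theory.
Import numFieldNormedType.Exports.
Local Open Scope classical_set_scope.
Local Open Scope ring_scope.

(** * Smooth bump *)

(** [C] is chosen before [eps], so the error probability has to tend to 1 at a fixed multiple of the
    rate. Fano's inequality with Kullback divergences would only give 1 - O(kappa), with [C]
    depending on kappa; Hoelder's inequality keeps an exponentially small factor instead. The
    balance, with N of order kappa J^p and p = 2 gam + 2 mu + d: the squared L^2 distance of the
    solutions is O(J^(d - p)), so C^N is at most exp (O(kappa s J^d)), while (3/4)^(J^d) to the
    power s/(1+s) is at most exp (- c s J^d). A small kappa makes the second factor win, by a margin
    that tends to infinity as soon as s J^d does. For a shift h, the Gaussian likelihood ratio has a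
    moment of order 1 + s that is exponential in h^2, which an L^2 bound on h cannot control.
    Against the Cauchy component the growth is only h^(2s), at most 1 + s h^2, at the price of a
    factor eta^(-s). That factor stays bounded only if s is at most of order 1/log (1/eta), which is
    1/j when eta is a power of J: hence s = 1/(j+2), for which s J^d still tends to infinity. *)

Section Bump.
Context {R : realType}.

(** The bump is exp (-1/D) where this quadratic D is positive, that is on (1/4, 3/4): a rescaled
    bump stays a quarter of a cell away from the walls of its cell. *)
Definition bumpD (x : R) : R := (x - 1 / 4) * (3 / 4 - x).

Definition bumpP : {poly R} := ('X - (1 / 4)%:P) * ((3 / 4)%:P - 'X).

Lemma bumpPE x : bumpP.[x] = bumpD x.
Proof. by rewrite /bumpP /bumpD !hornerE. Qed.

(* The derivatives of exp (-1/D) on {D > 0} are all of this form; [bump k] is the k-th one. *)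
Definition bumpf (p : {poly R}) (n : nat) (x : R) : R :=
  if 0 < bumpD x then p.[x] * (bumpD x)^-1 ^+ n * expR (- (bumpD x)^-1) else 0.

(** Numerator of the derivative of p D^-n exp (-1/D), over the common denominator D^(n+2). *)
Definition bump_next (p : {poly R}) (n : nat) : {poly R} :=
  p^`() * bumpP ^+ 2 - p * bumpP^`() * bumpP *+ n + p * bumpP^`().

Lemma bumpD_le1 (x : R) : bumpD x <= 1.
Proof. by rewrite /bumpD; nra. Qed.

Lemma bumpD_gt0 (x : R) : (0 < bumpD x) = (1 / 4 < x < 3 / 4).
Proof.
rewrite /bumpD; apply/idP/idP => [h|/andP[h1 h2]]; last first.
  by rewrite mulr_gt0// subr_gt0.
apply/andP; split; first by rewrite ltNge; apply/negP => h1; nra.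
by rewrite ltNge; apply/negP => h1; nra.
Qed.

(** One term of the exponential series, D^-(n+2) / (n+2)! <= exp (1/D), absorbs the negative powers
    of D and leaves D^2. The square is what makes the extension by zero differentiable at the end
    points. *)
Lemma bumpf_bound (p : {poly R}) n : exists2 C : R, 0 <= C &
  forall x, 0 < bumpD x -> `|bumpf p n x| <= C * bumpD x ^+ 2.
Proof.
have [M M0 hM] : exists2 M : R, 0 <= M &
    forall x, 0 < bumpD x -> `|p.[x]| <= M.
  have cp : {within `[0, 1], continuous (fun x => `|p.[x]|)}.
    apply: continuous_subspaceT => x; apply: (@continuous_comp _ _ _ (horner p) (@Num.norm _ R)).
      exact: continuous_horner.
    exact: norm_continuous.
  have [c _ hc] := EVT_max ler01 cp.
  exists `|p.[c]| => // x; rewrite bumpD_gt0 => /andP[h1 h2].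
  by apply: hc; rewrite in_itv/=; apply/andP; split; lra.
exists (M * (n.+2)`!%:R); first by rewrite mulr_ge0.
move=> x Dx; rewrite /bumpf Dx 2!normrM -!mulrA ler_pM//; first exact: hM.
have D1 : 0 < (bumpD x)^-1 by rewrite invr_gt0.
rewrite ger0_norm ?exprn_ge0 ?(ltW D1)//.
rewrite [`|expR _|]ger0_norm ?expR_ge0//.
have h : (bumpD x)^-1 ^+ n.+2 / n.+2`!%:R <= expR (bumpD x)^-1.
  by apply: le_trans (expR_ge1Dxn n.+1 (ltW D1)); rewrite lerDr.
rewrite expRN ler_pdivrMr ?expR_gt0// -ler_pdivrMl; last first.
  by rewrite mulr_gt0 ?exprn_gt0// ltr0n fact_gt0.
apply: le_trans h; rewrite invfM [leRHS]mulrC -mulrA ler_wpM2l//.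
by rewrite -(addn2 n) exprD mulrC !exprVn.
Qed.

Lemma is_derive_quad (f : R -> R) (x C : R) : f x = 0 ->
  (forall y, `|f y| <= C * (y - x) ^+ 2) -> is_derive x 1 f 0.
Proof.
move=> fx hf.
have C0 : 0 <= C.
  by have := le_trans (normr_ge0 _) (hf (x + 1)); rewrite addrAC subrr add0r expr1n mulr1.
have H : h^-1 *: (f (h *: 1 + x) - f x) @[h --> 0^'] --> (0 : R).
  have HC : C * `|h| @[h --> (0:R)^'] --> C * `|0 : R|.
    apply: cvgM; first exact: cvg_cst.
    apply: cvg_norm; apply: (@cvg_trans _ (nbhs (0 : R))); last exact: cvg_id.
    exact: cvg_within.
  rewrite normr0 mulr0 in HC.
  apply/norm_cvg0P.
  apply: (@squeeze_cvgr _ _ _ _ (fun=> 0) (fun h => C * `|h|)); last 2 first.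
  - exact: cvg_cst.
  - exact: HC.
  near=> h.
  have h0 : h != 0 by near: h; exact: nbhs_dnbhs_neq.
  rewrite normr_ge0/= fx subr0 normrZ normfV ler_pdivrMl ?normr_gt0//.
  apply: le_trans (hf _) _; rewrite addrK scaler1.
  have -> : (h : R) ^+ 2 = `|h| * `|h| by rewrite -expr2 real_normK ?num_real.
  by rewrite mulrCA.
by apply: DeriveDef; [apply/cvg_ex; exists 0|exact: cvg_lim].
Unshelve. all: by end_near.
Qed.

Lemma is_derive_bumpf p n (x : R) :
  is_derive x 1 (bumpf p n) (bumpf (bump_next p n) n.+2 x).
Proof.
have [Dx|Dx] := ltP 0 (bumpD x); last first.
  rewrite {2}/bumpf ltNge Dx/=.
  have [C C0 hC] := bumpf_bound p n.
  apply: (@is_derive_quad _ _ C); first by rewrite /bumpf ltNge Dx.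
  move=> y; have [Dy|Dy] := ltP 0 (bumpD y); last first.
    by rewrite /bumpf ltNge Dy normr0 mulr_ge0// sqr_ge0.
  apply: le_trans (hC _ Dy) _; rewrite ler_wpM2l//.
  (* Since x is outside the support and y inside, [bumpD y] is at most the distance from y to x. *)
  rewrite -[leRHS]real_normK ?num_real// lerXn2r ?nnegrE ?(ltW Dy)//.
  move: Dy (Dy) Dx; rewrite {1}bumpD_gt0 => /andP[y1 y2].
  rewrite /bumpD => Dy Dx.
  have [x1|x1] := leP x (1 / 4).
    by rewrite ger0_norm; nra.
  have x2 : 3 / 4 <= x by nra.
  by rewrite ler0_norm; nra.
have -> : bumpf (bump_next p n) n.+2 x =
  (p.[x] * (bumpD x)^-1 ^+ n) * (expR (- (bumpD x)^-1) * (bumpP^`().[x] / bumpD x ^+ 2))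
  + expR (- (bumpD x)^-1) * (p.[x] * (- (bumpP^`().[x] * (bumpD x)^-1 ^+ n.+1 *+ n))
    + (bumpD x)^-1 ^+ n * p^`().[x]).
  rewrite /bumpf Dx /bump_next; move: (bumpPE x); move: bumpP => q qE.
  rewrite !(hornerD, hornerN, hornerM, hornerMn, horner_exp) !qE.
  rewrite -[in LHS](mulr_natr _ n) -[in RHS](mulr_natr _ n) [in LHS]exprS [in LHS]exprS [in RHS](exprS _ n).
  move: Dx => /lt0r_neq0; move: (bumpD x) (expR _) => D E D0.
  by move: (D^-1 ^+ n) => W; field; rewrite D0.
apply: (@near_eq_is_derive _ _ _ (fun y => p.[y] * (bumpD y)^-1 ^+ n * expR (- (bumpD y)^-1))).
- have cD : {for x, continuous bumpD}.
    rewrite -(_ : horner bumpP = bumpD); first exact: continuous_horner.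
    by apply/funext => y; exact: bumpPE.
  have := cD; move/cvgr_gt => /(_ _ Dx).
  by apply: filterS => y Dy; rewrite /bumpf Dy.
have dD : is_derive x 1 bumpD bumpP^`().[x].
  rewrite -(_ : horner bumpP = bumpD); first exact: is_derive_poly.
  by apply/funext => y; exact: bumpPE.
have dV : is_derive x 1 (fun y => (bumpD y)^-1) (- (bumpP^`().[x] * (bumpD x) ^- 2)).
  apply: DeriveDef; first by apply: derivableV; [exact: lt0r_neq0|case: dD].
  have [d1 d2] := dD; rewrite (deriveV (lt0r_neq0 Dx) d1) d2.
  by rewrite /GRing.scale/= mulNr mulrC.
have dE : is_derive x 1 (fun y => expR (- (bumpD y)^-1))
    (expR (- (bumpD x)^-1) * (bumpP^`().[x] / bumpD x ^+ 2)).
  have := @is_derive1_comp _ expR (fun y => - (bumpD y)^-1) x _ _ (is_derive_expR _) (is_deriveN dV).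
  by rewrite opprK.
have dX := is_deriveX n dV.
have dP := is_deriveM (is_derive_poly p x) dX.
have dM := is_deriveM dP dE.
have XE (y : R) : ((fun y : R => (bumpD y)^-1) ^+ n) y = (bumpD y)^-1 ^+ n.
  by rewrite exprfctE.
have -> : (fun y => p.[y] * (bumpD y)^-1 ^+ n * expR (- (bumpD y)^-1)) =
  horner p * (fun y : R => (bumpD y)^-1) ^+ n * (fun y : R => expR (- (bumpD y)^-1)).
  by apply/funext => y; rewrite !mulrfctE XE.
apply: (is_derive_eq dM); rewrite !mulrfctE XE.
move: (bumpD x) (expR _) (bumpP^`().[x]) Dx => D E P /lt0r_neq0 D0.
rewrite /GRing.scale/= -mulNrn; congr (_ + _); congr (_ * (_ + _)).
congr (_ * _); case: n {dX dP dM XE} => [|n]; first by rewrite !mul0r mulr0n.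
rewrite /= -[RHS]mulr_natr !(exprS D^-1); field.
by rewrite D0.
Qed.

Fixpoint bump_code (k : nat) : {poly R} * nat :=
  if k is k'.+1 then
    let c := bump_code k' in (bump_next c.1 c.2, c.2.+2)
  else (1, 0%N).

Definition bump (k : nat) : R -> R := bumpf (bump_code k).1 (bump_code k).2.

Lemma is_derive_bump k (x : R) : is_derive x 1 (bump k) (bump k.+1 x).
Proof. exact: is_derive_bumpf. Qed.

Lemma continuous_bump k : continuous (bump k).
Proof.
move=> x; apply/differentiable_continuous/derivable1_diffP.
by have [] := is_derive_bump k x.
Qed.

Lemma bump_out k (x : R) : ~~ (1 / 4 < x < 3 / 4) -> bump k x = 0.
Proof. by rewrite -bumpD_gt0 /bump /bumpf => /negbTE ->. Qed.

Lemma bump0_gt0 (x : R) : 1 / 4 < x < 3 / 4 -> 0 < bump 0 x.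
Proof.
by rewrite -bumpD_gt0 /bump /bumpf/= => ->; rewrite ?hornerE ?mul1r ?mulr1 expR_gt0.
Qed.

Lemma bump_bounded k : exists2 M : R, 0 < M & forall x, `|bump k x| <= M.
Proof.
have [C C0 hC] := bumpf_bound (bump_code k).1 (bump_code k).2.
exists (C + 1) => [|x]; first by rewrite ltr_wpDl.
have [Dx|Dx] := ltP 0 (bumpD x).
  apply: le_trans (hC _ Dx) _; have := bumpD_le1 x => D1.
  by apply: (@le_trans _ _ C); rewrite ?lerDl// ler_piMr// exprn_ile1// ltW.
by rewrite /bump /bumpf ltNge Dx/= normr0 addr_ge0.
Qed.

Lemma bump_lipschitz k : exists2 L : R, 0 < L &
  forall x y, `|bump k x - bump k y| <= L * `|x - y|.
Proof.
have [M M0 hM] := bump_bounded k.+1; exists M => //.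
have H x y : x <= y -> `|bump k x - bump k y| <= M * `|x - y|.
  move=> xy; rewrite distrC [`|x - y|]distrC.
  have cb : {within `[x, y], continuous (bump k)}.
    by apply: continuous_subspaceT; exact: continuous_bump.
  have [c _ ->] := MVT_segment xy (fun z _ => is_derive_bump k z) cb.
  by rewrite normrM ler_wpM2r.
move=> x y; have [/H//|/ltW/H] := leP x y.
by rewrite distrC [`|x - y|]distrC.
Qed.

(** If the next derivative vanished identically, the current one would be constant, hence zero by
    its compact support. *)
Lemma bump_nonzero k : exists x, bump k x != 0.
Proof.
elim: k => [|k [x kx]].
  by exists (1 / 2); apply: lt0r_neq0; apply: bump0_gt0; lra.
apply/not_existsP => H; move/eqP: kx; apply.
have d0 (z : R) : is_derive z 1 (bump k) 0.
  have -> : 0 = bump k.+1 z by apply/esym/eqP/negPn/negP => /(H z).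
  exact: is_derive_bump.
rewrite (is_derive_0_is_cst x 0 d0); apply: bump_out; lra.
Qed.

Lemma bump_lower k : exists (p q c : R), [/\ 1 / 4 < p, p < q, q < 3 / 4, 0 < c &
  forall x, p <= x <= q -> c <= (bump k x) ^+ 2].
Proof.
have [x kx] := bump_nonzero k.
have xin : 1 / 4 < x < 3 / 4 by apply: contraNT kx => /(bump_out k) ->.
have [L L0 hL] := bump_lipschitz k.
pose e := Num.min (`|bump k x| / (2 * L)) (Num.min (x - 1 / 4) (3 / 4 - x)).
have nk : 0 < `|bump k x| by rewrite normr_gt0.
have e0 : 0 < e.
  by rewrite !lt_min divr_gt0 ?mulr_gt0// !subr_gt0.
have e1 : e <= `|bump k x| / (2 * L) by rewrite ge_min lexx.
have e2 : e <= x - 1 / 4 by rewrite !ge_min lexx orbT.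
have e3 : e <= 3 / 4 - x by rewrite !ge_min lexx !orbT.
exists (x - e / 2), (x + e / 2), ((`|bump k x| / 2) ^+ 2); split; try lra.
  by rewrite exprn_gt0// divr_gt0.
move=> y /andP[y1 y2]; rewrite -[leRHS]real_normK ?num_real//.
rewrite lerXn2r ?nnegrE ?divr_ge0//.
have h1 : `|bump k x - bump k y| <= `|bump k x| / 2.
  apply: le_trans (hL x y) _.
  have : `|x - y| <= e by rewrite ler_norml; apply/andP; split; lra.
  move=> /le_trans/(_ e1); rewrite invfM mulrA ler_pdivlMr// mulrC => h.
  by [].
have h2 := ler_distD 0 (bump k x) (bump k y).
have : `|bump k x| <= `|bump k x - bump k y| + `|bump k y|.
  by rewrite -{1}(subrK (bump k y) (bump k x)) ler_normD.
by move=> h; lra.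
Qed.

End Bump.

(** * Independent samples *)

(** The integral of a nonnegative function is a supremum over the simple functions below it, hence
    monotone for arbitrary, possibly non-measurable, functions. *)
Lemma le_integralT d (T : measurableType d) (R : realType)
    (mu : {measure set T -> \bar R}) (f g : T -> \bar R) :
  (forall x, 0 <= f x)%E -> (forall x, f x <= g x)%E ->
  (\int[mu]_x f x <= \int[mu]_x g x)%E.
Proof.
move=> f0 fg; have g0 x : (0 <= g x)%E by exact: le_trans (fg x).
rewrite !ge0_integralTE//; apply: le_ereal_sup => _ [h /= hf <-].
by exists h => // x; exact: le_trans (fg x).
Qed.

Lemma integral_prob_cst d (T : measurableType d) (R : realType) (P : probability T R) (r : R) :
  (\int[P]_x r%:E = r%:E)%E.
Proof. by rewrite integral_cst// [X in (_ * X)%E]probability_setT mule1. Qed.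

Lemma le_eq_trans (R : realType) (x y z : \bar R) : x = y -> (y <= z)%E -> (x <= z)%E.
Proof. by move=> ->. Qed.

Lemma le_of_eq disp (T : porderType disp) (x y : T) : x = y -> (x <= y)%O.
Proof. by move=> ->. Qed.

Lemma integrable_prod_bounded d1 d2 (X : measurableType d1) (Y : measurableType d2)
    (R : realType) (P : probability X R) (Q : probability Y R) (G : X * Y -> R) (M : R) :
  measurable_fun [set: X * Y] G -> (forall w, `|G w| <= M) ->
  (P \x Q)%E.-integrable setT (EFin \o G).
Proof.
move=> mG hM; apply: measurable_bounded_integrable => //.
  rewrite -setXTT [ltLHS]product_measure1E//.
  by rewrite ![_ setT](@probability_setT) mule1 ltry.
exists M; split; first exact: num_real.
by move=> y My w _ /=; apply: le_trans (hM _) _; exact: ltW.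
Qed.

Section IidIntegral.
Context {disp : measure_display} {X : measurableType disp} {R : realType}.
Variable P : probability X R.
Local Open Scope ereal_scope.

Lemma ge0_integral_iidS n (G : n.+1.-tuple X -> \bar R) :
  measurable_fun [set: n.+1.-tuple X] G -> (forall w, 0 <= G w) ->
  \int[iid P n.+1]_w G w =
  \int[P]_x \int[iid P n]_y G (Defs.cons_tuple (x, y)).
Proof.
move=> mG G0; rewrite [LHS]ge0_integral_distribution//.
rewrite fubini_tonelli1//=.
by apply: measurableT_comp => //; exact: Defs.measurable_cons_tuple.
Qed.

Lemma integrable_iid_bounded n (G : n.-tuple X -> R) (M : R) :
  measurable_fun setT G -> (forall w, (`|G w| <= M)%R) ->
  (iid P n).-integrable setT (EFin \o G).
Proof.
move=> mG hM; apply: measurable_bounded_integrable => //.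
  exact: fin_num_fun_lty.
exists M; split; first exact: num_real.
by move=> y My w _ /=; apply: le_trans (hM w) _; exact: ltW.
Qed.

Lemma integral_iidS n (G : n.+1.-tuple X -> R) (M : R) :
  measurable_fun setT G -> (forall w, (`|G w| <= M)%R) ->
  \int[iid P n.+1]_w (G w)%:E =
  \int[P]_x \int[iid P n]_y (G (Defs.cons_tuple (x, y)))%:E.
Proof.
move=> mG hM.
have mGc : measurable_fun setT (fun p : X * n.-tuple X => (G (Defs.cons_tuple p))%:E).
  by apply/measurable_EFinP; exact: measurableT_comp.
have iG : (P \x iid P n).-integrable setT (fun p : X * n.-tuple X => (G (Defs.cons_tuple p))%:E).
  apply: integrable_prod_bounded (fun p => hM (Defs.cons_tuple p)).
  exact: measurableT_comp.
rewrite [LHS]integral_distribution//; last exact/measurable_EFinP.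
by rewrite -integral12_prod_meas1.
Qed.

End IidIntegral.

Section SetCoord.
Context {R : realType}.
Local Notation RM := (measurableTypeR R).

Definition tset n (i : 'I_n) (t : RM) (x : n.-tuple RM) : n.-tuple RM :=
  [tuple if j == i then t else tnth x j | j < n].

Lemma tnth_tset n (i j : 'I_n) t x :
  tnth (tset i t x) j = if j == i then t else tnth x j.
Proof. by rewrite tnth_mktuple. Qed.

Lemma tset0_cons n t t0 (y : n.-tuple RM) :
  tset ord0 t (Defs.cons_tuple (t0, y)) = Defs.cons_tuple (t, y).
Proof.
apply: eq_from_tnth => j; rewrite tnth_tset; case: eqP => [->//|/eqP j0].
by case: (unliftP ord0 j) j0 => [k ->|-> /eqP//] _; rewrite !tnthS.
Qed.

Lemma tsetS_cons n (i : 'I_n) t t0 (y : n.-tuple RM) :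
  tset (lift ord0 i) t (Defs.cons_tuple (t0, y)) = Defs.cons_tuple (t0, tset i t y).
Proof.
apply: eq_from_tnth => j; rewrite tnth_tset.
case: (unliftP ord0 j) => [k ->|->]; last by [].
by rewrite (inj_eq lift_inj) !tnthS tnth_tset.
Qed.

Lemma measurable_tset n (i : 'I_n) (x : n.-tuple RM) :
  measurable_fun setT (fun t : RM => tset i t x).
Proof.
apply/measurable_fun_tnthP => j /=.
have [->|ji] := eqVneq j i.
  by apply: eq_measurable_fun (@measurable_id _ _ setT) => t _ /=; rewrite tnth_tset eqxx.
apply: eq_measurable_fun (measurable_cst (tnth x j)) => t _ /=.
by rewrite tnth_tset (negbTE ji).
Qed.

(** Fubini with the i-th coordinate integrated first. It reduces integration by parts on the cube to
    the fundamental theorem of calculus on the unit interval. *)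
Lemma integral_iid_coord0 (P : probability RM R) n (i : 'I_n)
    (G : n.-tuple RM -> R) (M : R) :
  measurable_fun setT G -> (forall w, `|G w| <= M) ->
  (forall x, \int[P]_t (G (tset i t x))%:E = 0)%E ->
  (\int[iid P n]_x (G x)%:E = 0)%E.
Proof.
elim: n i G => [[]//|n IH] i G mG hM.
have mc p : measurable_fun setT (fun y : n.-tuple RM => G (Defs.cons_tuple (p, y))).
  apply: (measurableT_comp mG).
  apply: (measurableT_comp (@Defs.measurable_cons_tuple _ _ n)).
  exact: measurable_pair1.
case: (unliftP ord0 i) => [k ->|->] h0; rewrite (integral_iidS P mG hM); last first.
  pose G' p := (G (@Defs.cons_tuple _ RM n p))%:E.
  have mG' : measurable_fun setT G'.
    by apply/measurable_EFinP; exact: measurableT_comp.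
  have iG : (P \x iid P n)%E.-integrable setT G'.
    apply: integrable_prod_bounded (fun p => hM (Defs.cons_tuple p)).
    exact: measurableT_comp.
  rewrite (Fubini iG); apply: integral0_eq => y _.
  (* The first coordinate 0 is a placeholder, overwritten by [tset]. *)
  by rewrite -(h0 (Defs.cons_tuple ((0 : R) : RM, y))); apply: eq_integral => t _; rewrite tset0_cons.
apply: integral0_eq => t0 _; apply: (IH k) => //.
by move=> y; rewrite -(h0 (Defs.cons_tuple (t0, y))); apply: eq_integral => t _; rewrite tsetS_cons.
Qed.

Lemma measurable_box n (A : 'I_n -> set RM) : (forall i, measurable (A i)) ->
  measurable [set x : n.-tuple RM | forall i, A i (tnth x i)].
Proof.
move=> mA.
rewrite (_ : [set _ | _] = \bigcap_(i in [set: 'I_n]) ((fun x => tnth x i) @^-1` A i)).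
  apply: fin_bigcap_measurable => // i _.
  by rewrite -[X in measurable X]setTI; apply: measurable_tnth.
by apply/seteqP; split => x /= h i; [move=> _|]; apply: h.
Qed.

Lemma iid_box (P : probability RM R) n (A : 'I_n -> set RM) :
  (forall i, measurable (A i)) ->
  iid P n [set x | forall i, A i (tnth x i)] = (\prod_(i < n) P (A i))%E.
Proof.
elim: n A => [|n IH] A mA.
  by rewrite big_ord0 /= diracE mem_set//=; case.
rewrite big_ord_recl/= /distribution /pushforward.
rewrite (_ : _ @^-1` _ = A ord0 `*` [set y | forall i, A (lift ord0 i) (tnth y i)]).
  rewrite product_measure1E//; last exact: (measurable_box (A := fun i => A (lift ord0 i))).
  by congr (_ * _)%E; apply: (IH (fun i => A (lift ord0 i))).
apply/seteqP; split => [[t y] /= h|[t y] /= [h0 h] i].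
  by split; [exact: (h ord0)|move=> i; have := h (lift ord0 i); rewrite tnthS].
by case: (unliftP ord0 i) => [k ->|->//]; rewrite tnthS.
Qed.

End SetCoord.

(** * Measurability of continuous functions of the coordinates *)

Section RvMeasurable.
Context {R : realType} {d : nat}.
Local Notation ptd := (pt R d).

Lemma rvE (x : ptd) i : rv x 0 i = tnth x i.
Proof. by rewrite /rv mxE. Qed.

Lemma rv_tset i t (x : ptd) :
  rv (tset i t x) = (t - tnth x i) *: delta_mx 0 i + rv x.
Proof.
apply/rowP => j; rewrite !mxE tnth_tset eqxx/=.
by have [->|_] := eqVneq j i; rewrite ?mulr1 ?subrK ?mulr0 ?add0r.
Qed.

Lemma row_cvg (u : nat -> 'rV[R]_d) (l : 'rV[R]_d) :
  (forall i, u k 0 i @[k --> \oo] --> l 0 i) -> u k @[k --> \oo] --> l.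
Proof.
move=> h; apply/cvg_ballP => e e0.
have H i : \forall k \near \oo, ball (l 0 i) e (u k 0 i).
  by move/cvg_ballP : (h i) => /(_ _ e0).
have {}H : \forall k \near \oo, forall i, ball (l 0 i) e (u k 0 i).
  exact: filter_forall H.
by apply: filterS H => k hk; split => // i j; rewrite (ord1 i).
Qed.

(** Measurability refers to the product sigma-algebra of tuples. By continuity F is the limit of its
    values at the lower corners of grids of mesh 1/(k+1), and each of these functions is constant on
    countably many boxes. *)
Lemma measurable_rv (F : 'rV[R]_d -> R) :
  continuous F -> measurable_fun setT (fun x : ptd => F (rv x)).
Proof.
move=> cF.
pose g k (x : ptd) := \row_i ((Num.floor (k.+1%:R * tnth x i))%:~R / k.+1%:R : R).
apply: (@measurable_fun_cvg _ _ _ _ (fun k x => F (g k x))); last first.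
  move=> x _; apply: (@cvg_comp _ _ _ (g^~ x) F _ (nbhs (rv x))) => //; last exact: cF.
  apply: row_cvg => i; rewrite rvE.
  rewrite (_ : (fun k => _) = (fun k => (Num.floor (k.+1%:R * tnth x i))%:~R / k.+1%:R)); last first.
    by apply/funext => k; rewrite mxE.
  apply/cvgrPdist_le => e e0.
  near=> k.
  have k0 : 0 < k.+1%:R :> R by rewrite ltr0n.
  have := floor_le (k.+1%:R * tnth x i); have := floorD1_gt (k.+1%:R * tnth x i).
  rewrite intrD1; set z := (Num.floor _)%:~R => h1 h2.
  have -> : tnth x i - z / k.+1%:R = (k.+1%:R * tnth x i - z) / k.+1%:R.
    by field; rewrite addrC natr1.
  rewrite ger0_norm ?divr_ge0 ?subr_ge0// ler_pdivrMr//.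
  apply: (@le_trans _ _ 1); first by rewrite lerBlDr addrC ltW.
  have : e^-1 <= k.+1%:R.
    near: k; exists (Num.truncn e^-1) => // m /= hm.
    apply: ltW; apply: lt_le_trans (truncnS_gt _) _.
    by rewrite ler_nat ltnS.
  by rewrite -ler_pdivrMl// mulr1.
move=> k _ Y mY; rewrite setTI.
pose row (z : d.-tuple int) : 'rV[R]_d := \row_i ((tnth z i)%:~R / k.+1%:R).
pose S (z : d.-tuple int) := [set x : ptd | forall i, Num.floor (k.+1%:R * tnth x i) = tnth z i].
rewrite (_ : _ @^-1` _ = \bigcup_z (S z `&` [set x | Y (F (row z))])); last first.
  apply/seteqP; split => [x /= Yx|x [z _ [/= Sz Yz]]].
    exists [tuple Num.floor (k.+1%:R * tnth x i) | i < d] => //; split.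
      by move=> i; rewrite tnth_mktuple.
    rewrite /= (_ : row _ = g k x)//; apply/rowP => i.
    by rewrite !mxE tnth_mktuple.
  rewrite (_ : g k x = row z)//; apply/rowP => i.
  by rewrite !mxE (Sz i).
apply: countable_bigcupT_measurable => [|z].
  exact: countableP.
apply: measurableI; last first.
  have [h|h] := pselect (Y (F (row z))).
    by rewrite (_ : [set _ | _] = setT)//; apply/seteqP; split.
  by rewrite (_ : [set _ | _] = set0)//; apply/seteqP; split.
rewrite (_ : S z = [set x | forall i, [set t : measurableTypeR R | Num.floor (k.+1%:R * t) = tnth z i] (tnth x i)])//.
apply: (measurable_box (A := fun i => [set t : measurableTypeR R | Num.floor (k.+1%:R * t) = tnth z i])) => i.
rewrite (_ : [set _ | _] = `[(tnth z i)%:~R / k.+1%:R, (tnth z i + 1)%:~R / k.+1%:R[%classic).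
  exact: measurable_itv.
have k0 : 0 < k.+1%:R :> R by rewrite ltr0n.
apply/seteqP; split => t; rewrite /= in_itv/= ler_pdivrMr// ltr_pdivlMr// mulrC.
  by move=> <-; rewrite floor_le floorD1_gt.
by move=> h; exact: floor_def.
Unshelve. all: by end_near.
Qed.

End RvMeasurable.

(** * Integration by parts and L^2 *)

Section VolIBP.
Context {R : realType} {d : nat}.
Local Notation ptd := (pt R d).
Local Notation mu := lebesgue_measure.

Lemma integral_uniform01 (f : measurableTypeR R -> \bar R) :
  measurable_fun [set: measurableTypeR R] f ->
  (\int[uniform_prob (@ltr01 R)]_x f x = \int[mu]_(x in `[0%R, 1%R]) f x)%E.
Proof.
move=> mf; rewrite integralE [RHS]integralE !integral_uniform//=.
- by rewrite subr0 invr1 !mul1e.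
- exact: measurable_funeneg.
- exact: measurable_funepos.
Qed.

Definition curve (i : 'I_d) (x : ptd) (t : R) : 'rV[R]_d := rv (tset i t x).

Lemma is_derive_curve i (F : 'rV[R]_d -> R) (x : ptd) (t : R) :
  (forall y, derivable F y (delta_mx 0 i)) ->
  is_derive t 1 (F \o curve i x) (pderiv i F (curve i x t)).
Proof.
move=> dF.
have E (h : R) : F (curve i x (h *: 1 + t)) = F (h *: delta_mx 0 i + curve i x t).
  rewrite /curve !rv_tset addrA -scalerDl; congr (F (_ *: _ + _)).
  by rewrite /GRing.scale/= mulr1 addrA.
have E2 : (fun h : R => h^-1 *: ((F \o curve i x) (h *: 1 + t) - (F \o curve i x) t)) =
    (fun h : R => h^-1 *: (F (h *: delta_mx 0 i + curve i x t) - F (curve i x t))).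
  by apply/funext => h; rewrite /= E.
apply: DeriveDef.
  have := dF (curve i x t); rewrite /derivable.
  by under [X in _ -> cvg (X @ _)]eq_fun do rewrite /= E.
rewrite /derive /pderiv /derive.
by under [X in lim (X @ _) = _]eq_fun do rewrite /= E.
Qed.

Lemma continuous_curve i (x : ptd) : continuous (curve i x).
Proof.
move=> t; rewrite (_ : curve i x = fun t => (t - tnth x i) *: delta_mx 0 i + rv x); last first.
  by apply/funext => s; rewrite /curve rv_tset.
apply: cvgD; last exact: cvg_cst.
apply: cvgZl; apply: cvgB; [exact: cvg_id|exact: cvg_cst].
Qed.

(** On every line in direction i, the points with i-th coordinate 0 or 1 lie outside the open cube,
    so F vanishes at both ends of the interval of integration. *)
Lemma integral_pderiv0 i (F : 'rV[R]_d -> R) (M : R) :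
  (forall x, derivable F x (delta_mx 0 i)) ->
  continuous (pderiv i F) ->
  (forall x, ~ cube x -> F x = 0) ->
  (forall x, `|pderiv i F x| <= M) ->
  (\int[@vol R d]_x (pderiv i F (rv x))%:E = 0)%E.
Proof.
move=> dF cdF F0 hM.
apply: (integral_iid_coord0 (i := i) (M := M)).
- exact: measurable_rv.
- by move=> w; apply: hM.
move=> x; rewrite integral_uniform01; last first.
  apply/measurable_EFinP; apply: (measurableT_comp (measurable_rv cdF)).
  exact: measurable_tset.
have dg (t : R) := is_derive_curve x t dF.
have cg : continuous (F \o curve i x).
  by move=> t; apply/differentiable_continuous/derivable1_diffP; case: (dg t).
have cf : continuous (pderiv i F \o curve i x).
  by move=> t; apply: continuous_comp; [exact: continuous_curve|exact: cdF].
rewrite (@continuous_FTC2 _ (pderiv i F \o curve i x) (F \o curve i x))//.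
- rewrite /= !F0 ?subee//.
  + by move=> /(_ i); rewrite /curve rvE tnth_tset eqxx ltxx.
  + by move=> /(_ i); rewrite /curve rvE tnth_tset eqxx ltxx andbF.
- exact: continuous_subspaceT.
- split.
  + by move=> t _; case: (dg t).
  + by apply: cvg_at_right_filter; exact: cg.
  + by apply: cvg_at_left_filter; exact: cg.
- by move=> t _; rewrite derive1E; case: (dg t).
Qed.

Lemma cube_bounded (F : 'rV[R]_d -> R) : continuous F ->
  exists2 M : R, 0 <= M & forall x, cube x -> `|F x| <= M.
Proof.
move=> cF.
have K : compact [set v : 'rV[R]_d | forall i, `[0, 1]%classic (v ord0 i)].
  by apply: (@rV_compact R d (fun=> `[0, 1]%classic)) => i; exact: segment_compact.
have : compact (F @` [set v : 'rV[R]_d | forall i, `[0, 1]%classic (v ord0 i)]).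
  by apply: continuous_compact => //; exact: continuous_subspaceT.
move=> /compact_bounded [M [_ hM]].
exists (Num.max 0 (M + 1)); first by rewrite le_max lexx.
move=> x cx; rewrite le_max; apply/orP; right.
apply: (hM (M + 1)); first by rewrite ltrDl.
exists x => // i /=; rewrite in_itv/=.
by have /andP[/ltW -> /ltW ->] := cx i.
Qed.

End VolIBP.

(** * The pre-Hilbert structure of L^2 on the cube *)

Section L2kit.
Context {R : realType} {d : nat}.
Local Notation ptd := (pt R d).
Implicit Types (v w : ptd -> R).

Lemma L2norm_sqr v : (L2norm v ^+ 2 = \int[vol]_x ((v x) ^+ 2)%:E)%E.
Proof.
have -> : (L2norm v ^+ 2 = L2norm v `^ 2)%E.
  have := Lnorm_ge0 vol 2%:E (EFin \o v); rewrite -/(L2norm v).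
  case: (L2norm v) => [r r0|_|//]; first by rewrite poweR_EFin powR_mulrn.
  by rewrite expe2 mulyy /poweR pnatr_eq0.
rewrite /L2norm poweR_Lnorm//.
by apply: eq_integral => x _; rewrite /= powR_mulrn// real_normK// num_real.
Qed.

Lemma L2_meas v : L2 v -> measurable_fun [set: ptd] v.
Proof. by rewrite /L2 inE => /andP[]; rewrite inE. Qed.

Lemma L2P v : L2 v <-> measurable_fun [set: ptd] v /\
  (\int[vol]_x ((v x) ^+ 2)%:E < +oo)%E.
Proof.
split=> [L2v|[mv fv]].
  split; first exact: L2_meas.
  have /integrable_lty := Lfun2_integrable_sqr L2v; exact.
rewrite /L2 inE/=; apply/andP; split; rewrite inE//= /finite_norm.
move: fv; rewrite -L2norm_sqr /L2norm; case: ('N[_]_ _ [_])%E (Lnorm_ge0 vol 2%:E (EFin \o v)) => //=.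
by move=> r _ _; exact: ltry.
Qed.

Lemma L2_bounded v (M : R) : measurable_fun [set: ptd] v -> (forall x, `|v x| <= M) -> L2 v.
Proof.
move=> mv hM; apply/L2P; split => //.
apply: (@le_lt_trans _ _ (\int[@vol R d]_x (M ^+ 2)%:E)%E).
  apply: le_integralT => x; first by rewrite lee_fin sqr_ge0.
  by rewrite lee_fin -(real_normK (num_real (v x))) lerXn2r ?nnegrE// (le_trans _ (hM x)).
by rewrite integral_prob_cst ltry.
Qed.

Lemma L2_integrableM v w : L2 v -> L2 w ->
  vol.-integrable [set: ptd] (EFin \o (fun x => v x * w x)).
Proof. by move=> L2v L2w; apply/Lfun1_integrable/(Lfun2_mul_Lfun1 L2v L2w). Qed.

Let le12 : (1 <= 2%:E :> \bar R)%E. Proof. by rewrite lee_fin ler1n. Qed.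

Let L2_submod := Lfun_submod_closed (vol : probability ptd R) le12.

Lemma L20 : L2 (fun _ : ptd => 0 : R). Proof. exact: L2_submod.1. Qed.

Let L2_lin (a : R) v w : L2 v -> L2 w -> L2 (fun x => a * v x + w x).
Proof. exact: L2_submod.2. Qed.

Lemma L2D v w : L2 v -> L2 w -> L2 (fun x => v x + w x).
Proof. by move=> hv hw; have := L2_lin 1 hv hw; under eq_fun do rewrite mul1r. Qed.

Lemma L2Z (a : R) v : L2 v -> L2 (fun x => a * v x).
Proof. by move=> hv; have := L2_lin a hv L20; under eq_fun do rewrite addr0. Qed.

Lemma L2B v w : L2 v -> L2 w -> L2 (fun x => v x - w x).
Proof.
by move=> hv hw; have := L2_lin (-1) hw hv; under eq_fun do rewrite mulN1r addrC.
Qed.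

Lemma L2_sum I (r : seq I) (P : pred I) (f : I -> ptd -> R) :
  (forall i, P i -> L2 (f i)) -> L2 (fun x => \sum_(i <- r | P i) f i x).
Proof.
move=> h; rewrite (_ : (fun x => _) = \sum_(i <- r | P i) f i); last first.
  by apply/funext => x; rewrite fct_sumE.
apply: (big_ind (fun f => L2 f)) => //; first exact: L20.
by move=> f1 f2; exact: L2D.
Qed.

Lemma innerC v w : inner v w = inner w v.
Proof. by apply: eq_Rintegral => x _; rewrite mulrC. Qed.

Lemma innerDl v1 v2 w : L2 v1 -> L2 v2 -> L2 w ->
  inner (fun x => v1 x + v2 x) w = inner v1 w + inner v2 w.
Proof.
move=> h1 h2 hw; rewrite /inner -RintegralD//; try exact: L2_integrableM.
by apply: eq_Rintegral => x _; rewrite mulrDl.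
Qed.

Lemma innerZl (a : R) v w : L2 v -> L2 w ->
  inner (fun x => a * v x) w = a * inner v w.
Proof.
move=> hv hw; rewrite /inner -RintegralZl//; last exact: L2_integrableM.
by apply: eq_Rintegral => x _; rewrite mulrA.
Qed.

Lemma innerBl v1 v2 w : L2 v1 -> L2 v2 -> L2 w ->
  inner (fun x => v1 x - v2 x) w = inner v1 w - inner v2 w.
Proof.
move=> h1 h2 hw; rewrite /inner -RintegralB//; try exact: L2_integrableM.
by apply: eq_Rintegral => x _; rewrite mulrBl.
Qed.

Lemma inner0l w : inner (fun=> 0) w = 0.
Proof.
rewrite /inner /Rintegral (eq_integral (fun=> 0%E)) ?integral0// => x _.
by rewrite mul0r.
Qed.

Lemma inner_suml I (r : seq I) (P : pred I) (f : I -> ptd -> R) w :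
  (forall i, P i -> L2 (f i)) -> L2 w ->
  inner (fun x => \sum_(i <- r | P i) f i x) w = \sum_(i <- r | P i) inner (f i) w.
Proof.
move=> h hw; elim: r => [|i r IH].
  rewrite big_nil -[RHS](inner0l w); apply: eq_Rintegral => x _.
  by rewrite big_nil.
rewrite big_cons; case: ifP => Pi; last first.
  rewrite -IH; apply: eq_Rintegral => x _; by rewrite big_cons Pi.
rewrite -IH -innerDl//; [|exact: h|exact: L2_sum].
by apply: eq_Rintegral => x _; rewrite big_cons Pi.
Qed.

Lemma inner_ge0 v : 0 <= inner v v.
Proof. by apply: Rintegral_ge0 => x _; rewrite -expr2 sqr_ge0. Qed.

Lemma inner_sqrE v : L2 v -> (\int[vol]_x ((v x) ^+ 2)%:E = (inner v v)%:E)%E.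
Proof.
move=> h; rewrite /inner /Rintegral fineK; last first.
  by apply: integrable_fin_num => //; exact: L2_integrableM.
by apply: eq_integral => x _; rewrite expr2.
Qed.

Lemma L2normE v : L2 v -> L2norm v = (Num.sqrt (inner v v))%:E.
Proof.
move=> hv; have := L2norm_sqr v; rewrite (inner_sqrE hv) => /(congr1 (@sqrte R)).
by rewrite sqrte_sqr gee0_abs// /L2norm Lnorm_ge0.
Qed.

Lemma inner_CS v w : L2 v -> L2 w -> inner v w ^+ 2 <= inner v v * inner w w.
Proof.
move=> hv hw.
have key t : 0 <= inner v v - 2 * t * inner v w + t ^+ 2 * inner w w.
  have htw := L2Z t hw.
  have := inner_ge0 (fun x => v x - t * w x).
  rewrite innerBl//; last exact: L2B.
  rewrite (innerC v) (innerC (fun x => t * w x)) !innerBl// !innerZl//.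
  rewrite (innerC v (fun x => t * w x)) (innerC w (fun x => t * w x)) !innerZl// (innerC w v).
  by move=> h; apply: le_trans h _; apply: le_of_eq; ring.
have [w0|w0] := eqVneq (inner w w) 0.
  rewrite w0 mulr0; have [->|vw0] := eqVneq (inner v w) 0; first by rewrite expr0n.
  (* When w has norm zero the quadratic in [key] is affine in t; at this t it equals -1. *)
  have := key ((inner v v + 1) / (2 * inner v w)).
  rewrite w0 mulr0 addr0 (_ : 2 * _ * _ = inner v v + 1); first lra.
  by field.
have wp : 0 < inner w w by rewrite lt0r w0 inner_ge0.
have := key (inner v w / inner w w).
rewrite (_ : _ + _ = inner v v - inner v w ^+ 2 / inner w w); last by field.
by rewrite subr_ge0 ler_pdivrMr.
Qed.

Lemma inner_cvg (vn : nat -> ptd -> R) v w : (forall n, L2 (vn n)) -> L2 v -> L2 w ->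
  (L2norm (fun x => vn n x - v x) @[n --> \oo] --> 0%E) ->
  inner (vn n) w @[n --> \oo] --> inner v w.
Proof.
move=> hn hv hw hc.
have hd n : L2 (fun x => vn n x - v x) by exact: L2B.
have E n := L2normE (hd n).
have hs : Num.sqrt (inner (fun x => vn n x - v x) (fun x => vn n x - v x)) @[n --> \oo] --> (0 : R).
  apply: (@fine_cvg _ _ _ _ (fun n => (Num.sqrt (inner (fun x => vn n x - v x) (fun x => vn n x - v x)))%:E) 0).
  by under eq_fun do rewrite -E.
have hz : (Num.sqrt (inner (fun x => vn n x - v x) (fun x => vn n x - v x)) * Num.sqrt (inner w w)) @[n --> \oo] --> (0 : R).
  rewrite -[X in _ --> X](mul0r (Num.sqrt (inner w w))).
  by apply: cvgM => //; exact: cvg_cst.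
apply/subr_cvg0; apply/norm_cvg0P.
apply: (squeeze_cvgr (f := fun=> 0) _ _ hz); last exact: cvg_cst.
near=> n; rewrite normr_ge0/= -innerBl// -sqrtr_sqr -sqrtrM ?inner_ge0//.
by rewrite ler_wsqrtr// inner_CS.
Unshelve. all: by end_near.
Qed.

End L2kit.

(** * Reference noise *)

Section Density.
Context {R : realType}.
Local Notation mu := (@lebesgue_measure R).
Local Open Scope ereal_scope.
Import HBNNSimple.

Lemma ge0_integral_density (m : {measure set (measurableTypeR R) -> \bar R})
    (q : R -> R) (f : R -> \bar R) :
  measurable_fun [set: R] q -> (forall x, 0 <= q x)%R ->
  (forall A, measurable A -> m A = \int[mu]_(x in A) (q x)%:E) ->
  measurable_fun [set: R] f -> (forall x, 0 <= f x) ->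
  \int[m]_x f x = \int[mu]_x (f x * (q x)%:E).
Proof.
move=> mq q0 mE mf f0.
have mqE : measurable_fun [set: R] (fun x => (q x)%:E) by exact/measurable_EFinP.
have q0E x : 0 <= (q x)%:E by rewrite lee_fin.
have Hind (A : set (measurableTypeR R)) : measurable A ->
    \int[m]_x (\1_A x)%:E = \int[mu]_x ((\1_A x)%:E * (q x)%:E).
  move=> mA; rewrite integral_indic// setIT mE// integral_mkcond.
  apply: eq_integral => x _; rewrite patchE indicE.
  by case: ifPn => _; rewrite ?mul1e ?mul0e.
have mf' : measurable_fun [set: measurableTypeR R] f := mf.
pose f_ := nnsfun_approx (@measurableT _ (measurableTypeR R)) mf'.
have Hs (g : {nnsfun (measurableTypeR R) >-> R}) :
    \int[m]_x (g x)%:E = \int[mu]_x ((g x)%:E * (q x)%:E).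
  under [LHS]eq_integral do rewrite fimfunE -fsumEFin//.
  rewrite [LHS]ge0_integral_fsum//; last 2 first.
    - by move=> r; exact/measurable_EFinP/measurableT_comp.
    - by move=> n x _; rewrite EFinM nnfun_muleindic_ge0.
  under [RHS]eq_integral.
    move=> x _; rewrite fimfunE -fsumEFin// ge0_mule_fsuml; last first.
      by move=> r; rewrite EFinM nnfun_muleindic_ge0.
    over.
  rewrite [RHS]ge0_integral_fsum//; last 2 first.
    - move=> r; apply: emeasurable_funM => //.
      by apply/measurable_EFinP; do 2 apply/measurableT_comp => //.
    - by move=> n x _; rewrite mule_ge0// EFinM nnfun_muleindic_ge0.
  apply: eq_fsbigr => r _; rewrite integralZl_indic_nnsfun//.
  have [r0|r0] := leP 0%R r; last first.
    rewrite preimage_nnfun0// integral_indic// set0I measure0 mule0.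
    by rewrite integral0_eq// => x _; rewrite indicE in_set0 mulr0 mul0e.
  under [RHS]eq_integral do rewrite EFinM -muleA.
  rewrite ge0_integralZl//; first by rewrite Hind.
  - by apply: emeasurable_funM => //; exact/measurable_EFinP.
  - by move=> x _; rewrite mule_ge0// lee_fin.
transitivity (lim (\int[m]_x (f_ n x)%:E @[n --> \oo])).
  rewrite -monotone_convergence//=.
  - by apply: eq_integral => x _; apply/esym/cvg_lim => //; exact: cvg_nnsfun_approx.
  - by move=> n; exact/measurable_EFinP/measurable_funTS.
  - by move=> n ? _; rewrite lee_fin.
  - by move=> ? _ ? ? mn; rewrite lee_fin; exact/lefP/nd_nnsfun_approx.
rewrite [RHS](_ : _ = lim (\int[mu]_x ((f_ n x)%:E * (q x)%:E) @[n --> \oo])).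
  by apply: congr_lim; apply/funext => n /=; exact: Hs.
rewrite -monotone_convergence//=.
- apply: eq_integral => x _; apply/esym/cvg_lim => //.
  by apply: cvgeZr => //; exact: cvg_nnsfun_approx.
- by move=> n; apply: emeasurable_funM => //; exact/measurable_EFinP.
- by move=> n x _; rewrite mule_ge0// lee_fin.
- by move=> x _ a b ab; rewrite lee_wpmul2r// lee_fin; exact/lefP/nd_nnsfun_approx.
Qed.

Lemma lebesgue_measure_shift (h : R) (A : set R) : measurable A ->
  pushforward mu ((fun x => x + h)%R : measurableTypeR R -> measurableTypeR R) A = mu A.
Proof.
move=> mA.
have mS : measurable_fun [set: measurableTypeR R]
    ((fun x => x + h)%R : measurableTypeR R -> measurableTypeR R).
  exact: measurable_funD.
pose S := HB.pack_for {mfun (measurableTypeR R) >-> (measurableTypeR R)}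
  ((fun x => x + h)%R : measurableTypeR R -> measurableTypeR R)
  (isMeasurableFun.Build _ _ _ _ _ mS).
apply/esym/(@lebesgue_measure_unique _ (pushforward mu S)) => //= _ [[a b]] _ <-.
rewrite /pushforward/= (_ : _ @^-1` _ = `](a - h)%R, (b - h)%R]%classic); last first.
  by apply/seteqP; split => x; rewrite /= !in_itv/= ltrBlDr lerBrDr.
rewrite !lebesgue_measure_itv/= !lte_fin ltrD2r -!EFinB.
by rewrite opprB addrA addrNK.
Qed.

Lemma ge0_integral_shift (h : R) (f : R -> \bar R) :
  measurable_fun [set: R] f -> (forall x, 0 <= f x) ->
  \int[mu]_x f (x + h)%R = \int[mu]_x f x.
Proof.
move=> mf f0.
have mS : measurable_fun [set: measurableTypeR R]
    ((fun x => x + h)%R : measurableTypeR R -> measurableTypeR R).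
  exact: measurable_funD.
transitivity (\int[pushforward mu ((fun x => x + h)%R : measurableTypeR R -> measurableTypeR R)]_x f x).
  by rewrite (ge0_integral_pushforward mS).
by apply: eq_measure_integral => //= A mA _; exact: lebesgue_measure_shift.
Qed.

Lemma integral_oneDsqrV : \int[mu]_x ((oneDsqr x)^-1)%:E = pi%:E.
Proof.
have mo : measurable_fun [set: R] (fun x : R => ((oneDsqr x)^-1)%:E).
  apply/measurable_EFinP; apply: continuous_measurable_fun.
  exact: continuous_oneDsqrV.
have o0 (x : R) : 0 <= ((oneDsqr x)^-1)%:E.
  by rewrite lee_fin invr_ge0 addr_ge0// sqr_ge0.
have -> : [set: R] = `]-oo, 0%R]%classic `|` `]0%R, +oo[%classic.
  by apply/seteqP; split => x //= _; rewrite !in_itv/= andbT; case: leP; [left|right].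
rewrite ge0_integral_setU//=; last 2 first.
- exact: measurable_funTS.
- by apply/disj_setPS => x [/=]; rewrite !in_itv/= andbT => h1 /(le_lt_trans h1); rewrite ltxx.
have h1 : \int[mu]_(x in `]-oo, 0%R]) ((oneDsqr x)^-1)%:E = (pi / 2)%:E.
  rewrite -integral0y_oneDsqr (@ge0_integration_by_substitution0 _ (fun x => ((oneDsqr x)^-1)%:E))//.
  by apply: eq_integral => x _; rewrite /oneDsqr sqrrN.
rewrite integral_itv_obnd_cbnd; last exact: measurable_funTS.
by rewrite h1 integral0y_oneDsqr -EFinD -splitr.
Qed.

End Density.

Section HeavyNoise.
Context {R : realType}.
Variables (eta : R).
Local Notation mu := (@lebesgue_measure R).

Definition heavy_pdf (y : R) : R :=
  (1 - eta) * normal_pdf 0 1 y + eta * (pi * oneDsqr y)^-1.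

Lemma measurable_heavy_pdf : measurable_fun [set: R] heavy_pdf.
Proof.
apply: measurable_funD; apply: measurable_funM => //; first exact: measurable_normal_pdf.
rewrite (_ : (fun y => _) = (fun y => pi^-1 * (oneDsqr y)^-1)); last first.
  by apply/funext => y; rewrite invfM.
apply: measurable_funM => //; apply: continuous_measurable_fun.
exact: continuous_oneDsqrV.
Qed.

(** [eta01] is an argument because the probability structure attached to this term depends on it. *)
Definition heavy_prob (eta01 : 0 <= eta <= 1) : set (measurableTypeR R) -> \bar R :=
  fun V => (\int[mu]_(x in V) (heavy_pdf x)%:E)%E.

Hypothesis eta01 : 0 <= eta <= 1.

Lemma heavy_pdf_ge0 y : 0 <= heavy_pdf y.
Proof.
case/andP: eta01 => e0 e1; rewrite addr_ge0// mulr_ge0 ?subr_ge0 ?normal_pdf_ge0//.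
by rewrite invr_ge0 mulr_ge0 ?pi_ge0// addr_ge0// sqr_ge0.
Qed.

Let heavy0 : heavy_prob eta01 set0 = 0%E.
Proof. by rewrite /heavy_prob integral_set0. Qed.

Let heavy_ge0 A : (0 <= heavy_prob eta01 A)%E.
Proof. by apply: integral_ge0 => x _; rewrite lee_fin heavy_pdf_ge0. Qed.

Let heavy_sigma_additive : semi_sigma_additive (heavy_prob eta01).
Proof.
move=> /= F mF tF mUF; rewrite /heavy_prob; apply: cvg_toP.
  apply: ereal_nondecreasing_is_cvgn => m n mn.
  apply: lee_sum_nneg_natr => // k _ _.
  by apply: integral_ge0 => /= x Fkx; rewrite lee_fin heavy_pdf_ge0.
rewrite ge0_integral_bigcup//=.
- apply: measurable_funTS; apply: measurableT_comp => //.
  exact: measurable_heavy_pdf.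
- by move=> x _; rewrite lee_fin heavy_pdf_ge0.
Qed.

HB.instance Definition _ := isMeasure.Build _ _ _ (heavy_prob eta01)
  heavy0 heavy_ge0 heavy_sigma_additive.

Let heavy_setT : heavy_prob eta01 [set: _] = 1%:E.
Proof.
case/andP: eta01 => e0 e1.
rewrite /heavy_prob /heavy_pdf.
under eq_integral do rewrite EFinD !EFinM invfM EFinM.
have mo : measurable_fun [set: R] (fun x : R => ((oneDsqr x)^-1)%:E).
  apply/measurable_EFinP; apply: continuous_measurable_fun.
  exact: continuous_oneDsqrV.
have o0 (x : R) : (0 <= ((oneDsqr x)^-1)%:E)%E.
  by rewrite lee_fin invr_ge0 addr_ge0// sqr_ge0.
have mn : measurable_fun [set: R] (fun x : R => (normal_pdf 0 1 x)%:E).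
  by apply/measurable_EFinP; exact: measurable_normal_pdf.
have p0 : 0 <= pi^-1 :> R by rewrite invr_ge0 pi_ge0.
have I1 : (\int[mu]_x ((1 - eta)%:E * (normal_pdf 0 1 x)%:E) = (1 - eta)%:E)%E.
  rewrite ge0_integralZl//; first by rewrite integral_normal_pdf mule1.
  - by move=> x _; rewrite lee_fin normal_pdf_ge0.
  - by rewrite lee_fin subr_ge0.
have mp : measurable_fun [set: R] (fun x : R => (pi^-1%:E * ((oneDsqr x)^-1)%:E)%E).
  exact: measurable_funeM.
have I2 : (\int[mu]_x (eta%:E * (pi^-1%:E * ((oneDsqr x)^-1)%:E)) = eta%:E)%E.
  rewrite ge0_integralZl//.
  - rewrite ge0_integralZl//.
    by rewrite integral_oneDsqrV -EFinM mulVf ?mule1 ?mulr1// gt_eqF ?pi_gt0.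
  - by move=> x _; rewrite mule_ge0 ?lee_fin.
rewrite ge0_integralD//=.
- by rewrite I1 [X in (_ + X)%E]I2 -EFinD subrK.
- by move=> x _; rewrite mule_ge0 ?lee_fin ?subr_ge0 ?normal_pdf_ge0.
- exact: measurable_funeM.
- by move=> x _; rewrite !mule_ge0 ?lee_fin.
- exact: measurable_funeM.
Qed.

HB.instance Definition _ := @Measure_isProbability.Build _ _ R
  (heavy_prob eta01) heavy_setT.

End HeavyNoise.

(** * Change of measure *)

Section Tensor.
Context {d1 d2 : measure_display} {W : measurableType d1} {X : measurableType d2}
  {R : realType}.
Variables (P Q : probability W R) (o o' : W -> X) (p c : R).
Hypotheses (mo : measurable_fun [set: W] o) (mo' : measurable_fun [set: W] o').
Hypotheses (p1 : 1 < p) (c0 : 0 <= c).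
Hypothesis onestep : forall g : X -> R, measurable_fun [set: X] g ->
  (forall x, 0 <= g x <= 1) ->
  (\int[P]_w (g (o w))%:E <= c%:E * (\int[Q]_w ((g (o' w)) `^ p)%:E) `^ p^-1)%E.

Lemma map_tuple_cons (k : W -> X) n (x : W) (y : n.-tuple W) :
  map_tuple k (Defs.cons_tuple (x, y)) = Defs.cons_tuple (k x, map_tuple k y).
Proof. exact/val_inj. Qed.

Lemma measurable_map_tuple (k : W -> X) n : measurable_fun [set: W] k ->
  measurable_fun [set: n.-tuple W] (fun w : n.-tuple W => map_tuple k w : n.-tuple X).
Proof.
move=> mk; apply/measurable_fun_tnthP => i.
rewrite (_ : _ \o _ = fun w : n.-tuple W => k (tnth w i)); last first.
  by apply/funext => w; rewrite /= tnth_map.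
by apply: (measurableT_comp mk); exact: measurable_tnth.
Qed.

Let p_gt0 : 0 < p. Proof. exact: lt_trans p1. Qed.

(** The inequality tensorizes because [onestep] holds for all functions with values in [0, 1].
    Freezing the first observation and applying the induction hypothesis to the others leaves the
    p-th root of an integral of G^p, again a function with values in [0, 1]; [onestep] applies to
    it, and its p-th power undoes the root. *)
Lemma iid_hoelder n (G : n.-tuple X -> R) :
  measurable_fun [set: n.-tuple X] G -> (forall x, 0 <= G x <= 1) ->
  (\int[iid P n]_w (G (map_tuple o w))%:E <=
   (c ^+ n)%:E * (\int[iid Q n]_w ((G (map_tuple o' w)) `^ p)%:E) `^ p^-1)%E.
Proof.
elim: n G => [|n IH] G mG G01.
  have m0 (f : 0.-tuple W -> \bar R) : measurable_fun [set: 0.-tuple W] f.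
    move=> _ Y mY; rewrite setTI.
    have [h|h] := pselect (f [tuple] \in Y).
      rewrite (_ : _ @^-1` _ = setT)//; apply/seteqP; split => // x _ /=.
      by rewrite tuple0; move: h; rewrite inE.
    rewrite (_ : _ @^-1` _ = set0)//; apply/seteqP; split => // x /=.
    by rewrite tuple0 => Yx; apply: h; rewrite inE.
  have Z (T0 : probability W R) (f : 0.-tuple W -> \bar R) :
      (\int[iid T0 0]_w f w = f [tuple])%E.
    by rewrite [LHS]integral_dirac//= diracE in_setT mul1e.
  rewrite !Z expr0 mul1e poweR_EFin -powRrM.
  rewrite mulfV ?gt_eqF// powRr1 ?(tuple0 (map_tuple o _)) ?(tuple0 (map_tuple o' _))//.
  by case/andP: (G01 [tuple]).
have G0 x : 0 <= G x by case/andP: (G01 x).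
have G1 x : G x <= 1 by case/andP: (G01 x).
have mGo (k : W -> X) : measurable_fun [set: W] k ->
    measurable_fun [set: n.+1.-tuple W] (fun w => G (map_tuple k w)).
  by move=> mk; apply: (measurableT_comp mG); exact: measurable_map_tuple.
pose F (a : X) := (\int[iid Q n]_w ((G (Defs.cons_tuple (a, map_tuple o' w))) `^ p)%:E)%E.
have mGc : measurable_fun [set: X * n.-tuple W]
    (fun q : X * n.-tuple W => G (Defs.cons_tuple (q.1, map_tuple o' q.2))).
  apply: (measurableT_comp mG).
  apply: (measurableT_comp (@Defs.measurable_cons_tuple _ X n)).
  apply/measurable_fun_pairP; split => //=.
  - exact: measurable_fst.
  - apply: (@measurableT_comp _ _ _ _ _ _ (fun w : n.-tuple W => map_tuple o' w : n.-tuple X) _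
      (fun q : X * n.-tuple W => q.2)).
      exact: measurable_map_tuple.
    exact: measurable_snd.
have mF : measurable_fun [set: X] F.
  apply: (@measurable_fun_fubini_tonelli_F _ _ _ _ R (iid Q n)
    (fun q : X * n.-tuple W => ((G (Defs.cons_tuple (q.1, map_tuple o' q.2))) `^ p)%:E)).
  - apply/measurable_EFinP.
    exact: (measurableT_comp (measurable_powR p) mGc).
  - by move=> q; rewrite lee_fin powR_ge0.
have F0 a : (0 <= F a)%E by apply: integral_ge0 => w _; rewrite lee_fin powR_ge0.
have F1 a : (F a <= 1)%E.
  rewrite /F; apply: (@le_trans _ _ (\int[iid Q n]_w 1%:E)%E); last first.
    by rewrite integral_prob_cst.
  apply: le_integralT => w; first by rewrite lee_fin powR_ge0.
  rewrite lee_fin; apply: (@le_trans _ _ (1 `^ p)); last by rewrite powR1.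
  by apply: ge0_ler_powR; rewrite ?nnegrE// ltW.
have Ffin a : F a \is a fin_num by rewrite ge0_fin_numE// (le_lt_trans (F1 a))// ltry.
pose g a := (fine (F a)) `^ p^-1.
have mg : measurable_fun [set: X] g.
  apply: (measurableT_comp (measurable_powR p^-1)).
  exact: (@measurableT_comp _ _ _ _ _ _ fine _ F).
have g01 a : 0 <= g a <= 1.
  rewrite /g powR_ge0/=; apply: (@le_trans _ _ (1 `^ p^-1)); last by rewrite powR1.
  apply: ge0_ler_powR.
  - by rewrite invr_ge0 ltW.
  - by rewrite nnegrE fine_ge0.
  - by rewrite nnegrE.
  - by rewrite -lee_fin fineK.
have gE a : (F a `^ p^-1 = (g a)%:E)%E.
  by rewrite /g -poweR_EFin fineK.
rewrite ge0_integral_iidS; [|by apply/measurable_EFinP; exact: mGo|by move=> w; rewrite lee_fin].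
apply: (@le_trans _ _ (\int[P]_x ((c ^+ n)%:E * (g (o x))%:E))%E).
  apply: le_integralT => x; first by apply: integral_ge0 => y _; rewrite lee_fin.
  rewrite -gE; under eq_integral do rewrite map_tuple_cons.
  apply: (IH (fun y => G (Defs.cons_tuple (o x, y)))) => //.
  apply: (measurableT_comp mG).
  apply: (measurableT_comp (@Defs.measurable_cons_tuple _ X n)).
  exact: measurable_pair1.
rewrite ge0_integralZl//; last 3 first.
- by apply/measurable_EFinP; exact: (measurableT_comp mg).
- by move=> x _; rewrite lee_fin; case/andP: (g01 (o x)).
- by rewrite lee_fin exprn_ge0.
rewrite exprSr EFinM -muleA lee_wpmul2l ?lee_fin ?exprn_ge0//.
apply: le_trans (onestep mg g01) _; rewrite lee_wpmul2l ?lee_fin//.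
rewrite ge0_integral_iidS; last 2 first.
- by apply/measurable_EFinP; apply: (measurableT_comp (measurable_powR p)); exact: mGo.
- by move=> w; rewrite lee_fin powR_ge0.
apply: le_of_eq; congr (_ `^ _)%E.
apply: eq_integral => x _.
rewrite /g -powRrM mulVf ?gt_eqF// powRr1 ?fine_ge0// fineK// /F.
by apply: eq_integral => y _; rewrite map_tuple_cons.
Qed.

End Tensor.

Section StdNormal.
Context {R : realType}.
Local Notation mu := (@lebesgue_measure R).
Local Notation phi := (@normal_pdf R 0 1).

Lemma phiE (x : R) : phi x = expR (ln (normal_peak 1) - x ^+ 2 / 2).
Proof.
rewrite normal_pdfE ?oner_neq0// /normal_fun subr0 expr1n mulNr expRB.
by rewrite lnK ?posrE ?normal_peak_gt0 ?oner_neq0// expRN.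
Qed.

Lemma phi_gt0 x : 0 < phi x. Proof. by rewrite phiE expR_gt0. Qed.

Lemma phi_powR x r : phi x `^ r = expR (r * (ln (normal_peak 1) - x ^+ 2 / 2)).
Proof. by rewrite phiE [r * _]mulrC expRM. Qed.

(** From a peak of at most 1/2 and exp (x^2 / 2) >= 1 + x^2 / 2. This compares the Gaussian with the
    Cauchy density. *)
Lemma phi_decay (x : R) : (1 + x ^+ 2) * phi x <= 1.
Proof.
have pk : normal_peak 1 <= 1 / 2 :> R.
  rewrite /normal_peak expr1n mul1r div1r lef_pV2 ?posrE ?sqrtr_gt0//.
    have -> : 2 = Num.sqrt (2 ^+ 2) :> R by rewrite sqrtr_sqr ger0_norm.
    rewrite ler_wsqrtr// -mulr_natr; have := pi_ge2 R; lra.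
  by rewrite mulrn_wgt0// pi_gt0.
rewrite phiE expRB lnK ?posrE ?normal_peak_gt0 ?oner_neq0//.
have h := expR_ge1Dx (x ^+ 2 / 2).
rewrite mulrA ler_pdivrMr ?expR_gt0// mul1r.
apply: le_trans (_ : (1 + x ^+ 2) * (1 / 2) <= _).
  by rewrite ler_wpM2l// addr_ge0// sqr_ge0.
have := sqr_ge0 x; lra.
Qed.

Lemma integral_phi_shift (m : R) : (\int[mu]_x (phi (x - m))%:E = 1)%E.
Proof.
rewrite -(@integral_normal_pdf R 0 1).
apply: (ge0_integral_shift (- m) (f := fun x => (phi x)%:E)).
- by apply/measurable_EFinP; exact: measurable_normal_pdf.
- by move=> x; rewrite lee_fin normal_pdf_ge0.
Qed.

(** Young's inequality for the product of (1 + h)^s and 1, with the exponents 1/s and 1/(1 - s). It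
    is what makes the large shifts cost s h^2 only. *)
Lemma powR_bernoulli (h s : R) : 0 <= h -> 0 < s < 1 -> (1 + h) `^ s <= 1 + s * h.
Proof.
move=> h0 /andP[s0 s1].
have a0 : 0 <= 1 + h by rewrite addr_ge0.
have := @conjugate_powR R ((1 + h) `^ s) 1 s^-1 (1 - s)^-1 (powR_ge0 _ _) ler01.
rewrite !invrK !invr_gt0 subr_gt0 s0 s1 subrKC mulr1 -powRrM mulfV ?gt_eqF// powRr1// powR1.
move=> /(_ isT isT erefl); lra.
Qed.

End StdNormal.

(** * Moments of the likelihood ratio for one shift of the noise *)

Section KernelBound.
Context {R : realType}.
Local Notation mu := (@lebesgue_measure R).
Local Notation phi := (@normal_pdf R 0 1).
Variables (eta s K : R).
Hypothesis eta01 : 0 <= eta <= 1.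
Hypotheses (eta0 : 0 < eta) (eta2 : eta <= 1 / 2) (s01 : 0 < s < 1).
Hypothesis etaK : eta `^ (- s) <= K.

Let s0 : 0 < s. Proof. by case/andP: s01. Qed.

Definition lratio (y h : R) : R := phi (y - h) / heavy_pdf eta y.

Let oneD_gt0 (y : R) : 0 < oneDsqr y.
Proof. by rewrite /oneDsqr ltr_pwDl// sqr_ge0. Qed.

Lemma heavy_pdf_ge1 y : (1 - eta) * phi y <= heavy_pdf eta y.
Proof.
rewrite /heavy_pdf lerDl mulr_ge0 ?ltW// invr_gt0 mulr_gt0 ?pi_gt0//.
Qed.

Lemma heavy_pdf_ge2 y : eta * (pi * oneDsqr y)^-1 <= heavy_pdf eta y.
Proof.
rewrite /heavy_pdf lerDr mulr_ge0 ?normal_pdf_ge0// subr_ge0.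
by case/andP: eta01.
Qed.

Lemma heavy_pdf_gt0 y : 0 < heavy_pdf eta y.
Proof.
apply: lt_le_trans (heavy_pdf_ge1 y); rewrite mulr_gt0 ?phi_gt0//.
by rewrite subr_gt0 (le_lt_trans eta2)// ltr_pdivrMr// mul1r ltr1n.
Qed.

Lemma lratio_ge0 y h : 0 <= lratio y h.
Proof. by rewrite divr_ge0 ?normal_pdf_ge0// ltW// heavy_pdf_gt0. Qed.

Lemma measurable_lratio d (T : measurableType d) (y h : T -> R) :
  measurable_fun [set: T] y -> measurable_fun [set: T] h ->
  measurable_fun [set: T] (fun t => lratio (y t) (h t)).
Proof.
move=> my mh; rewrite /lratio; apply: measurable_funM.
  apply: (measurableT_comp (measurable_normal_pdf 0 1)).
  exact: measurable_funB.
rewrite (_ : (fun t => _) = (fun t => (heavy_pdf eta (y t)) `^ (- 1))); last first.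
  by apply/funext => t; rewrite powR_inv1// ltW// heavy_pdf_gt0.
apply: (measurableT_comp (measurable_powR _)).
exact: (measurableT_comp (measurable_heavy_pdf eta)).
Qed.

(** An observed value v + y is rewritten as v0 + y' with y' = y + (v - v0), so that both noises are
    densities of the same variable y'. *)
Lemma change_noise (v0 v : R) (G : R -> \bar R) :
  measurable_fun [set: R] G -> (forall x, 0 <= G x)%E ->
  (\int[normal_prob 0 1]_y G (v + y)%R =
   \int[heavy_prob eta01]_y (G (v0 + y)%R * (lratio y (v - v0))%:E))%E.
Proof.
move=> mG G0.
have mGD (a : R) : measurable_fun [set: R] (fun y => G (a + y)%R).
  by apply: (measurableT_comp mG); exact: measurable_funD.
have mphi : measurable_fun [set: R] phi by exact: measurable_normal_pdf.
rewrite (@ge0_integral_density _ _ phi)//; last by move=> x; exact: normal_pdf_ge0.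
rewrite [RHS](@ge0_integral_density _ _ (heavy_pdf eta))//; last 4 first.
- exact: measurable_heavy_pdf.
- by move=> x; rewrite ltW// heavy_pdf_gt0.
- apply: emeasurable_funM => //; apply/measurable_EFinP.
  by apply: measurable_lratio.
- by move=> x; rewrite mule_ge0// lee_fin lratio_ge0.
rewrite -(@ge0_integral_shift _ (- (v - v0))); last 2 first.
- by apply: emeasurable_funM => //; exact/measurable_EFinP.
- by move=> x; rewrite mule_ge0// lee_fin normal_pdf_ge0.
apply: eq_integral => y _; rewrite -muleA -EFinM /lratio divfK ?gt_eqF ?heavy_pdf_gt0//.
by congr (G _ * _)%E; ring.
Qed.

(** The first term serves the case s h^2 <= 1, where the exponent of [kernel_small] is at most 2;
    the second one the case s h^2 > 1, where 2 (1 + s h^2) is at most 4 s h^2. *)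
Definition kernel_const : R := expR 2 + 4 * pi * K.

Let K0 : 0 < K.
Proof. by apply: lt_le_trans etaK; rewrite powR_gt0. Qed.

Lemma kernel_const_gt0 : 0 < kernel_const.
Proof. by rewrite addr_gt0 ?expR_gt0// !mulr_gt0// pi_gt0. Qed.

Lemma powRN_le (a b : R) : 0 < a -> a <= b -> b `^ (- s) <= a `^ (- s).
Proof.
move=> a0 ab; have b0 : 0 < b by exact: lt_le_trans ab.
rewrite !powRN lef_pV2 ?posrE ?powR_gt0//.
by apply: ge0_ler_powR => //; rewrite ?nnegrE; exact: ltW.
Qed.

Lemma expR_small : expR (- (2 * eta)) <= 1 - eta.
Proof.
have h : 1 + 2 * eta <= expR (2 * eta) by exact: expR_ge1Dx.
rewrite expRN -[_^-1]mul1r ler_pdivrMr ?expR_gt0//.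
have e0 := eta0; have e2 := eta2.
have e1 : 0 <= 1 - eta by lra.
have := ler_wpM2l e1 h; nra.
Qed.

(* Gaussian part of the reference density: used when s h^2 <= 1. *)
Lemma kernel_small h y :
  phi (y - h) `^ (1 + s) * heavy_pdf eta y `^ (- s) <=
  expR (s * (2 * eta + h ^+ 2)) * phi (y - (1 + s) * h).
Proof.
have h1 : heavy_pdf eta y `^ (- s) <=
    expR (- s * (- (2 * eta) + (ln (normal_peak 1) - y ^+ 2 / 2))).
  rewrite [- s * _]mulrC expRM; apply: powRN_le; first exact: expR_gt0.
  apply: le_trans (heavy_pdf_ge1 y).
  by rewrite expRD -phiE ler_wpM2r ?normal_pdf_ge0// expR_small.
apply: le_trans (ler_wpM2l (powR_ge0 _ _) h1) _.
rewrite phi_powR phiE -!expRD ler_expR.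
move: (ln _) => c; case/andP: s01 => s0' s1'.
have := mulr_ge0 (ltW s0') (sqr_ge0 h); nra.
Qed.

(* Cauchy part of the reference density: used when s h^2 > 1, where [kernel_small] would
   give an exponential in h^2. *)
Lemma kernel_large h y :
  phi (y - h) `^ (1 + s) * heavy_pdf eta y `^ (- s) <=
  2 * pi * K * (1 + s * h ^+ 2) * phi (y - h).
Proof.
have pi0 := pi_gt0 R.
have q0 : 0 < eta * (pi * oneDsqr y)^-1.
  by rewrite mulr_gt0// invr_gt0 mulr_gt0.
have h1 : heavy_pdf eta y `^ (- s) <= K * (pi * oneDsqr y) `^ s.
  apply: le_trans (powRN_le q0 (heavy_pdf_ge2 y)) _.
  rewrite powRM; [|exact: ltW|by rewrite invr_ge0 mulr_ge0// ltW].
  rewrite [X in _ * X](_ : _ = (pi * oneDsqr y) `^ s).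
    by apply: ler_wpM2r => //; exact: powR_ge0.
  by rewrite -(powR_inv1 (ltW (mulr_gt0 pi0 (oneD_gt0 y)))) -powRrM mulrNN mul1r.
have h2 : phi (y - h) `^ s * (pi * oneDsqr y) `^ s <= 2 * pi * (1 + s * h ^+ 2).
  rewrite -powRM ?normal_pdf_ge0//; last by rewrite mulr_ge0// ltW.
  have b1 : phi (y - h) * (pi * oneDsqr y) <= 2 * pi * (1 + h ^+ 2).
    have := phi_decay (y - h); have := normal_pdf_ge0 0 1 (y - h).
    rewrite /oneDsqr; set P := phi (y - h) => P0 P1.
    have P2 : P * (1 + y ^+ 2) <= 2 * (1 + h ^+ 2).
      (* Peetre's inequality: it moves the quadratic weight from y to y - h, where the Gaussian is
         centred, at the cost of a factor in h. *)
      have : P * (1 + y ^+ 2) <= P * (2 * (1 + h ^+ 2) * (1 + (y - h) ^+ 2)).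
        rewrite ler_wpM2l//; have := sqr_ge0 (y - 2 * h); have := sqr_ge0 (h * (y - h)); nra.
      move=> /le_trans; apply.
      have -> : P * (2 * (1 + h ^+ 2) * (1 + (y - h) ^+ 2)) =
        2 * (1 + h ^+ 2) * ((1 + (y - h) ^+ 2) * P) by ring.
      by rewrite ler_piMr// mulr_ge0// addr_ge0// sqr_ge0.
    rewrite mulrCA [2 * pi]mulrC -mulrA ler_pM2l//.
  have pp : 1 <= 2 * pi :> R by have := pi_ge2 R; lra.
  apply: (@le_trans _ _ ((2 * pi * (1 + h ^+ 2)) `^ s)).
    apply: ge0_ler_powR => //; first exact: ltW.
    - by rewrite nnegrE !mulr_ge0 ?normal_pdf_ge0// ltW.
    - by rewrite nnegrE mulr_ge0 ?addr_ge0 ?sqr_ge0// mulr_ge0// ltW.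
  rewrite powRM ?addr_ge0 ?sqr_ge0//; last by rewrite mulr_ge0// ltW.
  apply: ler_pM; rewrite ?powR_ge0//.
    by apply: ler1_powR => //; case/andP: s01 => _ /ltW.
  by apply: powR_bernoulli => //; exact: sqr_ge0.
rewrite powRD; last by rewrite (gt_eqF (phi_gt0 _)) implybT.
rewrite powRr1 ?normal_pdf_ge0// -mulrA.
rewrite [leRHS]mulrC ler_wpM2l ?normal_pdf_ge0//.
apply: le_trans (ler_wpM2l (powR_ge0 _ _) h1) _.
rewrite mulrCA [2 * pi * K]mulrC -[leRHS]mulrA ler_pM2l//.
Qed.

Lemma lratio_powRE h y : lratio y h `^ (1 + s) * heavy_pdf eta y =
  phi (y - h) `^ (1 + s) * heavy_pdf eta y `^ (- s).
Proof.
have q0 := heavy_pdf_gt0 y.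
rewrite /lratio powRM ?normal_pdf_ge0 ?invr_ge0 ?(ltW q0)// -mulrA; congr (_ * _).
rewrite -[X in X `^ (1 + s)](powR_inv1 (ltW q0)) -powRrM mulN1r.
rewrite -{2}[heavy_pdf eta y](powRr1 (ltW q0)) -powRD; last by rewrite (gt_eqF q0) implybT.
by congr (_ `^ _); ring.
Qed.

Lemma integral_lratio_le h :
  (\int[heavy_prob eta01]_y ((lratio y h) `^ (1 + s))%:E
     <= (1 + kernel_const * s * (2 * eta + h ^+ 2))%:E)%E.
Proof.
have pi0 := pi_gt0 R.
have e0 := eta0; have e2 := eta2; have s0' := s0; have K0' := K0.
have h2 := sqr_ge0 h.
have ml : measurable_fun [set: R] (fun y => (lratio y h) `^ (1 + s)).
  apply: (measurableT_comp (measurable_powR _)).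
  by apply: measurable_lratio.
rewrite [leLHS](@ge0_integral_density _ _ (heavy_pdf eta))//; last 4 first.
- exact: measurable_heavy_pdf.
- by move=> x; rewrite ltW// heavy_pdf_gt0.
- exact/measurable_EFinP.
- by move=> x; rewrite lee_fin powR_ge0.
(* Both kernel bounds are multiples of a translated Gaussian density, so each integrates to its
   constant. *)
have key (c m : R) : 0 <= c -> (forall y, lratio y h `^ (1 + s) * heavy_pdf eta y <= c * phi (y - m)) ->
    (\int[mu]_y ((lratio y h `^ (1 + s))%:E * (heavy_pdf eta y)%:E) <= c%:E)%E.
  move=> c0 hc.
  have mphi : measurable_fun [set: R] (fun y => phi (y - m)).
    by apply: (measurableT_comp (measurable_normal_pdf 0 1)); exact: measurable_funB.
  apply: (@le_trans _ _ (\int[mu]_y (c%:E * (phi (y - m))%:E))%E).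
    apply: le_integralT => y; last by rewrite -!EFinM lee_fin.
    by rewrite -EFinM lee_fin mulr_ge0 ?powR_ge0// ltW// heavy_pdf_gt0.
  rewrite ge0_integralZl//; first by rewrite integral_phi_shift mule1.
  - exact/measurable_EFinP.
  - by move=> y _; rewrite lee_fin normal_pdf_ge0.
have kc := kernel_const_gt0.
have [hs|hs] := leP (s * h ^+ 2) 1.
  set x := s * (2 * eta + h ^+ 2).
  have x0 : 0 <= x by apply: mulr_ge0; [exact: ltW|lra].
  have x2 : x <= 2 by rewrite /x; case/andP: s01; nra.
  apply: le_trans (key (expR x) ((1 + s) * h) (expR_ge0 _) _) _.
    by move=> y; rewrite lratio_powRE; exact: kernel_small.
  rewrite lee_fin.
  have e1 : expR x <= 1 + x * expR x.
    have := expR_ge1Dx (- x); rewrite expRN -(ler_pM2r (expR_gt0 x)) mulVf ?gt_eqF ?expR_gt0//.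
    by move=> ?; nra.
  apply: le_trans e1 _; rewrite lerD2l mulrC -mulrA -/x ler_wpM2r//.
  apply: (@le_trans _ _ (expR 2)); first by rewrite ler_expR.
  by rewrite /kernel_const lerDl !mulr_ge0// ltW.
have c0 : 0 <= 2 * pi * K * (1 + s * h ^+ 2).
  by apply: mulr_ge0; [apply: ltW; rewrite !mulr_gt0|lra].
apply: le_trans (key _ h c0 _) _.
  by move=> y; rewrite lratio_powRE; exact: kernel_large.
rewrite lee_fin /kernel_const.
have := mulr_gt0 pi0 K0; have := expR_gt0 (2 : R); set E := expR 2; set L := pi * K => E0 L0.
have -> : 2 * pi * K * (1 + s * h ^+ 2) = L * (2 * (1 + s * h ^+ 2)) by rewrite /L; ring.
have -> : 1 + (E + 4 * pi * K) * s * (2 * eta + h ^+ 2) =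
  1 + E * (s * (2 * eta + h ^+ 2)) + L * (4 * s * (2 * eta + h ^+ 2)) by rewrite /L; ring.
have se : 0 < s * eta by exact: mulr_gt0.
have : L * (2 * (1 + s * h ^+ 2)) <= L * (4 * s * (2 * eta + h ^+ 2)).
  by apply: ler_wpM2l; [exact: ltW|nra].
move=> /le_trans; apply; rewrite lerDr addr_ge0// mulr_ge0 ?(ltW E0)//.
by apply: mulr_ge0; [exact: ltW|lra].
Qed.

End KernelBound.

(** * Change of measure for one observation *)

Section OneStep.
Context {R : realType} {d : nat}.
Variables (eta s K T E : R) (T_gt0 : 0 < T).
Hypothesis eta01 : 0 <= eta <= 1.
Hypotheses (eta0 : 0 < eta) (eta2 : eta <= 1 / 2) (s01 : 0 < s < 1).
Hypothesis etaK : eta `^ (- s) <= K.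
Local Notation RM := (measurableTypeR R).
Variables (u0 u : R -> pt R d -> R).
Hypotheses (mu0 : measurable_fun [set: RM * pt R d] (fun q => u0 q.1 q.2))
  (mu : measurable_fun [set: RM * pt R d] (fun q => u q.1 q.2)).
Hypothesis hE :
  (\int[uniform_prob T_gt0]_t \int[vol]_x ((u t x - u0 t x) ^+ 2)%:E <= E%:E)%E.

(** The noise law is a parameter, so that the true experiment and the reference one are two
    instances. *)
Definition sampling_with (N : probability RM R) : probability (obs R d) R :=
  ((N \x vol) \x uniform_prob T_gt0)%E.

Lemma ge0_integral_sampling (N : probability RM R) (F : obs R d -> \bar R) :
  measurable_fun [set: obs R d] F -> (forall w, 0 <= F w)%E ->
  (\int[sampling_with N]_w F w =
   \int[uniform_prob T_gt0]_t \int[vol]_x \int[N]_y F (y, x, t))%E.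
Proof.
move=> mF F0; rewrite [LHS]fubini_tonelli2//.
apply: eq_integral => t _; rewrite /fubini_G [LHS]fubini_tonelli2//.
apply: (measurableT_comp mF); exact: measurable_pair2.
Qed.

Lemma measurable_observe (v : R -> pt R d -> R) :
  measurable_fun [set: RM * pt R d] (fun q => v q.1 q.2) ->
  measurable_fun [set: obs R d] (observe v).
Proof.
move=> mv; apply/measurable_fun_pairP; split => /=; last exact: measurable_snd.
apply/measurable_fun_pairP; split => /=; last first.
  exact: (measurableT_comp measurable_snd measurable_fst).
apply: measurable_funD; last exact: (measurableT_comp measurable_fst measurable_fst).
apply: (measurableT_comp mv (_ : measurable_fun _ (fun w : obs R d => (w.2, w.1.2)))).
apply/measurable_fun_pairP; split; first exact: measurable_snd.
exact: (measurableT_comp measurable_snd measurable_fst).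
Qed.

Definition lr (w : obs R d) : R := lratio eta w.1.1 (u w.2 w.1.2 - u0 w.2 w.1.2).

Lemma measurable_lr : measurable_fun [set: obs R d] lr.
Proof.
have mw : measurable_fun [set: obs R d] (fun w : obs R d => (w.2, w.1.2)).
  apply/measurable_fun_pairP; split; first exact: measurable_snd.
  exact: (measurableT_comp measurable_snd measurable_fst).
apply: measurable_lratio => //.
  exact: (measurableT_comp measurable_fst measurable_fst).
apply: measurable_funB; first exact: (measurableT_comp mu mw).
exact: (measurableT_comp mu0 mw).
Qed.

Let lr_ge0 w : 0 <= lr w. Proof. exact: lratio_ge0. Qed.

Lemma integral_observe (g : obs R d -> R) :
  measurable_fun [set: obs R d] g -> (forall x, 0 <= g x) ->
  (\int[sampling_with (normal_prob 0 1)]_w (g (observe u w))%:E =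
   \int[sampling_with (heavy_prob eta01)]_w ((g (observe u0 w))%:E * (lr w)%:E))%E.
Proof.
move=> mg g0.
have mA : measurable_fun [set: obs R d] (fun w => (g (observe u w))%:E).
  by apply/measurable_EFinP; exact: (measurableT_comp mg (measurable_observe mu)).
have mB : measurable_fun [set: obs R d] (fun w => (g (observe u0 w))%:E * (lr w)%:E)%E.
  apply: emeasurable_funM; apply/measurable_EFinP; last exact: measurable_lr.
  exact: (measurableT_comp mg (measurable_observe mu0)).
have A0 w : (0 <= (g (observe u w))%:E)%E by rewrite lee_fin.
have B0 w : (0 <= (g (observe u0 w))%:E * (lr w)%:E)%E by rewrite mule_ge0// lee_fin.
apply: etrans (ge0_integral_sampling (normal_prob 0 1) mA A0) _.
apply/esym; apply: etrans (ge0_integral_sampling (heavy_prob eta01) mB B0) _; apply/esym.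
apply: eq_integral => t _; apply: eq_integral => x _.
  rewrite /observe /lr/=.
  rewrite (@change_noise _ eta eta01 eta0 eta2 (u0 t x) _ (fun y => (g (y, x, t))%:E))//.
    have mz : measurable_fun [set: RM] (fun y : RM => (y, x, t) : obs R d).
      by apply/measurable_fun_pairP; split; [exact: measurable_pair2|exact: measurable_cst].
    by apply/measurable_EFinP; exact: (measurableT_comp mg mz).
  by move=> y; rewrite lee_fin.
Qed.

(** The bound of [integral_lratio_le] is affine in h^2, so averaging it over the design involves
    only the L^2 distance of the two regression functions. *)
Lemma integral_lr :
  (\int[sampling_with (heavy_prob eta01)]_w ((lr w) `^ (1 + s))%:E <=
   (1 + kernel_const K * s * (2 * eta + E))%:E)%E.
Proof.
set C := kernel_const K.
have C0 : 0 < C by apply: (kernel_const_gt0 (eta := eta) (s := s)).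
have s0 : 0 < s by case/andP: s01.
have mlr : measurable_fun [set: obs R d] (fun w => ((lr w) `^ (1 + s))%:E).
  by apply/measurable_EFinP; apply: (measurableT_comp (measurable_powR _)); exact: measurable_lr.
rewrite ge0_integral_sampling//; last by move=> w; rewrite lee_fin powR_ge0.
have mh : measurable_fun [set: RM * pt R d] (fun q => ((u q.1 q.2 - u0 q.1 q.2) ^+ 2)%:E).
  by apply/measurable_EFinP; apply: measurable_funX; exact: measurable_funB.
have mht (t : RM) : measurable_fun [set: pt R d] (fun x => ((u t x - u0 t x) ^+ 2)%:E).
  exact: (@measurableT_comp _ _ _ _ _ _ (fun q : RM * pt R d => ((u q.1 q.2 - u0 q.1 q.2) ^+ 2)%:E)
    _ (fun x => (t, x)) mh (measurable_pair1 t)).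
have h0 t x : (0 <= ((u t x - u0 t x) ^+ 2)%:E)%E by rewrite lee_fin sqr_ge0.
have mI : measurable_fun [set: RM] (fun t => \int[vol]_x ((u t x - u0 t x) ^+ 2)%:E)%E.
  exact: (@measurable_fun_fubini_tonelli_F _ _ _ _ R vol
    (fun q : RM * pt R d => ((u q.1 q.2 - u0 q.1 q.2) ^+ 2)%:E)).
have I0 t : (0 <= \int[vol]_x ((u t x - u0 t x) ^+ 2)%:E)%E by exact: integral_ge0.
apply: (@le_trans _ _ (\int[uniform_prob T_gt0]_t ((1 + C * s * (2 * eta))%:E +
    (C * s)%:E * \int[vol]_x ((u t x - u0 t x) ^+ 2)%:E))%E).
  apply: le_integralT => t.
    by apply: integral_ge0 => x _; apply: integral_ge0 => y _; rewrite lee_fin powR_ge0.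
  apply: (@le_trans _ _ (\int[vol]_x ((1 + C * s * (2 * eta))%:E +
     (C * s)%:E * ((u t x - u0 t x) ^+ 2)%:E))%E).
    apply: le_integralT => x; first by apply: integral_ge0 => y _; rewrite lee_fin powR_ge0.
    rewrite /lr/=.
    have hk := integral_lratio_le eta01 eta0 eta2 s01 etaK (u t x - u0 t x).
    apply: le_trans hk _.
    by rewrite -EFinM -EFinD lee_fin -/C mulrDr addrA.
  rewrite ge0_integralD//.
  + rewrite integral_prob_cst.
    by rewrite ge0_integralZl// lee_fin mulr_ge0 ?ltW.
  + by move=> x _; rewrite lee_fin addr_ge0// !mulr_ge0 ?ltW.
  + by move=> x _; rewrite mule_ge0// lee_fin mulr_ge0 ?ltW.
  + exact: measurable_funeM.
rewrite ge0_integralD//.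
- rewrite integral_prob_cst.
  rewrite ge0_integralZl ?lee_fin ?mulr_ge0 ?(ltW C0) ?(ltW s0)//.
  apply: le_trans (leeD2l _ (lee_wpmul2l _ hE)) _.
    by rewrite lee_fin mulr_ge0 ?ltW.
  by rewrite -EFinM -EFinD lee_fin mulrDr addrA.
- by move=> x _; rewrite lee_fin addr_ge0// !mulr_ge0 ?ltW.
- by move=> x _; rewrite mule_ge0// lee_fin mulr_ge0 ?ltW.
- exact: measurable_funeM.
Qed.

Definition step_const : R := 1 + kernel_const K * s * (2 * eta + E).

(** Hoelder's inequality for g times the likelihood ratio, with the conjugate exponents (1 + s)/s
    and 1 + s. *)
Lemma one_step (g : obs R d -> R) :
  measurable_fun [set: obs R d] g -> (forall x, 0 <= g x <= 1) ->
  (\int[sampling_with (normal_prob 0 1)]_w (g (observe u w))%:E <=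
   step_const%:E *
   (\int[sampling_with (heavy_prob eta01)]_w ((g (observe u0 w)) `^ ((1 + s) / s))%:E)
     `^ ((1 + s) / s)^-1)%E.
Proof.
move=> mg g01.
have g0 x : 0 <= g x by case/andP: (g01 x).
have s0 : 0 < s by case/andP: s01.
apply: (le_eq_trans (integral_observe mg g0)).
have mgo := measurableT_comp mg (measurable_observe mu0).
have := @hoelder _ _ _ (sampling_with (heavy_prob eta01)) (g \o observe u0) lr
  ((1 + s) / s) (1 + s) mgo measurable_lr.
rewrite divr_gt0 ?addr_gt0// => /(_ isT isT).
have -> : ((1 + s) / s)^-1 + (1 + s)^-1 = 1.
  by field; rewrite !gt_eqF ?addr_gt0.
move=> /(_ erefl); rewrite Lnorm1.
move=> H; apply: le_trans (_ : _ <= \int[sampling_with (heavy_prob eta01)]_w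
    `|(EFin \o ((g \o observe u0) \* lr)%R) w|)%E _.
  apply: le_of_eq; apply: eq_integral => w _.
  by rewrite [RHS]gee0_abs//= lee_fin mulr_ge0.
apply: le_trans H _.
have EA : ('N[sampling_with (heavy_prob eta01)]_(1 + s)%:E[EFin \o lr] =
    (\int[sampling_with (heavy_prob eta01)]_w ((lr w) `^ (1 + s))%:E) `^ (1 + s)^-1)%E.
  rewrite unlock; congr (_ `^ _)%E; apply: eq_integral => w _.
  by rewrite /= ger0_norm.
have EB : ('N[sampling_with (heavy_prob eta01)]_((1 + s) / s)%:E[EFin \o (g \o observe u0)] =
    (\int[sampling_with (heavy_prob eta01)]_w ((g (observe u0 w)) `^ ((1 + s) / s))%:E)
      `^ ((1 + s) / s)^-1)%E.
  rewrite unlock; congr (_ `^ _)%E; apply: eq_integral => w _.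
  by rewrite /= ger0_norm.
rewrite EA EB muleC {EA EB}.
apply: lee_pmul; rewrite ?poweR_ge0//.
have hl := integral_lr.
have I0 : (0 <= \int[sampling_with (heavy_prob eta01)]_w ((lr w) `^ (1 + s))%:E)%E.
  by apply: integral_ge0 => w _; rewrite lee_fin powR_ge0.
have c1 : 1 <= step_const.
  have := kernel_const_gt0 (eta := eta) (s := s) (K := K).
  have E0 : 0 <= E.
    rewrite -lee_fin; apply: le_trans hE; apply: integral_ge0 => t _.
    by apply: integral_ge0 => x _; rewrite lee_fin sqr_ge0.
  move=> /(_ eta0 etaK) C0.
  rewrite /step_const lerDl !mulr_ge0 ?(ltW C0) ?(ltW s0)// addr_ge0// mulr_ge0//.
  exact: ltW.
(* The root of order 1 + s is dropped, as [step_const] is at least 1. *)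
apply: (@le_trans _ _ (step_const%:E `^ (1 + s)^-1)%E).
  apply: gt0_ler_poweR => //.
  - by rewrite invr_ge0 addr_ge0// ltW.
  - by rewrite in_itv/= I0 leey.
  - by rewrite in_itv/= leey lee_fin (le_trans ler01 c1).
rewrite poweR_EFin lee_fin; apply: ler1_powR => //.
by rewrite invf_le1 ?addr_gt0// lerDl ltW.
Qed.

End OneStep.

(** * Sums of rescaled bumps *)

Lemma is_derive_bigsum (R : realType) (V : normedModType R) (I : Type) (r : seq I)
    (f : I -> V -> R) (df : I -> R) (x v : V) :
  (forall i, is_derive x v (f i) (df i)) ->
  is_derive x v (fun y => \sum_(i <- r) f i y) (\sum_(i <- r) df i).
Proof.
move=> h; elim: r => [|i r IH].
  rewrite big_nil; rewrite (_ : (fun y => _) = cst 0); first exact: is_derive_cst.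
  by apply/funext => y; rewrite big_nil.
rewrite big_cons (_ : (fun y => _) = f i + (fun y => \sum_(j <- r) f j y)).
  exact: is_deriveD.
by apply/funext => y; rewrite big_cons.
Qed.

Lemma continuous_bigsum (R : realType) (T : topologicalType) (I : Type) (r : seq I)
    (f : I -> T -> R) : (forall i, continuous (f i)) ->
  continuous (fun y => \sum_(i <- r) f i y).
Proof.
move=> h; elim: r => [|i r IH] y.
  by under eq_fun do rewrite big_nil; exact: cvg_cst.
under eq_fun do rewrite big_cons.
by apply: cvgD; [exact: h|exact: IH].
Qed.

Lemma continuous_bigprod (R : realType) (T : topologicalType) (I : Type) (r : seq I)
    (f : I -> T -> R) : (forall i, continuous (f i)) ->
  continuous (fun y => \prod_(i <- r) f i y).
Proof.
move=> h; elim: r => [|i r IH] y.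
  by under eq_fun do rewrite big_nil; exact: cvg_cst.
under eq_fun do rewrite big_cons.
by apply: cvgM; [exact: h|exact: IH].
Qed.

Section Cells.
Context {R : realType} {d : nat} (J : nat).
Local Notation cell := {ffun 'I_d -> 'I_J}.
Local Notation ptd := (pt R d).
Implicit Types (l : cell) (k : 'I_d -> nat) (a : cell -> R) (y : 'rV[R]_d).

(* n-th derivative of the bump of the m-th interval of length 1/J *)
Definition factor (n m : nat) (t : R) : R := J%:R ^+ n * bump n (J%:R * t - m%:R).

Definition cellf k l y : R := \prod_i factor (k i) (l i) (y 0 i).

(* Partial derivative of order k (a multi-index) of the combination, with weights a, of
   the bumps of the cells l *)
Definition Phi a k y : R := \sum_l a l * cellf k l y.

Definition kinc (i : 'I_d) k : 'I_d -> nat := fun j => ((j == i) + k j)%N.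

Definition incell l y := forall i, 0 < J%:R * y 0 i - (l i)%:R < 1.

Lemma is_derive_factor n m (t : R) : is_derive t 1 (factor n m) (factor n.+1 m t).
Proof.
have dl : is_derive t 1 (fun t : R => J%:R * t - m%:R) (J%:R).
  have := is_deriveB (is_deriveZ J%:R (is_derive_id t 1)) (is_derive_cst (m%:R : R) t 1).
  by rewrite subr0 /GRing.scale/= mulr1.
have db := @is_derive1_comp R (bump n) (fun t => J%:R * t - m%:R) t _ _ (is_derive_bump n _) dl.
have := is_deriveZ (J%:R ^+ n) db.
by rewrite /GRing.scale/= /factor exprS mulrA [_ * J%:R]mulrC mulrA => h; apply: is_derive_eq h _; rewrite mulrAC.
Qed.

Lemma continuous_factor n m : continuous (factor n m).
Proof.
move=> x; apply/differentiable_continuous/derivable1_diffP.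
by have [] := is_derive_factor n m x.
Qed.

Lemma is_derive_coord i (F : 'rV[R]_d -> R) (f : R -> R) (C df : R) y :
  (forall h : R, F (h *: delta_mx 0 i + y) = C * f (h + y 0 i)) ->
  is_derive (y 0 i) 1 f df -> is_derive y (delta_mx 0 i) F (C * df).
Proof.
move=> FE dF.
have dG := is_deriveZ C dF.
have E : (fun h : R => h^-1 *: (F (h *: delta_mx 0 i + y) - F y)) =
         (fun h : R => h^-1 *: ((C *: f) (h *: 1 + y 0 i) - (C *: f) (y 0 i))).
  apply/funext => h; rewrite FE.
  have -> : F y = C * f (y 0 i).
    by have := FE 0; rewrite scale0r !add0r.
  by rewrite /GRing.scale/= mulr1.
case: dG => dG1 dG2; apply: DeriveDef.
  by rewrite /derivable; rewrite /derivable in dG1; rewrite -E in dG1.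
by rewrite /derive; rewrite /derive -E in dG2; exact: dG2.
Qed.

Lemma is_derive_cellf i k l y :
  is_derive y (delta_mx 0 i) (cellf k l) (cellf (kinc i k) l y).
Proof.
rewrite /cellf (bigD1 i)//= mulrC.
rewrite (_ : \prod_(j | j != i) _ = \prod_(j | j != i) factor (k j) (l j) (y 0 j)).
  apply: (@is_derive_coord i _ (factor (k i) (l i))).
    move=> h; rewrite (bigD1 i)//= mulrC; congr (_ * _).
      apply: eq_bigr => j ji; rewrite !mxE eqxx/= (negbTE ji) mulr0 add0r//.
    by rewrite !mxE !eqxx mulr1.
  by rewrite /kinc eqxx; exact: is_derive_factor.
by apply: eq_bigr => j ji; rewrite /kinc (negbTE ji).
Qed.

Lemma is_derive_Phi i a k y :
  is_derive y (delta_mx 0 i) (Phi a k) (Phi a (kinc i k) y).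
Proof.
apply: is_derive_bigsum => l.
exact: (is_deriveZ (a l) (is_derive_cellf i k l y)).
Qed.

Lemma pderiv_Phi i a k : pderiv i (Phi a k) = Phi a (kinc i k).
Proof. by apply/funext => y; have [_] := is_derive_Phi i a k y. Qed.

Lemma continuous_cellf k l : continuous (cellf k l).
Proof.
apply: continuous_bigprod => i y.
apply: (@continuous_comp _ _ _ (fun y : 'rV[R]_d => y 0 i) (factor (k i) (l i))).
  exact: coord_continuous.
exact: continuous_factor.
Qed.

Lemma continuous_Phi a k : continuous (Phi a k).
Proof.
apply: continuous_bigsum => l y.
have h : {for y, continuous (cellf k l)} by exact: continuous_cellf.
have hc : {for y, continuous (fun _ : 'rV[R]_d => a l)} by exact: cst_continuous.
first [exact: (continuousM hc h)|exact: (cvgM hc h)].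
Qed.

Lemma foldr_pderiv_Phi a k s :
  foldr pderiv (Phi a k) s = Phi a (foldr kinc k s).
Proof. by elim: s => //= i s ->; rewrite pderiv_Phi. Qed.

Lemma smooth_Phi a k : smooth (Phi a k).
Proof.
move=> s /=; rewrite foldr_pderiv_Phi; split; first exact: continuous_Phi.
by move=> i x; have [] := is_derive_Phi i a (foldr kinc k s) x.
Qed.

Lemma factor_neq0 n m t : factor n m t != 0 -> 1 / 4 < J%:R * t - m%:R < 3 / 4.
Proof.
by apply: contraNT => h; rewrite /factor bump_out// mulr0.
Qed.

Lemma cellf_neq0 k l y : cellf k l y != 0 ->
  forall i, 1 / 4 < J%:R * y 0 i - (l i)%:R < 3 / 4.
Proof.
move=> h i; apply: (@factor_neq0 (k i)); apply: contraNN h => /eqP h.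
by rewrite /cellf (bigD1 i)//= h mul0r.
Qed.

Lemma cellf_incell k l y : cellf k l y != 0 -> incell l y.
Proof. by move=> /cellf_neq0 h i; have /andP[h1 h2] := h i; apply/andP; split; lra. Qed.

Lemma incell_uniq l l' y : incell l y -> incell l' y -> l = l'.
Proof.
move=> h h'; apply/ffunP => i; apply/val_inj => /=.
have /andP[h1 h2] := h i; have /andP[h3 h4] := h' i.
have a1 : (l i)%:R < (l' i).+1%:R :> R by rewrite -natr1; lra.
have a2 : (l' i)%:R < (l i).+1%:R :> R by rewrite -natr1; lra.
by move: a1 a2; rewrite !ltr_nat !ltnS => a1 a2; apply/eqP; rewrite eqn_leq a1.
Qed.

Lemma incell_cube l y : incell l y -> cube y.
Proof.
move=> h i; have /andP[h1 h2] := h i.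
have J0 : 0 < J%:R :> R by rewrite ltr0n; exact: leq_trans (ltn_ord (l i)).
apply/andP; split; first by rewrite -(pmulr_rgt0 _ J0); have := ler0n R (l i); lra.
rewrite -(ltr_pM2l J0) mulr1; have : (l i).+1%:R <= J%:R :> R by rewrite ler_nat.
rewrite -natr1; lra.
Qed.

Lemma cellf_out k l y : ~ cube y -> cellf k l y = 0.
Proof. by move=> h; apply/eqP/negPn/negP => /cellf_incell/incell_cube. Qed.

Lemma Phi_out a k y : ~ cube y -> Phi a k y = 0.
Proof. by move=> h; rewrite /Phi big1// => l _; rewrite cellf_out// mulr0. Qed.

Lemma test_fun_Phi a k : (0 < J)%N -> test_fun (Phi a k).
Proof.
move=> J0'; have J0 : 0 < J%:R :> R by rewrite ltr0n.
split; first exact: smooth_Phi.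
(* A quarter of the side of a cell: every bump vanishes closer to the boundary than this. *)
pose e : R := 1 / (4 * J%:R).
exists [set y : 'rV[R]_d | forall i, `[e, 1 - e]%classic (y ord0 i)]; split.
- by apply: (@rV_compact R d (fun=> `[e, 1 - e]%classic)) => i; exact: segment_compact.
- move=> y /= h i; have := h i; rewrite in_itv/= => /andP[h1 h2].
  have e0 : 0 < e by rewrite divr_gt0// mulr_gt0.
  by apply/andP; split; lra.
- move=> y hy; rewrite /Phi big1// => l _; have [->|h] := eqVneq (cellf k l y) 0.
    by rewrite mulr0.
  exfalso; apply: hy => i /=; have /andP[h1 h2] := cellf_neq0 h i.
  have JE : J%:R * e = 1 / 4 by rewrite /e; field; rewrite gt_eqF.
  have : (l i).+1%:R <= J%:R :> R by rewrite ler_nat.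
  have := ler0n R (l i).
  rewrite in_itv/= -natr1 -(ler_pM2l J0 e) -(ler_pM2l J0 _ (1 - e)) mulrBr JE => *.
  apply/andP; split; lra.
Qed.

Definition korder k : nat := (\sum_i k i)%N.

Lemma korder_kinc i k : korder (kinc i k) = (korder k).+1.
Proof.
rewrite /korder /kinc big_split/= (bigD1 i)//= eqxx big1 ?addn0//.
by move=> j /negbTE ->.
Qed.

Lemma L2_Phi a k : L2 (fun x : ptd => Phi a k (rv x)).
Proof.
have [M M0 hM] := cube_bounded (@continuous_Phi a k).
apply: (@L2_bounded _ _ _ M); first by apply: measurable_rv; exact: continuous_Phi.
move=> x; have [c|c] := pselect (cube (rv x)); first exact: hM.
by rewrite Phi_out// normr0.
Qed.

(** The product of [Phi a k] and phi vanishes outside the cube because its first factor does, so its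
    i-th partial derivative has integral zero. *)
Lemma inner_Phi_pderiv i a k (phi : 'rV[R]_d -> R) :
  continuous phi -> continuous (pderiv i phi) ->
  (forall x, derivable phi x (delta_mx 0 i)) ->
  inner (fun x : ptd => Phi a k (rv x)) (fun x => pderiv i phi (rv x)) =
  - inner (fun x : ptd => Phi a (kinc i k) (rv x)) (fun x => phi (rv x)).
Proof.
move=> cphi cdphi dphi.
pose F := fun y : 'rV[R]_d => Phi a k y * phi y.
have dF y : is_derive y (delta_mx 0 i) F
    (Phi a k y * pderiv i phi y + phi y * Phi a (kinc i k) y).
  have dp : is_derive y (delta_mx 0 i) phi (pderiv i phi y).
    by apply: DeriveDef => //; exact: dphi.
  exact: (is_deriveM (is_derive_Phi i a k y) dp).
have pF : pderiv i F = fun y => Phi a k y * pderiv i phi y + Phi a (kinc i k) y * phi y.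
  by apply/funext => y; have [_ E] := dF y; rewrite /pderiv E [phi y * _]mulrC.
have c1 : continuous (fun y => Phi a k y * pderiv i phi y).
  by move=> y; exact: (cvgM (@continuous_Phi a k y) (cdphi y)).
have c2 : continuous (fun y => Phi a (kinc i k) y * phi y).
  by move=> y; exact: (cvgM (@continuous_Phi a (kinc i k) y) (cphi y)).
have cF : continuous (pderiv i F).
  by rewrite pF => y; exact: (cvgD (c1 y) (c2 y)).
have bnd (G : 'rV[R]_d -> R) : continuous G -> (forall y, ~ cube y -> G y = 0) ->
    exists M : R, forall y, `|G y| <= M.
  move=> cG G0; have [M M0 hM] := cube_bounded cG; exists M => y.
  have [c|c] := pselect (cube y); first exact: hM.
  by rewrite G0// normr0.
have int (G : 'rV[R]_d -> R) : continuous G -> (forall y, ~ cube y -> G y = 0) ->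
    vol.-integrable [set: ptd] (EFin \o (fun x => G (rv x))).
  move=> cG G0; have [M hM] := bnd G cG G0.
  by apply: (@integrable_iid_bounded _ _ _ _ _ _ M) => //; exact: measurable_rv.
have out0 y : ~ cube y -> pderiv i F y = 0.
  by move=> cy; rewrite pF !Phi_out// !mul0r addr0.
have [M hM] := bnd (pderiv i F) cF out0.
have dF' y : derivable F y (delta_mx 0 i) by have [] := dF y.
have F0 y : ~ cube y -> F y = 0 by move=> cy; rewrite /F Phi_out// mul0r.
have I0 := integral_pderiv0 dF' cF F0 hM.
apply/eqP; rewrite -subr_eq0 opprK /inner -RintegralD//; last 2 first.
- by apply: (int (fun y => Phi a k y * pderiv i phi y)) => // y cy; rewrite Phi_out// mul0r.
- by apply: (int (fun y => Phi a (kinc i k) y * phi y)) => // y cy; rewrite Phi_out// mul0r.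
by apply/eqP; rewrite /Rintegral; move: I0; rewrite pF => ->.
Qed.

Lemma inner_Phi_iter i n a k (phi : 'rV[R]_d -> R) : smooth phi ->
  inner (fun x : ptd => Phi a k (rv x)) (fun x => iter n (pderiv i) phi (rv x)) =
  (-1) ^+ n * inner (fun x : ptd => Phi a (iter n (kinc i) k) (rv x)) (fun x => phi (rv x)).
Proof.
elim: n phi k => [|n IH] phi k sp; first by rewrite expr0 mul1r.
have sp' : smooth (pderiv i phi).
  by move=> s; have := sp (rcons s i); rewrite foldr_rcons.
rewrite iterSr IH// inner_Phi_pderiv//.
- by rewrite mulrN exprS mulN1r mulNr.
- by have [] := sp [::].
- by have [] := sp' [::].
- by have [_] := sp [::]; apply.
Qed.

Lemma smooth_iter i n (phi : 'rV[R]_d -> R) : smooth phi -> smooth (iter n (pderiv i) phi).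
Proof.
move=> sp; elim: n => // n IH s; rewrite iterS.
by have := IH (rcons s i); rewrite foldr_rcons.
Qed.

Lemma inner_Phi_mideriv m (b : {ffun 'I_d -> 'I_m.+1}) a k (phi : 'rV[R]_d -> R) :
  smooth phi ->
  inner (fun x : ptd => Phi a k (rv x)) (mideriv b phi \o rv) =
  (-1) ^+ miorder b *
  inner (fun x : ptd => Phi a (fun j => (b j + k j)%N) (rv x)) (phi \o rv).
Proof.
move=> sp; rewrite /mideriv /miorder.
(* Each coordinate of the list moves its derivatives onto [Phi], which raises the multi-index; hence
   the induction is over an arbitrary initial [k0]. The increments are then summed coordinate by
   coordinate. *)
have gen (s : seq 'I_d) k0 :
    smooth (foldr (fun i psi => iter (b i) (pderiv i) psi) phi s) /\
    inner (fun x : ptd => Phi a k0 (rv x))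
      (foldr (fun i psi => iter (b i) (pderiv i) psi) phi s \o rv) =
    (-1) ^+ (\sum_(i <- s) b i) *
    inner (fun x : ptd => Phi a (foldl (fun k i => iter (b i) (kinc i) k) k0 s) (rv x)) (phi \o rv).
  elim: s k0 => [|i s IH] k0; first by rewrite big_nil expr0 mul1r.
  split; first by apply: smooth_iter; case: (IH k0).
  rewrite /= inner_Phi_iter; last by case: (IH k0).
  have [_ ->] := IH (iter (b i) (kinc i) k0).
  by rewrite big_cons exprD mulrA.
have [_ ->] := gen (enum 'I_d) k; rewrite big_enum; congr (_ * inner _ _).
apply/funext => x; congr (Phi a _ (rv x)); apply/funext => j.
have it n i k0 : iter n (kinc i) k0 j = (n * (j == i) + k0 j)%N.
  by elim: n => [//|n IH]; rewrite iterS {1}/kinc IH mulSn addnA.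
have fl (s : seq 'I_d) k0 : foldl (fun k i => iter (b i) (kinc i) k) k0 s j =
    (\sum_(i <- s) b i * (j == i) + k0 j)%N.
  elim: s k0 => [|i s IH] k0; first by rewrite big_nil.
  by rewrite /= IH it big_cons addnA [(b i * _ + _)%N]addnC.
rewrite fl big_enum/= (bigD1 j)//= eqxx muln1 big1 ?addn0// => i ij.
by rewrite eq_sym (negbTE ij) muln0.
Qed.

Lemma weak_deriv_Phi m (b : {ffun 'I_d -> 'I_m.+1}) a k :
  weak_deriv b (fun x : ptd => Phi a k (rv x))
    (fun x => Phi a (fun j => (b j + k j)%N) (rv x)).
Proof. by move=> phi [sp _]; exact: inner_Phi_mideriv. Qed.

Lemma PhiZ (c : R) a k y : Phi (fun l => c * a l) k y = c * Phi a k y.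
Proof. by rewrite /Phi mulr_sumr; apply: eq_bigr => l _; rewrite mulrA. Qed.

Lemma PhiB a b k y : Phi (fun l => a l - b l) k y = Phi a k y - Phi b k y.
Proof. by rewrite /Phi -sumrB; apply: eq_bigr => l _; rewrite mulrBl. Qed.

End Cells.

Lemma bump_const (R : realType) m : exists2 M : R, 1 <= M & forall k, (k <= m)%N ->
  (forall x : R, `|bump k x| <= M) /\
  (forall x y : R, `|bump k x - bump k y| <= M * `|x - y|).
Proof.
have one k : exists2 M : R, 1 <= M & (forall x : R, `|bump k x| <= M) /\
    (forall x y : R, `|bump k x - bump k y| <= M * `|x - y|).
  have [A A0 hA] := @bump_bounded R k; have [L L0 hL] := @bump_lipschitz R k.
  exists (1 + A + L); first by rewrite -addrA lerDl addr_ge0// ltW.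
  split=> [x|x y]; first by apply: le_trans (hA x) _; lra.
  by apply: le_trans (hL x y) _; apply: ler_wpM2r => //; lra.
elim: m => [|m [M M1 IH]].
  by have [M M1 h] := one 0%N; exists M => // k; rewrite leqn0 => /eqP ->.
have [M' M'1 [h1 h2]] := one m.+1.
have M0 : 0 <= M by exact: le_trans M1.
have M'0 : 0 <= M' by exact: le_trans M'1.
exists (M + M'); first by rewrite (le_trans M1)// lerDl.
move=> k; rewrite leq_eqVlt => /orP[/eqP ->|/IH[h3 h4]].
  split=> [x|x y]; first by apply: le_trans (h1 x) _; lra.
  by apply: le_trans (h2 x y) _; apply: ler_wpM2r => //; lra.
split=> [x|x y]; first by apply: le_trans (h3 x) _; lra.
by apply: le_trans (h4 x y) _; apply: ler_wpM2r => //; lra.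
Qed.

(** Telescoping. The increments are measured relative to the bounds B i, so that the product of all
    the bounds factors out. *)
Lemma prod_diff (R : realType) (I : Type) (r : seq I) (u v B e : I -> R) :
  (forall i, `|u i| <= B i) -> (forall i, `|v i| <= B i) ->
  (forall i, `|u i - v i| <= B i * e i) ->
  `|\prod_(i <- r) u i - \prod_(i <- r) v i| <= (\prod_(i <- r) B i) * \sum_(i <- r) e i.
Proof.
move=> hu hv he; elim: r => [|i r IH]; first by rewrite !big_nil subrr normr0 mulr0.
have B0 j : 0 <= B j by exact: le_trans (normr_ge0 _) (hu j).
rewrite !big_cons; set U := \prod_(j <- r) u j; set V := \prod_(j <- r) v j.
set P := \prod_(j <- r) B j; set S := \sum_(j <- r) e j.
have -> : u i * U - v i * V = (u i - v i) * U + v i * (U - V) by ring.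
have hU : `|U| <= P by rewrite /U normr_prod; apply: ler_prod => j _; rewrite normr_ge0 hu.
have P0 : 0 <= P by apply: prodr_ge0.
apply: le_trans (ler_normD _ _) _; rewrite !normrM.
have h1 : `|u i - v i| * `|U| <= (B i * e i) * P by apply: ler_pM.
have h2 : `|v i| * `|U - V| <= B i * (P * S) by apply: ler_pM.
apply: le_trans (lerD h1 h2) _; apply: le_of_eq; ring.
Qed.

(** * Uniform and Lipschitz bounds independent of the number of cells *)

Section CellBounds.
Context {R : realType} {d : nat} (J : nat).
Local Notation cell := {ffun 'I_d -> 'I_J}.
Local Notation ptd := (pt R d).
Implicit Types (l : cell) (k : 'I_d -> nat) (a : cell -> R) (y : 'rV[R]_d).
Variables (m : nat) (M : R).
Hypotheses (M1 : 1 <= M) (hM : forall n, (n <= m)%N ->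
  (forall x : R, `|bump n x| <= M) /\
  (forall x y : R, `|bump n x - bump n y| <= M * `|x - y|)).

Lemma prod_powJ k (c : R) : \prod_i (J%:R ^+ k i * c) = J%:R ^+ korder k * c ^+ d :> R.
Proof.
rewrite big_split/= prodr_const card_ord; congr (_ * _).
by rewrite /korder (big_morph (fun n => J%:R ^+ n) (exprD _) (expr0 _)).
Qed.

Let M0 : 0 <= M. Proof. exact: le_trans M1. Qed.

Lemma factor_bound n p t : (n <= m)%N -> `|factor J n p t| <= J%:R ^+ n * M.
Proof.
move=> nm; rewrite normrM ger0_norm ?exprn_ge0// ler_wpM2l ?exprn_ge0//.
by have [h _] := hM nm; exact: h.
Qed.

Lemma cellf_bound k l y : (forall i, (k i <= m)%N) ->
  `|cellf k l y| <= J%:R ^+ korder k * M ^+ d.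
Proof.
move=> km; rewrite -prod_powJ normr_prod; apply: ler_prod => i _.
by rewrite normr_ge0 factor_bound.
Qed.

Lemma cellf_lip k l y z : (forall i, (k i <= m)%N) ->
  `|cellf k l y - cellf k l z| <=
  J%:R ^+ (korder k).+1 * M ^+ d * \sum_i `|y 0 i - z 0 i|.
Proof.
move=> km.
have h i : `|factor J (k i) (l i) (y 0 i) - factor J (k i) (l i) (z 0 i)| <=
    (J%:R ^+ k i * M) * (J%:R * `|y 0 i - z 0 i|).
  rewrite -mulrBr normrM ger0_norm ?exprn_ge0// -mulrA ler_wpM2l ?exprn_ge0//.
  have [_ h] := hM (km i); apply: le_trans (h _ _) _.
  rewrite ler_wpM2l// opprB addrA addrNK -mulrBr normrM ger0_norm//.
apply: le_trans (prod_diff _ (fun i => factor_bound _ _ (km i))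
  (fun i => factor_bound _ _ (km i)) h) _.
rewrite prod_powJ -mulr_sumr exprS; apply: le_of_eq; ring.
Qed.

Lemma Phi_single a k l y : incell l y -> Phi a k y = a l * cellf k l y.
Proof.
move=> ly; rewrite /Phi (bigD1 l)//= big1 ?addr0// => l' l'l.
have [->|/cellf_incell h] := eqVneq (cellf k l' y) 0; first by rewrite mulr0.
by move: l'l; rewrite (incell_uniq h ly) eqxx.
Qed.

Lemma Phi_none a k y : (forall l, ~ incell l y) -> Phi a k y = 0.
Proof.
move=> h; rewrite /Phi big1// => l _.
by have [->|/cellf_incell/h//] := eqVneq (cellf k l y) 0; rewrite mulr0.
Qed.

Lemma Phi_bound a k y : (forall i, (k i <= m)%N) -> (forall l, `|a l| <= 1) ->
  `|Phi a k y| <= J%:R ^+ korder k * M ^+ d.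
Proof.
move=> km a1; have [[l ly]|/forallNP h] := pselect (exists l, incell l y).
  rewrite (Phi_single _ _ ly) normrM.
  by apply: le_trans (ler_wpM2r (normr_ge0 _) (a1 l)) _; rewrite mul1r cellf_bound.
by rewrite Phi_none// normr0 mulr_ge0 ?exprn_ge0.
Qed.

(** In a common cell only one term of the sum is nonzero and [cellf_lip] applies. Otherwise the
    function of the cell of one point vanishes at the other point, so each of the two values is
    already bounded by the Lipschitz estimate of a single cell; this explains the factor 2. *)
Lemma Phi_lip a k y z : (forall i, (k i <= m)%N) -> (forall l, `|a l| <= 1) ->
  `|Phi a k y - Phi a k z| <=
  2 * (J%:R ^+ (korder k).+1 * M ^+ d * \sum_i `|y 0 i - z 0 i|).
Proof.
move=> km a1; set B := _ * _ * \sum_i _.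
have cl l y' z' : `|cellf k l y' - cellf k l z'| = `|cellf k l z' - cellf k l y'|.
  exact: distrC.
have one l y' : (y' = y \/ y' = z) -> incell l y' ->
    (incell l y /\ incell l z) \/ `|Phi a k y'| <= B.
  move=> yy ly.
  have Bs : `|cellf k l y - cellf k l z| <= B by exact: cellf_lip.
  rewrite (Phi_single _ _ ly).
  case: yy ly => -> ly.
    have [z0|/cellf_incell h] := eqVneq (cellf k l z) 0; [right|by left].
    rewrite normrM; apply: le_trans (ler_wpM2r (normr_ge0 _) (a1 l)) _.
    by rewrite mul1r -[cellf k l y]subr0 -z0.
  have [y0|/cellf_incell h] := eqVneq (cellf k l y) 0; [right|by left].
  rewrite normrM; apply: le_trans (ler_wpM2r (normr_ge0 _) (a1 l)) _.
  by rewrite mul1r -[cellf k l z]subr0 -y0 distrC.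
have B0 : 0 <= B by rewrite mulr_ge0 ?mulr_ge0 ?exprn_ge0// sumr_ge0.
have both l : incell l y -> incell l z -> `|Phi a k y - Phi a k z| <= 2 * B.
  move=> ly lz; rewrite (Phi_single _ _ ly) (Phi_single _ _ lz) -mulrBr normrM.
  apply: le_trans (ler_wpM2r (normr_ge0 _) (a1 l)) _; rewrite mul1r.
  by apply: le_trans (cellf_lip _ _ _ km) _; rewrite -/B; lra.
have H y' : (y' = y \/ y' = z) ->
    (exists l, incell l y /\ incell l z) \/ `|Phi a k y'| <= B.
  move=> yy; have [[l ly]|/forallNP h] := pselect (exists l, incell l y').
    by have [h|h] := one l y' yy ly; [left; exists l|right].
  by right; rewrite Phi_none// normr0.
have [[l [ly lz]]|hy] := H y (or_introl erefl); first exact: both ly lz.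
have [[l [ly lz]]|hz] := H z (or_intror erefl); first exact: both ly lz.
by apply: le_trans (ler_normB _ _) _; lra.
Qed.

End CellBounds.

Section UniformBox.
Context {R : realType} {d : nat}.
Local Notation ptd := (pt R d).
Local Notation U := (uniform_prob (@ltr01 R)).

Lemma uniform_itv (a b : R) : 0 <= a -> a <= b -> b <= 1 -> U `[a, b]%classic = (b - a)%:E.
Proof.
move=> a0 ab b1; rewrite /uniform_prob (eq_integral (fun=> 1%E)); last first.
  move=> x; rewrite inE/= in_itv/= => /andP[h1 h2].
  rewrite /uniform_pdf subr0 invr1 ifT//; apply/andP; split; lra.
rewrite integral_cst//= mul1e lebesgue_measure_itv/= lte_fin.
case: ltP => [_|ba]; first by rewrite EFinB.
by rewrite (_ : b = a) ?subrr//; apply/eqP; rewrite eq_le ab ba.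
Qed.

Lemma ball1E (c r : R) : [set t : measurableTypeR R | (`|c - t| <= r)%R] = `[(c - r)%R, (c + r)%R]%classic.
Proof.
by apply/seteqP; split => t; rewrite /= in_itv/= ler_distlC => /andP[h1 h2];
  apply/andP; split; lra.
Qed.

Lemma measurable_ball1 (c r : R) : measurable [set t : measurableTypeR R | (`|c - t| <= r)%R].
Proof. by rewrite ball1E; exact: measurable_itv. Qed.

Lemma uniform_ball (c r : R) : 0 <= r ->
  (U [set t : measurableTypeR R | (`|c - t| <= r)%R] <= (2 * r)%:E)%E.
Proof.
move=> r0; rewrite ball1E /uniform_prob.
apply: (@le_trans _ _ (\int[lebesgue_measure]_(x in `[(c - r)%R, (c + r)%R]) 1%E)%E).
  apply: ge0_le_integral => //.
  - by move=> x _; rewrite lee_fin uniform_pdf_ge0.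
  - by apply/measurable_EFinP/measurable_funTS; exact: measurable_uniform_pdf.
  - move=> x _; rewrite lee_fin /uniform_pdf subr0 invr1; by case: ifP.
rewrite integral_cst//= mul1e lebesgue_measure_itv/= lte_fin.
case: ltP => _; last by rewrite lee_fin mulr_ge0.
by rewrite -EFinB lee_fin; lra.
Qed.

Lemma measurable_ball (x : ptd) (r : R) :
  measurable [set y : ptd | forall i, (`|tnth x i - tnth y i| <= r)%R].
Proof.
apply: (measurable_box (A := fun i => [set t : measurableTypeR R | (`|tnth x i - t| <= r)%R])).
by move=> i; exact: measurable_ball1.
Qed.

Lemma vol_ball (x : ptd) (r : R) : 0 <= r ->
  (vol [set y : ptd | forall i, (`|tnth x i - tnth y i| <= r)%R] <= ((2 * r) ^+ d)%:E)%E.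
Proof.
move=> r0; rewrite /vol (iid_box U (A := fun i => [set t : measurableTypeR R | (`|tnth x i - t| <= r)%R])); last first.
  by move=> i; exact: measurable_ball1.
rewrite (_ : ((2 * r) ^+ d)%R = (\prod_(i < d) (2 * r))%R); last by rewrite prodr_const card_ord.
suff : (0 <= \prod_(i < d) U [set t : measurableTypeR R | (`|tnth x i - t| <= r)%R] <= (\prod_(i < d) (2 * r))%:E)%E.
  by case/andP.
apply: (big_ind2 (fun (a : \bar R) (b : R) => (0 <= a <= b%:E)%E)) => //.
- by rewrite lee_fin ler01 lexx.
- move=> a b a' b' /andP[h1 h2] /andP[h3 h4].
  by rewrite mule_ge0//= EFinM lee_pmul.
- by move=> i _; rewrite measure_ge0 uniform_ball.
Qed.

End UniformBox.

(** * Lower bound of the L^2 norm of a sum of bumps *)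

Section PhiLower.
Context {R : realType} {d : nat}.
Local Notation ptd := (pt R d).
Local Notation U := (uniform_prob (@ltr01 R)).

Definition subcell J (p q : 'I_d -> R) (l : {ffun 'I_d -> 'I_J}) :=
  [set x : ptd | forall i, (p i <= J%:R * tnth x i - (l i)%:R <= q i)%R].

Lemma subcellE J p q (l : {ffun 'I_d -> 'I_J}) : (0 < J)%N ->
  subcell p q l = [set x : ptd | forall i,
    `[((p i + (l i)%:R) / J%:R)%R, ((q i + (l i)%:R) / J%:R)%R]%classic (tnth x i)].
Proof.
move=> J0'; have J0 : 0 < J%:R :> R by rewrite ltr0n.
by apply/seteqP; split => x h i; have := h i;
  rewrite /= in_itv/= ler_pdivrMr// ler_pdivlMr// => /andP[h1 h2]; apply/andP; split; lra.
Qed.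

Lemma measurable_subcell J p q (l : {ffun 'I_d -> 'I_J}) : (0 < J)%N ->
  measurable (subcell p q l).
Proof.
move=> J0; rewrite subcellE//.
apply: (measurable_box (A := fun i : 'I_d => `[((p i + (l i)%:R) / J%:R)%R, ((q i + (l i)%:R) / J%:R)%R]%classic)).
by move=> i; exact: measurable_itv.
Qed.

Lemma vol_subcell J p q (l : {ffun 'I_d -> 'I_J}) : (0 < J)%N ->
  (forall i, [/\ 0 <= p i, p i <= q i & q i <= 1]) ->
  vol (subcell p q l) = (\prod_i ((q i - p i) / J%:R))%:E.
Proof.
move=> J0' h; have J0 : 0 < J%:R :> R by rewrite ltr0n.
rewrite subcellE// /vol (iid_box U (A := fun i : 'I_d => `[((p i + (l i)%:R) / J%:R)%R, ((q i + (l i)%:R) / J%:R)%R]%classic)).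
  rewrite (eq_bigr (fun i => ((q i - p i) / J%:R)%:E)); first by rewrite -prodEFin.
  move=> i _; have [h1 h2 h3] := h i; apply: etrans (uniform_itv _ _ _) _; last first.
  - by congr EFin; field; rewrite gt_eqF.
  - rewrite ler_pdivrMr// mul1r; have : (l i).+1%:R <= J%:R :> R by rewrite ler_nat.
    rewrite -natr1; lra.
  - by rewrite ler_pM2r ?invr_gt0//; lra.
  - by rewrite divr_ge0// addr_ge0//; lra.
by move=> i; exact: measurable_itv.
Qed.

Lemma subcell_incell J p q (l : {ffun 'I_d -> 'I_J}) x :
  (forall i, 0 < p i) -> (forall i, q i < 1) -> subcell p q l x -> incell l (rv x).
Proof.
move=> p0 q1 bx i; rewrite rvE; have /andP[h1 h2] := bx i.
by rewrite (lt_le_trans (p0 i) h1) (le_lt_trans h2).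
Qed.

(** Each cell contains a box on which all the one-variable factors are bounded away from zero. The
    boxes are disjoint, so their contributions add up: values of order a(l)^2 J^(2 |k|) on a volume
    of order J^-d. *)
Lemma Phi_lower (k : 'I_d -> nat) : exists2 c : R, 0 < c &
  forall (J : nat) (a : {ffun 'I_d -> 'I_J} -> R), (0 < J)%N ->
    c * J%:R ^+ (2 * korder k) / J%:R ^+ d * (\sum_l a l ^+ 2) <=
    inner (fun x : ptd => Phi a k (rv x)) (fun x => Phi a k (rv x)).
Proof.
have /choice[p /choice[q /choice[c0 h]]] : forall i, exists p q c : R,
    [/\ 1 / 4 < p, p < q, q < 3 / 4, 0 < c &
      forall x, p <= x <= q -> c <= (bump (k i) x) ^+ 2].
  by move=> i; exact: bump_lower.
exists (\prod_i (c0 i * (q i - p i))).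
  by apply: prodr_gt0 => i _; have [_ h2 _ h4 _] := h i; rewrite mulr_gt0// subr_gt0.
move=> J a J0'; have J0 : 0 < J%:R :> R by rewrite ltr0n.
pose box (l : {ffun 'I_d -> 'I_J}) := subcell p q l.
have mbox l : measurable (box l) by exact: measurable_subcell.
have vbox l : vol (box l) = (\prod_i ((q i - p i) / J%:R))%:E.
  by apply: vol_subcell => // i; have [h1 h2 h3 _ _] := h i; split; lra.
have boxin l x : box l x -> incell l (rv x).
  by apply: subcell_incell => i; have [h1 h2 h3 _ _] := h i; lra.
pose C := J%:R ^+ (2 * korder k) * \prod_i c0 i.
have C0 : 0 <= C.
  by rewrite mulr_ge0 ?exprn_ge0// prodr_ge0// => i _; have [_ _ _ /ltW] := h i.
have cl l x : box l x -> C <= cellf k l (rv x) ^+ 2.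
  move=> bx; rewrite /C /cellf -prodrXl mulnC exprM.
  rewrite (_ : J%:R ^+ korder k = \prod_i (J%:R ^+ k i)); last first.
    by rewrite /korder (big_morph (fun n => J%:R ^+ n) (exprD _) (expr0 _)).
  rewrite -prodrXl -big_split/=; apply: ler_prod => i _; have [_ _ _ ci hi] := h i.
  apply/andP; split; first by rewrite mulr_ge0 ?exprn_ge0// ltW.
  by rewrite /factor exprMn ler_wpM2l ?exprn_ge0// hi// rvE bx.
rewrite -lee_fin -inner_sqrE; last exact: L2_Phi.
apply: (@le_trans _ _ (\int[@vol R d]_x \sum_l ((a l ^+ 2 * C)%:E * (\1_(box l) x)%:E))%E).
  rewrite ge0_integral_sum//.
  - rewrite (eq_bigr (fun l => ((a l ^+ 2 * C) * \prod_i ((q i - p i) / J%:R))%:E)); last first.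
      move=> l _; rewrite ge0_integralZl//.
      + rewrite [RHS]EFinM; congr (_ * _)%E; apply: etrans (vbox l).
        by rewrite integral_indic// setIT.
      + by apply/measurable_EFinP; exact: measurable_indic.
      + by rewrite lee_fin mulr_ge0// sqr_ge0.
    rewrite sumEFin lee_fin -!mulr_suml /C !big_split/= prodr_const card_ord exprVn.
    by apply: le_of_eq; ring.
  - move=> l; apply/measurable_EFinP; apply: measurable_funM => //.
  - by move=> l x _; rewrite -EFinM lee_fin mulr_ge0// mulr_ge0// sqr_ge0.
apply: le_integralT => x.
  by apply: sume_ge0 => l _; rewrite -EFinM lee_fin mulr_ge0// mulr_ge0// sqr_ge0.
have [[l bl]|/forallNP nb] := pselect (exists l, box l x); last first.
  rewrite big1 ?lee_fin ?sqr_ge0// => l _.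
  by rewrite indicE memNset ?mule0//; exact: nb.
rewrite (bigD1 l)//= big1 ?adde0; last first.
  move=> l' l'l; rewrite indicE memNset ?mule0// => bl'.
  by move: l'l; rewrite (incell_uniq (boxin _ _ bl') (boxin _ _ bl)) eqxx.
rewrite indicE mem_set// mule1 lee_fin (Phi_single _ _ (boxin _ _ bl)) exprMn.
by rewrite ler_wpM2l ?sqr_ge0// cl.
Qed.
End PhiLower.

(** * Sobolev norms of sums of bumps *)

Lemma two_sided_sum (R : realType) (rho : R) (N j : nat) : 0 <= rho < 1 ->
  \sum_(n < N) (if (n < j)%N then rho ^+ (j - n) else rho ^+ (n - j)) <= 2 / (1 - rho).
Proof.
move=> /andP[r0 r1]; have r1' : 0 < 1 - rho by rewrite subr_gt0.
(* This is the sum of the whole infinite series, a bound that goes through the induction on N with j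
   generalized. *)
apply: (@le_trans _ _ ((1 + rho - rho ^+ j.+1) / (1 - rho))); last first.
  rewrite ler_pM2r ?invr_gt0//; have := exprn_ge0 j.+1 r0; lra.
elim: N j => [|N IH] j.
  rewrite big_ord0; apply: divr_ge0; last exact: ltW.
  have := exprn_ile1 j.+1 r0 (ltW r1).
  by move=> h; move: h r0; set p := rho ^+ _; lra.
rewrite big_ord_recl; case: j => [|j]; rewrite /=.
  rewrite expr0 expr1 addrK.
  under eq_bigr => i _ do rewrite /fintype.bump/= subn0 exprS.
  have h : \sum_(i < N) rho ^+ i <= (1 + rho - rho ^+ 1) / (1 - rho).
    apply: le_trans (IH 0%N); apply: le_of_eq.
    by apply: eq_bigr => i _; rewrite subn0.
  rewrite expr1 addrK in h; rewrite -mulr_sumr.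
  rewrite ler_pdivlMr//; rewrite ler_pdivlMr// in h; nra.
rewrite subn0; have h := IH j.
have -> : (1 + rho - rho ^+ j.+2) / (1 - rho) =
    rho ^+ j.+1 + (1 + rho - rho ^+ j.+1) / (1 - rho).
  by rewrite [rho ^+ j.+2]exprS; field; rewrite gt_eqF.
rewrite lerD2l; apply: le_trans h; apply: le_of_eq.
by apply: eq_bigr => i _; rewrite /fintype.bump/= add1n ltnS subSS.
Qed.

Section Slobodeckij.
Context {R : realType} {d : nat}.
Local Notation ptd := (pt R d).

Lemma dist_le_edist (x y : ptd) i : `|tnth x i - tnth y i| <= Defs.edist x y.
Proof.
rewrite -sqrtr_sqr /Defs.edist ler_wsqrtr// (bigD1 i)//= lerDl sumr_ge0// => j _.
exact: sqr_ge0.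
Qed.

Lemma edist_ge0 (x y : ptd) : 0 <= Defs.edist x y. Proof. exact: sqrtr_ge0. Qed.

Lemma slobodeckij_ge0 (sigma : R) (v : ptd -> R) : (0 <= slobodeckij sigma v)%E.
Proof.
apply: integral_ge0 => x _; apply: integral_ge0 => y _.
by rewrite lee_fin divr_ge0 ?sqr_ge0 ?powR_ge0.
Qed.

(** Equal to 4^-sigma. Its inverse to the power j is (2^j)^(2 sigma), the growth of the squared
    seminorm for oscillations at scale 2^-j. *)
Definition slob_ratio (sigma : R) : R := 2^-1 `^ (2 * sigma).

Lemma slob_ratio_bounds (sigma : R) : 0 < sigma < 1 -> 1 / 4 < slob_ratio sigma < 1.
Proof.
move=> /andP[s0 s1]; rewrite /slob_ratio /powR gt_eqF ?invr_gt0//.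
have l2 : ln (2^-1 : R) < 0 by rewrite ln_lt0// invr_gt0//= ltr0n/= invf_lt1// ltr1n.
have s2 : 0 < 2 * sigma by lra.
apply/andP; split; last by rewrite -[ltRHS]expR0 ltr_expR nmulr_llt0.
have -> : 1 / 4 = expR (2 * ln (2^-1 : R)).
  by rewrite mulr_natl mulr2n expRD lnK ?posrE ?invr_gt0//; lra.
by rewrite ltr_expR; set l := ln _ in l2 *; nra.
Qed.

(* Dyadic shells: if 2^(-n-1) < |x - y|_oo <= 2^-n, the n-th term of the series bounds the
   integrand; its integral decays geometrically on both sides of n = j. *)
Lemma slobodeckij_upper (sigma : R) : 0 < sigma < 1 -> exists2 K : R, 0 < K &
  forall (v : ptd -> R) (Q : R) (j : nat),
  (forall x y, (v x - v y) ^+ 2 <= Q) ->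
  (forall x y r, (forall i, `|tnth x i - tnth y i| <= r) ->
     (v x - v y) ^+ 2 <= Q * (d%:R * 2 ^+ j * r) ^+ 2) ->
  (slobodeckij sigma v <= (Q * K * (slob_ratio sigma)^-1 ^+ j)%:E)%E.
Proof.
move=> sig; have /andP[z14 z1] := slob_ratio_bounds sig.
have /andP[s0 s1] := sig.
set z := slob_ratio sigma in z14 z1 *.
have z0 : 0 < z by lra.
(* On the shells with n < j the increments of v are only bounded, which gives the rate z; for n >= j
   their Lipschitz bound brings an extra 4^-n, which gives the rate 1/(4z). Both are below 1 because
   z lies in (1/4, 1). *)
pose rho := Num.max z (4 * z)^-1.
have rho1 : 0 <= rho < 1.
  rewrite /rho le_max (ltW z0)/= gt_max z1/= invf_lt1; lra.
have /andP[rho0 rholt] := rho1.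
pose K1 : R := 4 ^+ d / z * (1 + d%:R ^+ 2).
have K10 : 0 <= K1 by rewrite mulr_ge0 ?divr_ge0 ?exprn_ge0 ?addr_ge0 ?sqr_ge0 ?ltW.
have K20 : 0 <= K1 * (2 / (1 - rho)) by rewrite mulr_ge0// divr_ge0//; lra.
exists (1 + K1 * (2 / (1 - rho))); first lra.
move=> v Q j hQ hQr.
have Q0 : 0 <= Q by apply: le_trans (sqr_ge0 _) (hQ [tuple of nseq d 0] [tuple of nseq d 0]).
(* Where the distance exceeds 2^-(n+1), the singular kernel is at most w^-(n+1). *)
pose w : R := 2^-1 `^ (d%:R + 2 * sigma).
have wE : w = 2^-1 ^+ d * z.
  rewrite /w powRD; last by apply/implyP => _; rewrite gt_eqF// invr_gt0.
  by rewrite powR_mulrn.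
have w0 : 0 < w by rewrite powR_gt0.
pose m n : R := if (n < j)%N then 1 else (d%:R * 2 ^+ j * 2^-1 ^+ n) ^+ 2.
have m0 n : 0 <= m n by rewrite /m; case: ifP => // _; exact: sqr_ge0.
pose c n : R := Q * m n / w ^+ n.+1.
have c0 n : 0 <= c n by rewrite /c divr_ge0 ?mulr_ge0// exprn_ge0// ltW.
pose ballx (x : ptd) n := [set y : ptd | forall i, (`|tnth x i - tnth y i| <= 2^-1 ^+ n)%R].
have mb x n : measurable (ballx x n) by exact: measurable_ball.
(* The term Q covers the pairs at distance more than 1, which occur since x and y are arbitrary
   points and only the measure is carried by the cube. *)
have pw x y : (((v x - v y) ^+ 2 / Defs.edist x y `^ (d%:R + 2 * sigma))%:E <=
    Q%:E + \sum_(n <oo) ((c n)%:E * (\1_(ballx x n) y)%:E))%E.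
  have ser0 : (0 <= \sum_(n <oo) ((c n)%:E * (\1_(ballx x n) y)%:E))%E.
    by apply: nneseries_ge0 => n _ _; rewrite -EFinM lee_fin mulr_ge0.
  have D0 : 0 < d%:R + 2 * sigma.
    have := ler0n R d; lra.
  have [/forallP b0|/forallPn[i]] := boolP [forall i, `|tnth x i - tnth y i| <= 1]; last first.
    rewrite -ltNge => xy1.
    have e1 : 1 <= Defs.edist x y `^ (d%:R + 2 * sigma).
      have e1 : 1 <= Defs.edist x y by rewrite (le_trans (ltW xy1))// dist_le_edist.
      by have := ler_powR e1 (ltW D0); rewrite powRr0.
    apply: (@le_trans _ _ Q%:E); last by rewrite leeDl.
    rewrite lee_fin ler_pdivrMr; last by apply: lt_le_trans e1.
    by apply: le_trans (hQ x y) _; rewrite ler_peMr.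
  have [/forallP xy|/forallPn[i xyi]] := boolP [forall i, tnth x i == tnth y i].
    have := hQr x y 0; rewrite mulr0 expr0n/= mulr0 => h.
    have -> : (v x - v y) ^+ 2 = 0.
      apply/eqP; rewrite eq_le sqr_ge0 h// => i.
      by rewrite (eqP (xy i)) subrr normr0.
    by rewrite mul0r adde_ge0// lee_fin.
  have [n nb] : exists n, ~~ `[< ballx x n y >].
    have a0 : 0 < `|tnth x i - tnth y i| by rewrite normr_gt0 subr_eq0.
    exists (Num.bound (`|tnth x i - tnth y i|^-1)).
    apply/asboolPn => /(_ i); apply/negP; rewrite -ltNge exprVn.
    rewrite -[ltRHS]invrK ltf_pV2 ?posrE ?invr_gt0 ?exprn_gt0//.
    exact: upper_nthrootP.
  have [k nk kmin] := ex_minnP (ex_intro (fun n => ~~ `[< ballx x n y >]) n nb).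
  case: k nk kmin => [/asboolP[]|k nk kmin]; first by move=> i'; rewrite expr0.
  have bk : ballx x k y.
    by apply/asboolP/negPn/negP => /kmin; rewrite ltnn.
  move/asboolPn: nk => /existsNP[i' /negP]; rewrite -ltNge => hk.
  have he : w ^+ k.+1 <= Defs.edist x y `^ (d%:R + 2 * sigma).
    rewrite -powR_mulrn; last exact: ltW.
    rewrite /w -powRrM mulrC powRrM powR_mulrn ?invr_ge0//.
    apply: ge0_ler_powR; first exact: ltW.
    - by rewrite nnegrE exprn_ge0.
    - by rewrite nnegrE edist_ge0.
    - by apply: ltW; apply: lt_le_trans hk _; exact: dist_le_edist.
  have hv : (v x - v y) ^+ 2 <= Q * m k.
    rewrite /m; case: ifP => _; first by rewrite mulr1.
    exact: hQr.
  apply: (@le_trans _ _ (\sum_(n <oo) ((c n)%:E * (\1_(ballx x n) y)%:E))%E); last first.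
    by rewrite leeDr// lee_fin.
  apply: (@le_trans _ _ (\sum_(0 <= n < k.+1) ((c n)%:E * (\1_(ballx x n) y)%:E))%E); last first.
    by apply: nneseries_lim_ge => n' _ _; rewrite -EFinM lee_fin mulr_ge0.
  rewrite big_nat_recr//= indicE mem_set// mule1.
  apply: (@le_trans _ _ (c k)%:E); last first.
    by rewrite leeDr// sume_ge0// => n' _; rewrite -EFinM lee_fin mulr_ge0.
  rewrite lee_fin /c ler_pM ?sqr_ge0 ?invr_ge0 ?powR_ge0//.
  by rewrite lef_pV2 ?posrE ?exprn_gt0// powR_gt0// (lt_le_trans _ (dist_le_edist x y i'))// (le_lt_trans _ hk)// exprn_ge0.
have row x : (\int[@vol R d]_y ((v x - v y) ^+ 2 / Defs.edist x y `^ (d%:R + 2 * sigma))%:E <=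
    (Q * (1 + K1 * (2 / (1 - rho))) * z^-1 ^+ j)%:E)%E.
  apply: (@le_trans _ _ (\int[@vol R d]_y (Q%:E + \sum_(n <oo) ((c n)%:E * (\1_(ballx x n) y)%:E)))%E).
    by apply: le_integralT => // y; rewrite lee_fin divr_ge0 ?sqr_ge0 ?powR_ge0.
  have mi n : measurable_fun [set: ptd] (fun y => ((c n)%:E * (\1_(ballx x n) y)%:E)%E).
    by apply/measurable_EFinP; apply: measurable_funM => //; exact: measurable_indic.
  have ci0 n y : (0 <= (c n)%:E * (\1_(ballx x n) y)%:E)%E by rewrite -EFinM lee_fin mulr_ge0.
  rewrite ge0_integralD//; last 2 first.
  - by move=> y _; apply: nneseries_ge0 => n _ _; exact: ci0.
  - by apply: ge0_emeasurable_sum => // n y _ _; exact: ci0.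
  rewrite integral_prob_cst integral_nneseries//.
  have zj1 : 1 <= z^-1 ^+ j by rewrite exprn_ege1// invf_ge1// ltW.
  have tn n : (\int[@vol R d]_y ((c n)%:E * (\1_(ballx x n) y)%:E) <=
      (Q * K1 * z^-1 ^+ j * (if (n < j)%N then rho ^+ (j - n) else rho ^+ (n - j)))%:E)%E.
    rewrite ge0_integralZl//; last 2 first.
    - by apply/measurable_EFinP; exact: measurable_indic.
    - by rewrite lee_fin.
    rewrite integral_indic// setIT.
    apply: (@le_trans _ _ ((c n)%:E * ((2 * 2^-1 ^+ n) ^+ d)%:E)%E).
      by apply: lee_wpmul2l; [rewrite lee_fin|apply: vol_ball; rewrite exprn_ge0].
    rewrite -EFinM lee_fin.
    have -> : c n * (2 * 2^-1 ^+ n) ^+ d = Q * (4 ^+ d / z) * (m n / z ^+ n).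
      rewrite /c wE exprMn -exprM mulnC exprM !exprSr !exprMn.
      have -> : (4 : R) ^+ d = 2 ^+ d * 2 ^+ d by rewrite -exprMn; congr (_ ^+ _); lra.
      rewrite -[in X in X = _](invrK (2 ^+ d)) -exprVn.
      set H := 2^-1 ^+ d; have H0 : H != 0 by rewrite expf_neq0// invr_neq0.
      have -> : (2 : R) ^+ d = H^-1 by rewrite /H exprVn invrK.
      have zn : z ^+ n != 0 by rewrite expf_neq0// gt_eqF.
      set G := 2^-1 ^+ n ^+ d; have G0 : G != 0 by rewrite !expf_neq0// invr_neq0.
      by field; rewrite zn G0 H0 gt_eqF.
    rewrite /K1 mulrA -!mulrA ler_wpM2l// ler_wpM2l ?exprn_ge0// ler_wpM2l ?invr_ge0 ?(ltW z0)//.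
    have d2 : 0 <= d%:R ^+ 2 :> R by exact: sqr_ge0.
    rewrite /m; case: ltnP => nj.
      rewrite mul1r -[leLHS]mul1r; apply: ler_pM => //; first by rewrite invr_ge0 exprn_ge0// ltW.
        by rewrite lerDl.
      have -> : (z ^+ n)^-1 = z^-1 ^+ j * z ^+ (j - n).
        rewrite -{1}(subnK (ltnW nj)) exprD mulrC mulrA -exprMn divff ?gt_eqF// expr1n mul1r.
        by rewrite exprVn.
      rewrite ler_wpM2l ?exprn_ge0 ?invr_ge0 ?(ltW z0)// ler_pXn2r ?nnegrE ?(ltW z0)// ?subn_gt0//.
      by rewrite /rho le_max lexx.
    have -> : (d%:R * 2 ^+ j * 2^-1 ^+ n) ^+ 2 / z ^+ n =
        d%:R ^+ 2 * (z^-1 ^+ j * (4 * z)^-1 ^+ (n - j)) :> R.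
      have e2 : (2 : R) ^+ j != 0 by rewrite expf_neq0.
      have ez : z ^+ j != 0 by rewrite expf_neq0// gt_eqF.
      have ez' : z ^+ (n - j) != 0 by rewrite expf_neq0// gt_eqF.
      have e3 : (2 : R) ^+ (n - j) != 0 by rewrite expf_neq0.
      have e4 : (4 : R) = 2 * 2 by lra.
      rewrite -{1 2}(subnK nj) !exprD !exprVn e4 !exprMn.
      by field; rewrite ez ez' e2 e3.
    apply: ler_pM => //; first by rewrite mulr_ge0// exprn_ge0// invr_ge0; lra.
      by rewrite lerDr.
    rewrite ler_wpM2l ?exprn_ge0 ?invr_ge0 ?(ltW z0)// lerXn2r ?nnegrE ?invr_ge0//; first lra.
    by rewrite /rho le_max lexx orbT.
  have -> : (Q * (1 + K1 * (2 / (1 - rho))) * z^-1 ^+ j) =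
      Q * z^-1 ^+ j + Q * K1 * z^-1 ^+ j * (2 / (1 - rho)) by ring.
  rewrite EFinD; apply: leeD; first by rewrite lee_fin ler_peMr.
  apply: (@le_trans _ _ (\sum_(n <oo) (Q * K1 * z^-1 ^+ j *
      (if (n < j)%N then rho ^+ (j - n) else rho ^+ (n - j)))%:E)%E).
    apply: lee_nneseries => // n _ _; apply: integral_ge0 => y _; exact: ci0.
  have C0 : 0 <= Q * K1 * z^-1 ^+ j by apply: mulr_ge0; [exact: mulr_ge0|exact: le_trans zj1].
  apply: lime_le.
    by apply: is_cvg_nneseries => n _ _; rewrite lee_fin mulr_ge0//; case: ifP => _; rewrite exprn_ge0.
  apply: nearW => N; rewrite sumEFin lee_fin -mulr_sumr ler_wpM2l// big_mkord.
  exact: two_sided_sum.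
rewrite /slobodeckij.
apply: (@le_trans _ _ (\int[@vol R d]_x (Q * (1 + K1 * (2 / (1 - rho))) * z^-1 ^+ j)%:E)%E).
  apply: le_integralT => // x; apply: integral_ge0 => y _.
  by rewrite lee_fin divr_ge0 ?sqr_ge0 ?powR_ge0.
by rewrite integral_prob_cst.
Qed.
End Slobodeckij.

Section SobolevUpper.
Context {R : realType} {d : nat}.
Local Notation ptd := (pt R d).

Lemma inner_Phi_le J (a : {ffun 'I_d -> 'I_J} -> R) (k : 'I_d -> nat) (m : nat) (M : R) :
  1 <= M -> (forall n, (n <= m)%N -> (forall x : R, `|bump n x| <= M) /\
    (forall x y : R, `|bump n x - bump n y| <= M * `|x - y|)) ->
  (forall i, (k i <= m)%N) -> (forall l, `|a l| <= 1) ->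
  inner (fun x : ptd => Phi a k (rv x)) (fun x => Phi a k (rv x)) <=
  (J%:R ^+ korder k * M ^+ d) ^+ 2.
Proof.
move=> M1 hM km a1; rewrite -lee_fin -inner_sqrE; last exact: L2_Phi.
apply: (@le_trans _ _ (\int[@vol R d]_x ((J%:R ^+ korder k * M ^+ d) ^+ 2)%:E)%E).
  apply: le_integralT => x; rewrite lee_fin ?sqr_ge0//.
  rewrite -[leLHS]real_normK ?num_real// lerXn2r ?nnegrE//.
    by rewrite mulr_ge0// exprn_ge0// (le_trans _ M1).
  exact: (Phi_bound M1 hM).
by rewrite integral_prob_cst.
Qed.

Lemma slob_ratioV (sigma : R) j : (slob_ratio sigma)^-1 ^+ j = ((2 ^ j)%:R) `^ (2 * sigma).
Proof.
rewrite /slob_ratio -[X in (X `^ _)^-1](powR_inv1 (ler0n R 2)) -powRrM mulN1r powRN invrK.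
rewrite natrX -(powR_mulrn j (powR_ge0 2 _)) -(powR_mulrn j (ler0n R 2)).
by rewrite -!powRrM mulrC.
Qed.

Lemma sum_le_const (I : finType) (P : pred I) (f : I -> \bar R) (B : R) : 0 <= B ->
  (forall i, P i -> (f i <= B%:E)%E) -> (\sum_(i | P i) f i <= (#|I|%:R * B)%:E)%E.
Proof.
move=> B0 h; apply: (@le_trans _ _ (\sum_(i | P i) B%:E)%E); first exact: lee_sum.
rewrite sumEFin lee_fin sumr_const -[leLHS]mulr_natl ler_wpM2r// ler_nat.
exact: max_card.
Qed.

(** The classical derivatives form an admissible family. Each differentiation costs a factor J, and
    the fractional part costs J^sigma through [slobodeckij_upper] at scale 1/J. *)
Lemma sobolev_upper (s : R) (k0 : 'I_d -> nat) : 0 <= s ->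
  exists2 K : R, 0 < K & forall (j : nat) (a : {ffun 'I_d -> 'I_(2 ^ j)%N} -> R) (t : R),
    0 <= t -> (forall l, `|a l| <= 1) ->
    (sobolev_norm s (fun x : ptd => t * Phi a k0 (rv x))%R <=
     (t * K * ((2 ^ j)%:R) `^ (s + (korder k0)%:R))%:E)%E.
Proof.
move=> s0; have /andP[ms sm1] := truncn_itv s0.
set m := Num.truncn s in ms sm1.
set sigma := s - m%:R.
have sig0 : 0 <= sigma by rewrite /sigma; lra.
have sig1 : sigma < 1 by move: sm1; rewrite /sigma -natr1; lra.
have [M M1 hM] := @bump_const R (m + korder k0).
have M0 : 0 <= M by exact: le_trans M1.
have [K1 K10 hK1] : exists2 K : R, 0 < K & 0 < sigma ->
  forall (v : ptd -> R) (Q : R) (j : nat),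
  (forall x y, (v x - v y) ^+ 2 <= Q) ->
  (forall x y r, (forall i, `|tnth x i - tnth y i| <= r) ->
     (v x - v y) ^+ 2 <= Q * (d%:R * 2 ^+ j * r) ^+ 2) ->
  (slobodeckij sigma v <= (Q * K * (slob_ratio sigma)^-1 ^+ j)%:E)%E.
  have [sp|sn] := ltP 0 sigma; last by exists 1 => //; rewrite ltNge sn.
  have sp1 : 0 < sigma < 1 by rewrite sp.
  by have [K K0 hK] := @slobodeckij_upper R d sigma sp1; exists K.
pose c : R := #|{ffun 'I_d -> 'I_m.+1}|%:R.
exists (Num.sqrt (c * (1 + 4 * K1)) * M ^+ d + 1).
  by rewrite ltr_wpDl// mulr_ge0 ?sqrtr_ge0 ?exprn_ge0.
move=> j a t t0 a1; set J := (2 ^ j)%N.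
have J0 : 0 < J%:R :> R by rewrite ltr0n expn_gt0.
have J1 : 1 <= J%:R :> R by rewrite ler1n expn_gt0.
have JE : J%:R = 2 ^+ j :> R by rewrite /J natrX.
pose kb (b : {ffun 'I_d -> 'I_m.+1}) i := (b i + k0 i)%N.
have kbE b : korder (kb b) = (miorder b + korder k0)%N by rewrite /korder /miorder -big_split.
have kbm b i : (kb b i <= m + korder k0)%N.
  by rewrite leq_add//; [rewrite -ltnS|rewrite /korder (bigD1 i)//= leq_addr].
pose g b (x : ptd) := t * Phi a (kb b) (rv x).
pose L := J%:R `^ (s + (korder k0)%:R) : R.
have L0 : 0 <= L by exact: powR_ge0.
have c0 : 0 <= c * (1 + 4 * K1) by rewrite mulr_ge0 ?ler0n//; lra.
pose X : R := (t * (Num.sqrt (c * (1 + 4 * K1)) * M ^+ d) * L) ^+ 2.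
have hpow b : (miorder b <= m)%N -> J%:R ^+ korder (kb b) <= L.
  move=> bm; rewrite kbE -powR_mulrn ?ler0n// /L ler_powR//.
  by rewrite natrD lerD2r (le_trans _ ms)// ler_nat.
have hpow2 b : miorder b = m -> (J%:R ^+ korder (kb b)) ^+ 2 * (slob_ratio sigma)^-1 ^+ j = L ^+ 2.
  move=> bm; rewrite slob_ratioV kbE bm -/J -!powR_mulrn ?powR_ge0// ?(ltW J0)//.
  rewrite -!powRrM -powRD; last by apply/implyP => _; rewrite gt_eqF.
  by congr (_ `^ _); rewrite natrD /sigma; ring.
have hX : (\sum_(b : {ffun 'I_d -> 'I_m.+1} | (miorder b <= m)%N) L2norm (g b) ^+ 2
       + (if (0 < sigma)%R then
            \sum_(b : {ffun 'I_d -> 'I_m.+1} | miorder b == m) slobodeckij sigma (g b)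
          else 0) <= X%:E)%E.
  pose D := t ^+ 2 * (M ^+ d) ^+ 2 * L ^+ 2.
  have D0 : 0 <= D by apply: mulr_ge0; [apply: mulr_ge0|]; exact: sqr_ge0.
  have -> : X = c * D + c * (4 * K1 * D) by rewrite /X /D !exprMn sqr_sqrtr//; ring.
  rewrite EFinD; apply: leeD.
    apply: sum_le_const => // b bm; rewrite L2norm_sqr inner_sqrE; last first.
      by apply: L2Z; exact: L2_Phi.
    rewrite lee_fin innerZl; [|exact: L2_Phi|by apply: L2Z; exact: L2_Phi].
    rewrite innerC innerZl; [|exact: L2_Phi|exact: L2_Phi].
    rewrite mulrA -expr2 /D -mulrA ler_wpM2l ?sqr_ge0//.
    apply: le_trans (inner_Phi_le M1 hM (kbm b) a1) _.
    rewrite exprMn mulrC ler_wpM2l ?sqr_ge0// lerXn2r ?nnegrE ?exprn_ge0 ?ler0n// hpow//.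
  have D1 : 0 <= 4 * K1 * D by apply: mulr_ge0 => //; lra.
  case: ifP => sp; last by rewrite lee_fin mulr_ge0 ?ler0n.
  apply: sum_le_const => [//|b /eqP bm].
  (* Square of twice the supremum bound. The same Q, multiplied by the square of d J r, dominates
     the Lipschitz estimate of [Phi_lip]. *)
  pose Q := (2 * t * (J%:R ^+ korder (kb b) * M ^+ d)) ^+ 2.
  apply: (@le_trans _ _ (Q * K1 * (slob_ratio sigma)^-1 ^+ j)%:E).
    apply: hK1 => // [x y|x y r hr].
      rewrite -[leLHS]real_normK ?num_real// lerXn2r ?nnegrE//.
        by rewrite !mulr_ge0 ?exprn_ge0 ?ler0n.
      rewrite /g -mulrBr normrM ger0_norm// [2 * t]mulrC -mulrA ler_wpM2l//.
      apply: le_trans (ler_normB _ _) _.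
      have := Phi_bound M1 hM (rv x) (kbm b) a1.
      have := Phi_bound M1 hM (rv y) (kbm b) a1.
      by lra.
    have hs : \sum_i `|rv x 0 i - rv y 0 i| <= d%:R * r.
      rewrite -[d in leRHS]card_ord mulr_natl -sumr_const; apply: ler_sum => i _.
      by rewrite !rvE.
    have r0 : 0 <= d%:R * r by apply: le_trans hs; exact: sumr_ge0.
    have J0' : 0 <= J%:R ^+ korder (kb b) * M ^+ d by rewrite mulr_ge0 ?exprn_ge0 ?ler0n.
    have e : (2 * t * (J%:R ^+ korder (kb b) * M ^+ d)) * (d%:R * 2 ^+ j * r) =
       t * (2 * (J%:R ^+ (korder (kb b)).+1 * M ^+ d * (d%:R * r))).
      by rewrite exprS JE; ring.
    rewrite /Q -exprMn e -[leLHS]real_normK ?num_real// lerXn2r ?nnegrE//.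
      by rewrite mulr_ge0// mulr_ge0// mulr_ge0// mulr_ge0 ?exprn_ge0 ?ler0n.
    rewrite /g -mulrBr normrM ger0_norm// ler_wpM2l//.
    apply: le_trans (Phi_lip M1 hM (rv x) (rv y) (kbm b) a1) _.
    by rewrite ler_wpM2l// ler_wpM2l// mulr_ge0 ?exprn_ge0 ?ler0n.
  rewrite lee_fin /D /Q -[L ^+ 2](hpow2 b bm); apply: le_of_eq; ring.
apply: (@le_trans _ _ (sqrte X%:E)).
  apply: (@le_trans _ _ (sqrte (\sum_(b : {ffun 'I_d -> 'I_m.+1} | (miorder b <= m)%N) L2norm (g b) ^+ 2
       + (if (0 < sigma)%R then
            \sum_(b : {ffun 'I_d -> 'I_m.+1} | miorder b == m) slobodeckij sigma (g b)
          else 0))%E)).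
    apply: ereal_inf_lbound; exists g => //; split.
      by apply: L2Z; exact: L2_Phi.
    move=> b bm; split; first by apply: L2Z; exact: L2_Phi.
    move=> phi tphi; have E k : (fun x : ptd => t * Phi a k (rv x)) =
        (fun x => Phi (fun l => t * a l) k (rv x)).
      by apply/funext => x; rewrite PhiZ.
    by rewrite /g !E; exact: weak_deriv_Phi.
  by rewrite lee_sqrt// lee_fin sqr_ge0.
rewrite /= lee_fin sqrtr_sqr ger0_norm; last first.
  by rewrite !mulr_ge0 ?sqrtr_ge0 ?exprn_ge0.
by rewrite ler_wpM2r// ler_wpM2l// lerDl.
Qed.
End SobolevUpper.

(** * Sobolev norms from below, for every choice of weak derivatives *)

Section SobolevLower.
Context {R : realType} {d : nat}.
Local Notation ptd := (pt R d).

Lemma L2_indicM (A : set ptd) (v : ptd -> R) : measurable A -> L2 v ->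
  L2 (fun x => \1_A x * v x).
Proof.
move=> mA /L2P[mv fv]; apply/L2P; split.
  by apply: measurable_funM => //; exact: measurable_indic.
apply: le_lt_trans fv; apply: le_integralT => x; rewrite lee_fin ?sqr_ge0//.
by rewrite indicE; case: (_ \in _); rewrite ?mul1r// mul0r expr0n sqr_ge0.
Qed.

Lemma L2_cst (c : R) : L2 (fun _ : ptd => c).
Proof. by apply: (@L2_bounded _ _ _ `|c|). Qed.

(** A derivative of a function vanishing outside the cube has mean zero. This is what allows the
    value g x to be subtracted in [slobodeckij_lower]. *)
Lemma inner_cst_Phi J (a : {ffun 'I_d -> 'I_J} -> R) i k (t : R) :
  inner (fun _ : ptd => t) (fun x => Phi a (kinc i k) (rv x)) = 0.
Proof.
rewrite (_ : (fun=> t) = fun _ : ptd => t * 1); last by apply/funext => x; rewrite mulr1.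
rewrite innerZl; [|exact: L2_cst|exact: L2_Phi].
rewrite /inner /Rintegral (eq_integral (fun x : ptd => (pderiv i (Phi a k) (rv x))%:E)); last first.
  by move=> x _; rewrite mul1r pderiv_Phi.
have [M M0 hM] := cube_bounded (@continuous_Phi R d J a (kinc i k)).
rewrite (@integral_pderiv0 _ _ _ _ M) ?mulr0//.
- by move=> x; have [] := is_derive_Phi i a k x.
- by rewrite pderiv_Phi; exact: continuous_Phi.
- by move=> x; exact: Phi_out.
- move=> x; rewrite pderiv_Phi; have [c|c] := pselect (cube x); first exact: hM.
  by rewrite Phi_out// normr0.
Qed.

Definition single J (a : {ffun 'I_d -> 'I_J} -> R) l l' : R := if l' == l then a l else 0.

Lemma Phi_singleE J (a : {ffun 'I_d -> 'I_J} -> R) l k y :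
  Phi (single a l) k y = a l * cellf k l y.
Proof.
rewrite /Phi (bigD1 l)//= big1 ?addr0 /single ?eqxx// => l' /negbTE ->.
by rewrite mul0r.
Qed.

Lemma inner_Phi_single J (a : {ffun 'I_d -> 'I_J} -> R) l k :
  inner (fun x : ptd => Phi a k (rv x)) (fun x => Phi (single a l) k (rv x)) =
  inner (fun x : ptd => Phi (single a l) k (rv x)) (fun x => Phi (single a l) k (rv x)).
Proof.
apply: eq_Rintegral => x _; rewrite !Phi_singleE.
have [->|/cellf_incell h] := eqVneq (cellf k l (rv x)) 0; first by rewrite !mulr0.
by rewrite (Phi_single _ _ h).
Qed.

Lemma edist_le J (l : {ffun 'I_d -> 'I_J}) (x y : ptd) : (0 < J)%N ->
  incell l (rv x) -> incell l (rv y) -> Defs.edist x y <= d%:R / J%:R.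
Proof.
move=> J0' lx ly; have J0 : 0 < J%:R :> R by rewrite ltr0n.
have dJ : 0 <= d%:R / J%:R :> R by rewrite divr_ge0.
rewrite -[leRHS]ger0_norm// -sqrtr_sqr /Defs.edist ler_wsqrtr//.
apply: (@le_trans _ _ (\sum_(i < d) J%:R^-1 ^+ 2)).
  apply: ler_sum => i _; rewrite -[leLHS]real_normK ?num_real// lerXn2r ?nnegrE ?invr_ge0//.
  have := lx i; have := ly i; rewrite !rvE => /andP[h1 h2] /andP[h3 h4].
  rewrite -(ler_pM2l J0) divff ?gt_eqF// -[X in X * _](ger0_norm (ltW J0)) -normrM mulrBr ler_norml.
  by apply/andP; split; lra.
rewrite sumr_const card_ord -[leLHS]mulr_natl exprMn exprVn ler_wpM2r ?invr_ge0 ?exprn_ge0//.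
by rewrite -natrX ler_nat; case: d => // n; rewrite leq_pmulr.
Qed.

(* [slobodeckij] is bounded below using pairs of points of a common cell only: there
   |gx - gy|^2 >= 2 (gy - gx) phi y - (phi y)^2, where phi has mean zero on the cell. *)
Lemma slobodeckij_lower (sigma : R) (i0 : 'I_d) (k1 : 'I_d -> nat) : 0 <= sigma ->
  exists2 c : R, 0 < c &
  forall J (a : {ffun 'I_d -> 'I_J} -> R) (g : ptd -> R), (0 < J)%N -> L2 g ->
   (forall l, inner g (fun x => Phi (single a l) (kinc i0 k1) (rv x)) =
      inner (fun x => Phi a (kinc i0 k1) (rv x)) (fun x => Phi (single a l) (kinc i0 k1) (rv x))) ->
   ((c * J%:R `^ (2 * (sigma + (korder (kinc i0 k1))%:R)) *
      ((\sum_l a l ^+ 2) / J%:R ^+ d))%:E <= slobodeckij sigma g)%E.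
Proof.
move=> s0; set k := kinc i0 k1; have [c c0 hc] := @Phi_lower R d k.
have d0' : (0 < d)%N by apply: leq_ltn_trans (ltn_ord i0).
have d0 : 0 < d%:R :> R by rewrite ltr0n.
set D := d%:R + 2 * sigma.
have D0 : 0 < D by rewrite /D; lra.
(* The factors come from the bound d/J of the distance of two points of a cell, from the volume of
   its middle box, and from [Phi_lower]. *)
exists ((d%:R^-1) `^ D * (2^-1) ^+ d * c).
  by rewrite !mulr_gt0 ?powR_gt0 ?exprn_gt0 ?invr_gt0.
move=> J a g J0' L2g hg; have J0 : 0 < J%:R :> R by rewrite ltr0n.
pose kap : R := (J%:R / d%:R) `^ D.
have kap0 : 0 < kap by rewrite powR_gt0// divr_gt0.
pose box l := @subcell R d J (fun=> 1 / 4) (fun=> 3 / 4) l.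
have mbox l : measurable (box l) by exact: measurable_subcell.
have boxin l x : box l x -> incell l (rv x) by apply: subcell_incell => _; lra.
pose q : R := (2^-1 / J%:R) ^+ d.
have vbox l : vol (box l) = q%:E.
  rewrite /box vol_subcell//; last by move=> _; split; lra.
  by rewrite prodr_const card_ord /q; congr ((_ / _) ^+ _)%:E; lra.
pose P l := inner (fun x : ptd => Phi (single a l) k (rv x)) (fun x => Phi (single a l) k (rv x)).
have P0 l : 0 <= P l by exact: inner_ge0.
have row l (x : ptd) : ((P l)%:E <= \int[@vol R d]_y ((\1_(box l) y * (g y - g x)) ^+ 2)%:E)%E.
  have L2v : L2 (fun y : ptd => g y - g x) by apply: L2B => //; exact: L2_cst.
  have L2u : L2 (fun y : ptd => \1_(box l) y * (g y - g x)) by exact: L2_indicM.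
  have L2f : L2 (fun y : ptd => Phi (single a l) k (rv y)) by exact: L2_Phi.
  rewrite (inner_sqrE L2u) lee_fin.
  set U := (fun y : ptd => \1_(box l) y * (g y - g x)) in L2u *.
  set f := (fun y : ptd => Phi (single a l) k (rv y)) in L2f *.
  have e : inner U f = P l.
    (* The indicator disappears because f vanishes outside the box; then the constant g x pairs to
       zero with f. *)
    transitivity (inner (fun y : ptd => g y - g x) f).
      apply: eq_Rintegral => y _; rewrite /U /f Phi_singleE.
      have [->|/cellf_neq0 h] := eqVneq (cellf k l (rv y)) 0; first by rewrite !mulr0.
      rewrite indicE mem_set ?mul1r// => i; have := h i; rewrite rvE => /andP[h1 h2].
      by rewrite (ltW h1) (ltW h2).
    rewrite innerBl//; last exact: L2_cst.
    by rewrite inner_cst_Phi subr0 hg inner_Phi_single.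
  have := inner_ge0 (fun y => U y - f y).
  have L2Uf : L2 (fun y => U y - f y) by exact: L2B.
  rewrite innerBl// (innerC U) (innerC f) !innerBl// (innerC f U) e -/(P l).
  by rewrite -/f -/(P l); lra.
have slow x : ((\sum_l kap * P l * \1_(box l) x)%:E <=
    \int[@vol R d]_y ((g x - g y) ^+ 2 / Defs.edist x y `^ D)%:E)%E.
  have [[l lx]|/forallNP nx] := pselect (exists l, box l x); last first.
    rewrite big1; first by apply: integral_ge0 => y _; rewrite lee_fin divr_ge0 ?sqr_ge0 ?powR_ge0.
    by move=> l _; rewrite indicE memNset ?mulr0//; exact: nx.
  rewrite (bigD1 l)//= big1 ?addr0; last first.
    move=> l' l'l; rewrite indicE memNset ?mulr0// => bl'.
    by move: l'l; rewrite (incell_uniq (boxin _ _ bl') (boxin _ _ lx)) eqxx.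
  rewrite indicE mem_set// mulr1.
  apply: (@le_trans _ _ (kap%:E * \int[@vol R d]_y ((\1_(box l) y * (g y - g x)) ^+ 2)%:E)%E).
    by rewrite EFinM; apply: lee_wpmul2l; rewrite ?lee_fin ?(ltW kap0)//; exact: row.
  have mU : measurable_fun [set: ptd] (fun y : ptd => \1_(box l) y * (g y - g x)).
    apply: measurable_funM; first exact: measurable_indic.
    by apply: measurable_funB => //; exact: L2_meas.
  rewrite -ge0_integralZl ?lee_fin ?(ltW kap0)//; last 2 first.
  - by apply/measurable_EFinP; exact: measurable_funX.
  - by move=> y _; rewrite lee_fin sqr_ge0.
  apply: le_integralT => y; rewrite -?EFinM lee_fin ?(mulr_ge0 (ltW kap0) (sqr_ge0 _))//.
  rewrite indicE; have [ly|nly] := boolP (y \in box l); last first.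
    by rewrite mul0r expr0n mulr0 divr_ge0 ?sqr_ge0 ?powR_ge0.
  rewrite mul1r -sqrrN opprB; have [e0|e0] := eqVneq (Defs.edist x y) 0.
    have xy : x = y.
      apply: eq_from_tnth => i; apply/eqP; rewrite -subr_eq0 -normr_le0 -e0.
      exact: dist_le_edist.
    by rewrite xy subrr expr0n mul0r mulr0.
  have ep : 0 < Defs.edist x y by rewrite lt0r e0 edist_ge0.
  rewrite mulrC ler_wpM2l ?sqr_ge0// -[leRHS]mul1r ler_pdivlMr ?powR_gt0//.
  rewrite /kap -powRM ?divr_ge0 ?(ltW ep)//.
  apply: (@le_trans _ _ (1 `^ D)); last by rewrite powR1.
  apply: ge0_ler_powR; first exact: ltW.
  - by rewrite nnegrE mulr_ge0// ?divr_ge0// ltW.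
  - by rewrite nnegrE.
  - have := edist_le J0' (boxin _ _ lx) (boxin _ _ (set_mem ly)).
    by rewrite ler_pdivlMr// mulrAC ler_pdivrMr// mul1r mulrC.
rewrite /slobodeckij.
apply: (@le_trans _ _ (\int[@vol R d]_x (\sum_l kap * P l * \1_(box l) x)%:E)%E); last first.
  apply: le_integralT => x; last exact: slow.
  by rewrite lee_fin sumr_ge0// => l _; rewrite !mulr_ge0// ltW.
under eq_integral do rewrite -sumEFin.
rewrite ge0_integral_sum//; last 2 first.
- move=> l; apply/measurable_EFinP; apply: measurable_funM => //; exact: measurable_indic.
- by move=> l x _; rewrite lee_fin !mulr_ge0// ltW.
rewrite (eq_bigr (fun l => (kap * P l * q)%:E)); last first.
  move=> l _; under eq_integral do rewrite EFinM.
  rewrite ge0_integralZl//; last 2 first.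
  - by apply/measurable_EFinP; exact: measurable_indic.
  - by rewrite lee_fin mulr_ge0// ltW.
  rewrite [RHS]EFinM; congr (_ * _)%E; apply: etrans (vbox l).
  by rewrite integral_indic// setIT.
rewrite sumEFin lee_fin -mulr_suml -mulr_sumr.
have hP : c * J%:R ^+ (2 * korder k) / J%:R ^+ d * (\sum_l a l ^+ 2) <= \sum_l P l.
  rewrite mulr_sumr; apply: ler_sum => l _; apply: le_trans (hc J (single a l) J0').
  rewrite (bigD1 l)//= big1 ?addr0 /single ?eqxx// => l' /negbTE ->.
  by rewrite expr0n.
have -> : d%:R^-1 `^ D * 2^-1 ^+ d * c * J%:R `^ (2 * (sigma + (korder k)%:R)) *
    ((\sum_l a l ^+ 2) / J%:R ^+ d) =
    kap * (c * J%:R ^+ (2 * korder k) / J%:R ^+ d * (\sum_l a l ^+ 2)) * q.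
  have Jn : J%:R ^+ d != 0 :> R by rewrite expf_neq0// gt_eqF.
  rewrite /kap powRM ?invr_ge0 ?(ltW J0)//; set G := d%:R^-1 `^ D.
  rewrite /q exprMn !exprVn /D mulrDr powRD; last by apply/implyP => _; rewrite gt_eqF.
  rewrite [J%:R `^ (d%:R + _)]powRD; last by apply/implyP => _; rewrite gt_eqF.
  rewrite -natrM !powR_mulrn ?(ltW J0)//.
  by field; rewrite Jn expf_neq0//.
by rewrite ler_wpM2r ?exprn_ge0 ?divr_ge0 ?(ltW J0)// ler_wpM2l// ltW.
Qed.

(** The infimum is over families known only through their pairings with test functions. A single
    member is enough: the derivative of order m along i0, tested against sums of bumps. For an
    integer s the conclusion is Cauchy-Schwarz, otherwise it is [slobodeckij_lower]. *)
Lemma sobolev_lower (s : R) (i0 : 'I_d) (k1 : 'I_d -> nat) : 0 <= s ->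
  exists2 c : R, 0 < c & forall J (a : {ffun 'I_d -> 'I_J} -> R), (0 < J)%N ->
  ((c * J%:R `^ (s + (korder (kinc i0 k1))%:R) *
     Num.sqrt ((\sum_l a l ^+ 2) / J%:R ^+ d))%:E <=
   sobolev_norm s (fun x : ptd => Phi a (kinc i0 k1) (rv x)))%E.
Proof.
move=> s0; have /andP[ms sm1] := truncn_itv s0.
set m := Num.truncn s in ms sm1.
set sigma := s - m%:R.
have sig0 : 0 <= sigma by rewrite /sigma; lra.
pose b : {ffun 'I_d -> 'I_m.+1} := [ffun i => if i == i0 then ord_max else ord0].
have bm : miorder b = m.
  by rewrite /miorder (bigD1 i0)//= ffunE eqxx big1 ?addn0// => i /negbTE ii; rewrite ffunE ii.
set k0 := kinc i0 k1.
pose k2 j := (b j + k1 j)%N.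
have kE j : (b j + k0 j)%N = kinc i0 k2 j by rewrite /k0 /k2 /kinc addnCA.
have kE' : (fun j => (b j + k0 j)%N) = kinc i0 k2 by apply/funext.
have kord : korder (kinc i0 k2) = (m + korder k0)%N.
  by rewrite -kE' /korder big_split/=; congr (_ + _)%N; exact: bm.
have [c1 c10 hc1] := @Phi_lower R d (kinc i0 k2).
have [c2 c20 hc2] := @slobodeckij_lower sigma i0 k2 sig0.
pose c := Num.min c1 c2.
have c0 : 0 < c by rewrite lt_min c10.
exists (Num.sqrt c); first by rewrite sqrtr_gt0.
move=> J a J0'; have J0 : 0 < J%:R :> R by rewrite ltr0n.
set A := \sum_l a l ^+ 2.
have A0 : 0 <= A by apply: sumr_ge0 => l _; exact: sqr_ge0.
set L := J%:R `^ _.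
have L0 : 0 <= L by exact: powR_ge0.
apply: le_ereal_inf_tmp => _ [g [L2v hg] <-]; rewrite -/m -/sigma.
have [L2g wd] := hg b (eq_leq bm).
(* Sums of bumps are test functions, so against them the weak derivative [g b] acts as the classical
   one. *)
have Hg (a' : {ffun 'I_d -> 'I_J} -> R) : inner (g b) (fun x => Phi a' (kinc i0 k2) (rv x)) =
    inner (fun x : ptd => Phi a (kinc i0 k2) (rv x)) (fun x => Phi a' (kinc i0 k2) (rv x)).
  have tphi := @test_fun_Phi R d J a' (kinc i0 k2) J0'.
  have := wd _ tphi; rewrite inner_Phi_mideriv; last by case: tphi.
  have sg : (-1) ^+ miorder b != 0 :> R by rewrite signr_eq0.
  by move=> /(mulfI sg) <-; rewrite kE'.
have sqrtE : (Num.sqrt c * L * Num.sqrt (A / J%:R ^+ d))%:E = sqrte (c * L ^+ 2 * (A / J%:R ^+ d))%:E.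
  have cL : 0 <= c * L ^+ 2 := mulr_ge0 (ltW c0) (sqr_ge0 L).
  by rewrite /= (sqrtrM _ cL) (sqrtrM _ (ltW c0)) sqrtr_sqr (ger0_norm L0).
rewrite sqrtE; set S := (X in sqrte X%:E).
have LE : L ^+ 2 = J%:R `^ (2 * (sigma + (korder (kinc i0 k2))%:R)).
  rewrite -powR_mulrn// -powRrM; congr (_ `^ _); rewrite kord natrD /sigma; ring.
have nn1 : (0 <= \sum_(b' : {ffun 'I_d -> 'I_m.+1} | (miorder b' <= m)%N) L2norm (g b') ^+ 2)%E.
  by apply: sume_ge0 => b' _; rewrite sqre_ge0.
have nn2 : (0 <= if (0 < sigma)%R then
    \sum_(b' : {ffun 'I_d -> 'I_m.+1} | miorder b' == m) slobodeckij sigma (g b') else 0)%E.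
  by case: ifP => // _; apply: sume_ge0 => b' _; exact: slobodeckij_ge0.
rewrite lee_sqrt; last by rewrite adde_ge0.
have AJ0 : 0 <= A / J%:R ^+ d by rewrite divr_ge0 ?exprn_ge0 ?(ltW J0).
have [sp|] := ltP 0 sigma; last first.
  move=> sn; have sz : sigma = 0 by apply/eqP; rewrite eq_le sig0 sn.
  rewrite adde0 (bigD1 b)/= ?bm//; apply: (@le_trans _ _ (L2norm (g b) ^+ 2)%E); last first.
    by rewrite leeDl// sume_ge0// => b' _; rewrite sqre_ge0.
  rewrite L2norm_sqr inner_sqrE// lee_fin.
  set phi := fun x : ptd => Phi a (kinc i0 k2) (rv x).
  have L2phi : L2 phi by exact: L2_Phi.
  have F : inner (g b) phi = inner phi phi by exact: Hg.
  apply: (@le_trans _ _ (inner phi phi)).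
    apply: le_trans (hc1 J a J0'); rewrite -/A /S LE sz add0r -natrM powR_mulrn ?(ltW J0)//.
    rewrite -[leRHS]mulrA [_^-1 * A]mulrC -[leLHS]mulrA -[leRHS]mulrA.
    by apply: ler_wpM2r; [rewrite mulr_ge0// exprn_ge0// ltW|rewrite /c ge_min lexx].
  have := inner_CS L2g L2phi; rewrite F expr2.
  have [->|p0] := eqVneq (inner phi phi) 0; first by move=> _; exact: inner_ge0.
  by rewrite ler_pM2r// lt0r p0 inner_ge0.
apply: (@le_trans _ _ (slobodeckij sigma (g b))).
  apply: le_trans (hc2 J a (g b) J0' L2g (fun l => Hg (single a l))).
  rewrite lee_fin -/A /S LE ler_wpM2r// ler_wpM2r ?powR_ge0//.
  by rewrite /c ge_min lexx orbT.
rewrite -[leLHS]add0e; apply: leeD => //.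
rewrite (bigD1 b)/= ?bm// leeDl// sume_ge0// => b' _; exact: slobodeckij_ge0.
Qed.
End SobolevLower.

(** * Negative norms *)

Lemma cvgn_bigsum (R : realType) (I : Type) (r : seq I) (f : nat -> I -> R) (l : I -> R) :
  (forall i, f n i @[n --> \oo] --> l i) ->
  \sum_(i <- r) f n i @[n --> \oo] --> \sum_(i <- r) l i.
Proof.
move=> h; elim: r => [|i r IH].
  by rewrite big_nil; under eq_fun do rewrite big_nil; exact: cvg_cst.
by rewrite big_cons; under eq_fun do rewrite big_cons; exact: cvgD.
Qed.

Section TestFunctions.
Context {R : realType} {d : nat}.
Local Notation ptd := (pt R d).
Implicit Types phi : 'rV[R]_d -> R.

Lemma L2_continuous0 phi : continuous phi -> (forall x, ~ cube x -> phi x = 0) ->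
  L2 (fun x : ptd => phi (rv x)).
Proof.
move=> cphi phi0; have [M M0 hM] := cube_bounded cphi.
apply: (@L2_bounded _ _ _ M); first exact: measurable_rv.
move=> x; have [c|c] := pselect (cube (rv x)); first exact: hM.
by rewrite phi0// normr0.
Qed.

Lemma L2_test phi : test_fun phi -> L2 (fun x : ptd => phi (rv x)).
Proof.
move=> [sphi [K [_ Kc K0]]]; apply: L2_continuous0; first by have [] := sphi [::].
by move=> x cx; apply: K0 => /Kc.
Qed.

Lemma pderiv_out (K : set 'rV[R]_d) i (phi : 'rV[R]_d -> R) : compact K ->
  (forall x, ~ K x -> phi x = 0) -> forall x, ~ K x -> pderiv i phi x = 0.
Proof.
move=> cK K0 x xK; have oK : open (~` K).
  by apply: closed_openC; apply: compact_closed => //; exact: norm_hausdorff.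
rewrite /pderiv (@near_eq_derive _ _ _ phi (cst 0)).
  by rewrite derive_cst.
by near=> y; apply: K0; near: y; exact: open_nbhs_nbhs.
Unshelve. all: by end_near.
Qed.

Lemma test_pderiv i (phi : 'rV[R]_d -> R) : test_fun phi -> test_fun (pderiv i phi).
Proof.
move=> [sphi [K [cK Kc K0]]]; split.
  by move=> s; have := sphi (rcons s i); rewrite foldr_rcons.
by exists K; split => // x; exact: pderiv_out.
Qed.

Lemma L2_pderiv_test i phi : test_fun phi -> L2 (fun x : ptd => pderiv i phi (rv x)).
Proof. by move=> tphi; apply: L2_test; exact: test_pderiv. Qed.

End TestFunctions.

(** * Eigenfunctions and the orthogonality of their gradients *)

Section Spectral.
Context {R : realType} {d : nat}.
Local Notation ptd := (pt R d).
Variables (lam : nat -> R) (e : nat -> ptd -> R).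
Hypothesis heig : dirichlet_eigenpairs lam e.

(** The eigenvalue equation is given against test functions only. As each eigenfunction is an H^1
    limit of test functions, it may be tested against the other eigenfunctions, and integrations by
    parts pass to the limit. *)
Lemma eigenfield : exists g : nat -> 'I_d -> ptd -> R,
  [/\ forall j i, L2 (g j i),
      forall j (phi : 'rV[R]_d -> R), test_fun phi ->
        \sum_i inner (g j i) (pderiv i phi \o rv) = lam j * inner (e j) (phi \o rv),
      forall i j, \sum_k inner (g i k) (g j k) = lam i * (i == j)%:R &
      forall j i J (a : {ffun 'I_d -> 'I_J} -> R) k,
        inner (fun x : ptd => Phi a (kinc i k) (rv x)) (e j) =
        - inner (fun x : ptd => Phi a k (rv x)) (g j i)].
Proof.
have [[L2e orth _] he] := heig.
have /choice[g hg] : forall j, exists gj : 'I_d -> ptd -> R, H10_grad (e j) gj /\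
    forall phi, test_fun phi ->
      \sum_i inner (gj i) (pderiv i phi \o rv) = lam j * inner (e j) (phi \o rv).
  by move=> j; have [_ [gj h1 h2]] := he j; exists gj.
exists g; split.
- by move=> j i; have [[_ h _] _] := hg j; exact: h.
- by move=> j phi; have [_] := hg j; apply.
- move=> i j; have [[_ L2gi _] hi] := hg i; have [[_ L2gj [phi [tphi cphi cdphi]]] _] := hg j.
  have [[L2e' _ _] _] := hg j; have [[L2ei _ _] _] := hg i.
  have c1 : lam i * inner (fun x => phi n (rv x)) (e i) @[n --> \oo] --> lam i * inner (e j) (e i).
    by apply: cvgZr; apply: inner_cvg => // n; exact: L2_test.
  have c2 : (\sum_k inner (fun x => pderiv k (phi n) (rv x)) (g i k)) @[n --> \oo] -->
      \sum_k inner (g j k) (g i k).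
    apply: cvgn_bigsum => k; apply: inner_cvg => // n; exact: L2_pderiv_test.
  have E : (fun n => lam i * inner (fun x => phi n (rv x)) (e i)) =
      (fun n => \sum_k inner (fun x => pderiv k (phi n) (rv x)) (g i k)).
    apply/funext => n; rewrite innerC -hi//; apply: eq_bigr => k _; exact: innerC.
  rewrite E in c1; have := cvg_unique (@norm_hausdorff _ _) c1 c2.
  rewrite innerC orth => ->; apply: eq_bigr => k _; exact: innerC.
- move=> j i J a k; have [[L2ej L2g [phi [tphi cphi cdphi]]] _] := hg j.
  have c1 : inner (fun x => phi n (rv x)) (fun x : ptd => Phi a (kinc i k) (rv x)) @[n --> \oo] -->
      inner (e j) (fun x : ptd => Phi a (kinc i k) (rv x)).
    by apply: inner_cvg => // [n|]; [exact: L2_test|exact: L2_Phi].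
  have c2 : - inner (fun x => pderiv i (phi n) (rv x)) (fun x : ptd => Phi a k (rv x)) @[n --> \oo] -->
      - inner (g j i) (fun x : ptd => Phi a k (rv x)).
    by apply: cvgN; apply: inner_cvg => // [n|]; [exact: L2_pderiv_test|exact: L2_Phi].
  rewrite innerC [in RHS]innerC; apply: cvg_unique c1 _ => //.
  rewrite (_ : (fun n => _) = (fun n => - inner (fun x => pderiv i (phi n) (rv x)) (fun x : ptd => Phi a k (rv x))))//.
  apply/funext => n; rewrite innerC [in RHS]innerC; have [sp _] := tphi n.
  rewrite inner_Phi_pderiv ?opprK//.
  - by have [] := sp [::].
  - by have [] := sp [:: i].
  - by have [_] := sp [::]; apply.
Qed.

(** Bessel's inequality in the space of square integrable vector fields: the gradients of the
    eigenfunctions, divided by the square roots of the eigenvalues, are orthonormal there. *)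
Lemma gradient_bessel (g : nat -> 'I_d -> ptd -> R) (w : 'I_d -> ptd -> R) n :
  (forall j i, L2 (g j i)) -> (forall i, L2 (w i)) ->
  (forall i j, \sum_k inner (g i k) (g j k) = lam i * (i == j)%:R) ->
  \sum_(j < n) (lam j)^-1 * (\sum_k inner (g j k) (w k)) ^+ 2 <= \sum_k inner (w k) (w k).
Proof.
move=> L2g L2w hg; have lam0 j : 0 < lam j by have [_ /(_ j)[]] := heig.
pose c j := \sum_k inner (g j k) (w k).
pose S k (x : ptd) := \sum_(j < n) (c j / lam j) * g j k x.
have L2S k : L2 (S k) by apply: L2_sum => j _; exact: L2Z.
have Sw k v : L2 v -> inner (S k) v = \sum_(j < n) (c j / lam j) * inner (g j k) v.
  move=> L2v; rewrite inner_suml//; first by apply: eq_bigr => j _; rewrite innerZl.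
  by move=> j _; exact: L2Z.
have e1 : \sum_k inner (S k) (w k) = \sum_(j < n) (lam j)^-1 * c j ^+ 2.
  under eq_bigr => k _ do rewrite Sw//.
  rewrite exchange_big/=; apply: eq_bigr => j _; rewrite -mulr_sumr -/(c j).
  by rewrite mulrAC -expr2 mulrC.
have e2 : \sum_k inner (S k) (S k) = \sum_(j < n) (lam j)^-1 * c j ^+ 2.
  under eq_bigr => k _ do rewrite Sw//.
  rewrite exchange_big/=; apply: eq_bigr => j _; rewrite -mulr_sumr.
  have -> : \sum_k inner (g j k) (S k) = c j.
    under eq_bigr => k _ do rewrite innerC Sw//.
    rewrite exchange_big/= (bigD1 j)//= [X in _ + X]big1 ?addr0.
      by rewrite -mulr_sumr hg eqxx mulr1 mulfVK// gt_eqF.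
    move=> i ij; rewrite -mulr_sumr hg.
    have -> : (i == j :> nat) = false by apply/negbTE.
    by rewrite !mulr0.
  by rewrite mulrAC -expr2 mulrC.
have h : 0 <= \sum_k inner (fun x => w k x - S k x) (fun x => w k x - S k x).
  by apply: sumr_ge0 => k _; exact: inner_ge0.
have h2 : \sum_k inner (fun x => w k x - S k x) (fun x => w k x - S k x) =
    \sum_k inner (w k) (w k) - 2 * \sum_k inner (S k) (w k) + \sum_k inner (S k) (S k).
  rewrite mulr_sumr -sumrB -big_split/=; apply: eq_bigr => k _.
  have L2d : L2 (fun x => w k x - S k x) by exact: L2B.
  rewrite innerBl// (innerC (w k)) (innerC (S k)) !innerBl// (innerC (w k) (S k)).
  by ring.
move: h; rewrite h2 e1 e2; rewrite -/(\sum_(j < n) _); lra.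
Qed.

Lemma coef_bessel (v : ptd -> R) n : L2 v -> 
  inner (fun x => v x - \sum_(j < n) coef e v j * e j x)
        (fun x => v x - \sum_(j < n) coef e v j * e j x) =
  inner v v - \sum_(j < n) coef e v j ^+ 2.
Proof.
move=> L2v; have [[L2e orth _] _] := heig.
pose S (x : ptd) := \sum_(j < n) coef e v j * e j x.
have L2S : L2 S by apply: L2_sum => j _; exact: L2Z.
have Sw w : L2 w -> inner S w = \sum_(j < n) coef e v j * inner (e j) w.
  move=> L2w; rewrite inner_suml//; first by apply: eq_bigr => j _; rewrite innerZl.
  by move=> j _; exact: L2Z.
have L2d : L2 (fun x => v x - S x) by exact: L2B.
rewrite innerBl// (innerC v) (innerC S) !innerBl// (innerC v S).
have -> : inner S v = \sum_(j < n) coef e v j ^+ 2.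
  by rewrite Sw//; apply: eq_bigr => j _; rewrite innerC expr2.
have -> : inner S S = \sum_(j < n) coef e v j ^+ 2.
  rewrite Sw//; apply: eq_bigr => j _; rewrite expr2; congr (_ * _).
  rewrite innerC Sw// (bigD1 j)//= orth eqxx mulr1 big1 ?addr0// => i ij.
  rewrite orth; have -> : (i == j :> nat) = false by apply/negbTE.
  by rewrite mulr0.
by ring.
Qed.

Lemma parseval (v : ptd -> R) : L2 v ->
  \sum_(j < n) coef e v j ^+ 2 @[n --> \oo] --> inner v v.
Proof.
move=> L2v; have [[L2e orth ex] _] := heig; have [_ h] := ex v L2v.
have L2d n : L2 (fun x => v x - \sum_(j < n) coef e v j * e j x).
  by apply: L2B => //; apply: L2_sum => j _; exact: L2Z.
pose D n := inner (fun x => v x - \sum_(j < n) coef e v j * e j x)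
        (fun x => v x - \sum_(j < n) coef e v j * e j x).
have hs : Num.sqrt (D n) @[n --> \oo] --> (0 : R).
  apply: (@fine_cvg _ _ _ _ (fun n => (Num.sqrt (D n))%:E) 0).
  by under eq_fun do rewrite -L2normE//.
have hD : D n @[n --> \oo] --> (0 : R).
  rewrite (_ : (fun n => D n) = (fun n => Num.sqrt (D n) * Num.sqrt (D n))).
    by rewrite -[X in _ --> X](mulr0 (0 : R)); exact: cvgM.
  by apply/funext => n; rewrite -expr2 sqr_sqrtr// inner_ge0.
rewrite (_ : (fun n => _) = (fun n => inner v v - D n)).
  by rewrite -[X in _ --> X]subr0; apply: cvgB => //; exact: cvg_cst.
by apply/funext => n; rewrite /D coef_bessel//; ring.
Qed.

Lemma coef_sum_le (v : ptd -> R) n : L2 v -> \sum_(j < n) coef e v j ^+ 2 <= inner v v.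
Proof. by move=> L2v; rewrite -subr_ge0 -coef_bessel// inner_ge0. Qed.

(** [gradient_bessel] for the gradient of [Phi a k], whose pairing with the gradient of an
    eigenfunction is the eigenvalue times a coefficient. *)
Lemma coef_Phi_up J (a : {ffun 'I_d -> 'I_J} -> R) k n : (0 < J)%N ->
  \sum_(j < n) lam j * coef e (fun x : ptd => Phi a k (rv x)) j ^+ 2 <=
  \sum_i inner (fun x : ptd => Phi a (kinc i k) (rv x)) (fun x => Phi a (kinc i k) (rv x)).
Proof.
move=> J0; have [g [L2g hphi hg _]] := eigenfield.
have lam0 j : 0 < lam j by have [_ /(_ j)[]] := heig.
have L2w i : L2 (fun x : ptd => Phi a (kinc i k) (rv x)) by exact: L2_Phi.
apply: le_trans (gradient_bessel n L2g L2w hg).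
apply: le_of_eq; apply: eq_bigr => j _.
have := hphi j _ (@test_fun_Phi R d J a k J0).
under eq_bigr => i _ do rewrite pderiv_Phi.
rewrite /comp => ->; rewrite exprMn /coef innerC expr2; field; rewrite gt_eqF//.
Qed.

(** [gradient_bessel] for the field with i-th component [Phi a k] and the others zero: its pairing
    with the gradient of an eigenfunction is, up to sign, a coefficient of its divergence. *)
Lemma coef_Phi_down J (a : {ffun 'I_d -> 'I_J} -> R) i k n :
  \sum_(j < n) (lam j)^-1 * coef e (fun x : ptd => Phi a (kinc i k) (rv x)) j ^+ 2 <=
  inner (fun x : ptd => Phi a k (rv x)) (fun x => Phi a k (rv x)).
Proof.
have [g [L2g _ hg hi]] := eigenfield.
pose w k' (x : ptd) := (k' == i)%:R * Phi a k (rv x).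
have L2w k' : L2 (w k') by apply: L2Z; exact: L2_Phi.
have ww f k' : L2 f -> inner f (w k') = (k' == i)%:R * inner f (fun x => Phi a k (rv x)).
  by move=> L2f; rewrite innerC innerZl; [rewrite innerC|exact: L2_Phi|].
have -> : inner (fun x : ptd => Phi a k (rv x)) (fun x => Phi a k (rv x)) =
    \sum_k' inner (w k') (w k').
  rewrite (bigD1 i)//= big1 ?addr0; last first.
    by move=> k' /negbTE k'i; rewrite ww// k'i mul0r.
  rewrite ww// eqxx mul1r innerC ww ?eqxx ?mul1r//; exact: L2_Phi.
apply: le_trans (gradient_bessel n L2g L2w hg).
apply: le_of_eq; apply: eq_bigr => j _.
rewrite (bigD1 i)//= big1 ?addr0; last first.
  by move=> k' /negbTE k'i; rewrite ww// k'i mul0r.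
by rewrite ww// eqxx mul1r /coef hi sqrrN innerC.
Qed.

End Spectral.

Lemma powRD_gt0 (R : realType) (x r s : R) : 0 < x -> x `^ (r + s) = x `^ r * x `^ s.
Proof. by move=> x0; rewrite powRD//; apply/implyP => _; rewrite gt_eqF. Qed.

Section NegativeNorms.
Context {R : realType} {d : nat}.
Local Notation ptd := (pt R d).
Variables (lam : nat -> R) (e : nat -> ptd -> R).

Lemma HnormE s (v : ptd -> R) : Hnorm lam (Hemb e s v) =
  if 0 <= s then sobolev_norm s v else doth_norm lam s (coef e v).
Proof. by rewrite /Hnorm /Hemb; case: (0 <= s). Qed.

Lemma doth_norm_ub s (c : nat -> R) (X : R) : 0 <= X ->
  (forall n, \sum_(j < n) lam j `^ s * c j ^+ 2 <= X) ->
  (doth_norm lam s c <= (Num.sqrt X)%:E)%E.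
Proof.
move=> X0 h; rewrite /doth_norm -[(Num.sqrt X)%:E]/(sqrte X%:E) lee_sqrt ?lee_fin//.
apply: lime_le.
  by apply: is_cvg_nneseries => n _ _; rewrite lee_fin mulr_ge0 ?powR_ge0 ?sqr_ge0.
by apply: nearW => n; rewrite sumEFin lee_fin big_mkord.
Qed.

Lemma doth_norm_lb s (c : nat -> R) n :
  ((Num.sqrt (\sum_(j < n) lam j `^ s * c j ^+ 2))%:E <= doth_norm lam s c)%E.
Proof.
have t0 j : (0 <= (lam j `^ s * c j ^+ 2)%:E)%E.
  by rewrite lee_fin mulr_ge0 ?powR_ge0 ?sqr_ge0.
rewrite /doth_norm -[X in (X <= _)%E]/(sqrte (_)%:E) lee_sqrt; last by apply: nneseries_ge0 => n' _ _.
rewrite -(big_mkord xpredT (fun j => lam j `^ s * c j ^+ 2)) -sumEFin.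
by apply: nneseries_lim_ge => n' _ _.
Qed.

(** Eigenvalues above L are charged to the L^2 norm, those below L to the H^-1 norm. *)
Lemma powR_interp_down (nu L x : R) : 0 <= nu <= 1 -> 0 < L -> 0 < x ->
  x `^ (- nu) <= L `^ (- nu) + L `^ (1 - nu) * x^-1.
Proof.
move=> /andP[n0 n1] L0 x0.
have [Lx|xL] := leP L x.
  rewrite -[leLHS]addr0 lerD ?mulr_ge0 ?powR_ge0 ?invr_ge0 ?(ltW x0)//.
  rewrite !powRN lef_pV2 ?posrE ?powR_gt0//.
  by apply: ge0_ler_powR; rewrite ?nnegrE ?(ltW L0) ?(ltW x0).
rewrite -[leLHS]add0r lerD ?powR_ge0//.
have -> : x `^ (- nu) = x `^ (1 - nu) * x^-1.
  by rewrite -[x^-1]powR_inv1 ?(ltW x0)// -powRD_gt0//; congr (_ `^ _); ring.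
rewrite ler_wpM2r ?invr_ge0 ?(ltW x0)//.
by apply: ge0_ler_powR; rewrite ?nnegrE ?(ltW L0) ?(ltW x0) ?subr_ge0// ltW.
Qed.

Lemma powR_interp_up (s L x : R) : 0 <= s -> 0 < L -> 0 < x ->
  1 <= L `^ s * x `^ (- s) + x / L.
Proof.
move=> s0 L0 x0; have [Lx|xL] := leP L x.
  rewrite -[leLHS]add0r lerD ?mulr_ge0 ?powR_ge0//.
  by rewrite ler_pdivlMr// mul1r.
rewrite -[leLHS]addr0 lerD ?divr_ge0 ?(ltW L0) ?(ltW x0)//.
rewrite powRN ler_pdivlMr ?powR_gt0// mul1r.
by apply: ge0_ler_powR; rewrite ?nnegrE ?(ltW L0) ?(ltW x0)// ltW.
Qed.

Hypothesis heig : dirichlet_eigenpairs lam e.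

Let lam0 j : 0 < lam j. Proof. by have [_ /(_ j)[]] := heig. Qed.

Let L2e j : L2 (e j). Proof. by have [[]] := heig. Qed.

Lemma coefZ t (v : ptd -> R) j : L2 v -> coef e (fun x => t * v x) j = t * coef e v j.
Proof. by move=> L2v; rewrite /coef innerZl. Qed.

Lemma Hnorm_neg_upper (nu : R) (i0 : 'I_d) (k1 : 'I_d -> nat) : 0 <= nu <= 1 ->
  exists2 K : R, 0 < K & forall (j : nat) (a : {ffun 'I_d -> 'I_(2 ^ j)%N} -> R) (t : R),
    0 <= t -> (forall l, `|a l| <= 1) ->
    (Hnorm lam (Hemb e (- nu) (fun x : ptd => t * Phi a (kinc i0 k1) (rv x))%R) <=
     (t * K * ((2 ^ j)%:R) `^ ((korder (kinc i0 k1))%:R - nu))%:E)%E.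
Proof.
move=> nu01; set k := kinc i0 k1.
(* As nu is nonnegative, only nu = 0 falls in the first case, where the norm is the Sobolev one
   instead of the spectral one. *)
have [n0|n0] := boolP (0 <= - nu).
  have [K K0 hK] := @sobolev_upper R d (- nu) k n0.
  exists K => // j a t t0 a1; rewrite HnormE n0.
  by rewrite [(korder k)%:R - nu]addrC; exact: hK.
have [M M1 hM] := @bump_const R (korder k).
have M0 : 0 < M by exact: lt_le_trans M1.
have km i : (k i <= korder k)%N by rewrite /korder (bigD1 i)//= leq_addr.
have km1 i : (k1 i <= korder k)%N by apply: leq_trans (km i); rewrite /k /kinc leq_addl.
exists (Num.sqrt 2 * M ^+ d); first by rewrite mulr_gt0 ?sqrtr_gt0 ?exprn_gt0.
move=> j a t t0 a1; rewrite HnormE (negbTE n0); set J := (2 ^ j)%N.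
have J0 : 0 < J%:R :> R by rewrite ltr0n expn_gt0.
set L := J%:R `^ _; have L0 : 0 <= L by exact: powR_ge0.
have -> : t * (Num.sqrt 2 * M ^+ d) * L = Num.sqrt (2 * (t * M ^+ d * L) ^+ 2).
  rewrite sqrtrM// sqrtr_sqr ger0_norm; first by ring.
  by rewrite !mulr_ge0 ?exprn_ge0 ?(ltW M0).
apply: doth_norm_ub => [|n]; first by apply: mulr_ge0 => //; exact: sqr_ge0.
pose v (x : ptd) := Phi a k (rv x).
have L2v : L2 v by exact: L2_Phi.
(* The size of the eigenvalues at the scale of the bumps: with this threshold both terms of the
   interpolation have the same order. *)
pose La : R := J%:R ^+ 2.
have La0 : 0 < La by rewrite exprn_gt0.
apply: (@le_trans _ _ (t ^+ 2 * (La `^ (- nu) * \sum_(j0 < n) coef e v j0 ^+ 2 +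
    La `^ (1 - nu) * \sum_(j0 < n) (lam j0)^-1 * coef e v j0 ^+ 2))).
  rewrite !mulr_sumr -big_split/= mulr_sumr; apply: ler_sum => j0 _.
  rewrite coefZ// exprMn mulrCA ler_wpM2l ?sqr_ge0// [La `^ (1 - nu) * _]mulrA -mulrDl.
  by rewrite ler_wpM2r ?sqr_ge0// powR_interp_down.
have h1 : \sum_(j0 < n) coef e v j0 ^+ 2 <= (J%:R ^+ korder k * M ^+ d) ^+ 2.
  by apply: le_trans (coef_sum_le heig n L2v) _; exact: inner_Phi_le hM km a1.
have h2 : \sum_(j0 < n) (lam j0)^-1 * coef e v j0 ^+ 2 <= (J%:R ^+ korder k1 * M ^+ d) ^+ 2.
  by apply: le_trans (coef_Phi_down heig a i0 k1 n) _; exact: inner_Phi_le hM km1 a1.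
have [p1 p2] : 0 <= La `^ (- nu) /\ 0 <= La `^ (1 - nu) by rewrite !powR_ge0.
apply: (@le_trans _ _ (t ^+ 2 * (La `^ (- nu) * (J%:R ^+ korder k * M ^+ d) ^+ 2 +
    La `^ (1 - nu) * (J%:R ^+ korder k1 * M ^+ d) ^+ 2))).
  by rewrite ler_wpM2l ?sqr_ge0// lerD// ler_wpM2l.
have LE : L ^+ 2 = La `^ (- nu) * (J%:R ^+ korder k) ^+ 2.
  rewrite /La -!powR_mulrn ?powR_ge0 ?(ltW J0)// -!powRrM -powRD_gt0//.
  by congr (_ `^ _); ring.
have LE2 : L ^+ 2 = La `^ (1 - nu) * (J%:R ^+ korder k1) ^+ 2.
  rewrite LE /k korder_kinc [J%:R ^+ _.+1]exprS exprMn mulrA -/La; congr (_ * _).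
  by rewrite [1 - nu]addrC powRD_gt0// powRr1 ?(ltW La0).
apply: le_of_eq.
transitivity (t ^+ 2 * (M ^+ d) ^+ 2 * (L ^+ 2 + L ^+ 2)); last by ring.
by rewrite {1}LE LE2; ring.
Qed.

(* Interpolation of L^2 between H^-s and H^1: 1 <= L^s x^-s + x / L with x an eigenvalue
   and L of the order of J^2. *)
Lemma doth_norm_Phi_lower (s r0 : R) (k : 'I_d -> nat) : 0 <= s -> 0 < r0 ->
  exists2 c : R, 0 < c & forall J (a : {ffun 'I_d -> 'I_J} -> R) (t : R), (0 < J)%N ->
    0 <= t -> (forall l, `|a l| <= 1) -> r0 * J%:R ^+ d <= \sum_l a l ^+ 2 ->
    ((t * c * J%:R `^ ((korder k)%:R - s))%:E <=
     doth_norm lam (- s) (coef e (fun x : ptd => t * Phi a k (rv x))%R))%E.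
Proof.
move=> s0 r00.
have [M M1 hM] := @bump_const R (korder k).+1.
have M0 : 0 < M by exact: lt_le_trans M1.
have [c1 c10 hc1] := @Phi_lower R d k.
(* Large enough for the H^1 term of the interpolation to be at most half of the squared L^2 norm
   ([hG]); the final 1 keeps L positive. *)
pose L : R := 2 * d%:R * (M ^+ d) ^+ 2 / (c1 * r0) + 1.
have L0 : 0 < L.
  by rewrite ltr_wpDl// divr_ge0 ?mulr_ge0 ?sqr_ge0 ?exprn_ge0 ?ler0n ?(ltW c10) ?(ltW r00) ?(ltW M0).
exists (Num.sqrt (c1 * r0 / (4 * L `^ s))).
  by rewrite sqrtr_gt0 !divr_gt0 ?mulr_gt0 ?powR_gt0.
move=> J a t J0' t0 a1 ha; have J0 : 0 < J%:R :> R by rewrite ltr0n.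
pose v (x : ptd) := Phi a k (rv x).
have L2v : L2 v by exact: L2_Phi.
have V0 : c1 * r0 * J%:R ^+ (2 * korder k) <= inner v v.
  apply: le_trans (hc1 J a J0').
  rewrite [leRHS](_ : _ = c1 * J%:R ^+ (2 * korder k) * ((\sum_l a l ^+ 2) / J%:R ^+ d)); last by ring.
  rewrite mulrAC ler_wpM2l ?mulr_ge0 ?exprn_ge0 ?(ltW c10)//.
  by rewrite ler_pdivlMr ?exprn_gt0.
have Jk : 0 < J%:R ^+ (2 * korder k) :> R by rewrite exprn_gt0.
have V1 : 0 < inner v v by apply: lt_le_trans V0; rewrite !mulr_gt0.
pose La : R := L * J%:R ^+ 2.
have La0 : 0 < La by rewrite mulr_gt0 ?exprn_gt0.
have hG n : (\sum_(j < n) lam j * coef e v j ^+ 2) / La <= inner v v / 2.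
  have h1 : \sum_(j < n) lam j * coef e v j ^+ 2 <= d%:R * (J%:R ^+ (korder k).+1 * M ^+ d) ^+ 2.
    apply: le_trans (coef_Phi_up heig a k n J0') _.
    set W := _ ^+ 2; have -> : d%:R * W = \sum_(i < d) W.
      by rewrite sumr_const card_ord mulr_natl.
    apply: ler_sum => i _; rewrite /W.
    rewrite -(korder_kinc i); apply: (inner_Phi_le M1 hM _ a1) => i'.
    rewrite -(korder_kinc i) /korder (bigD1 i')//= leq_addr//.
  rewrite ler_pdivrMr//; apply: le_trans h1 _.
  apply: (@le_trans _ _ (c1 * r0 * J%:R ^+ (2 * korder k) / 2 * La)); last first.
    by rewrite ler_wpM2r ?(ltW La0)// ler_wpM2r.
  have hL : 2 * d%:R * (M ^+ d) ^+ 2 <= c1 * r0 * L.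
    rewrite /L mulrDr mulr1 [c1 * r0 * (_ / _)]mulrC mulfVK ?mulf_neq0 ?gt_eqF// lerDl.
    by rewrite mulr_ge0 ?(ltW c10) ?(ltW r00).
  rewrite [leLHS](_ : _ = (2 * d%:R * (M ^+ d) ^+ 2) * (J%:R ^+ (2 * korder k) * J%:R ^+ 2 / 2)); last first.
    by rewrite mulnC exprM [J%:R ^+ _.+1]exprS; field.
  rewrite [leRHS](_ : _ = (c1 * r0 * L) * (J%:R ^+ (2 * korder k) * J%:R ^+ 2 / 2)); last first.
    by rewrite /La; field.
  by rewrite ler_wpM2r// divr_ge0// mulr_ge0 ?exprn_ge0 ?(ltW J0).
(* By Parseval finitely many coefficients carry three quarters of the squared norm; the H^1 term
   takes at most one half, and a quarter is left for the negative norm. *)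
have [n hn] : exists n, 3 / 4 * inner v v <= \sum_(j < n) coef e v j ^+ 2.
  have lt : 3 / 4 * inner v v < inner v v by lra.
  have := cvgr_gt _ (parseval heig L2v) _ lt => hN.
  near \oo => n; exists n; apply: ltW; near: n; exact: hN.
have hD : inner v v / 4 <= La `^ s * \sum_(j < n) lam j `^ (- s) * coef e v j ^+ 2.
  have h3 : \sum_(j < n) coef e v j ^+ 2 <=
      La `^ s * \sum_(j < n) lam j `^ (- s) * coef e v j ^+ 2 +
      (\sum_(j < n) lam j * coef e v j ^+ 2) / La.
    rewrite mulr_sumr mulr_suml -big_split/=; apply: ler_sum => j _.
    have := powR_interp_up s0 La0 (lam0 j) => h.
    rewrite -[leLHS]mul1r (le_trans (ler_wpM2r (sqr_ge0 _) h))//.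
    by apply: le_of_eq; ring.
  by have := hG n; lra.
apply: le_trans (doth_norm_lb _ _ n); rewrite lee_fin.
have -> : \sum_(j < n) lam j `^ (- s) * coef e (fun x : ptd => t * Phi a k (rv x)) j ^+ 2 =
    t ^+ 2 * \sum_(j < n) lam j `^ (- s) * coef e v j ^+ 2.
  by rewrite mulr_sumr; apply: eq_bigr => j _; rewrite coefZ// exprMn mulrCA.
rewrite (sqrtrM _ (sqr_ge0 t)) sqrtr_sqr (ger0_norm t0) -mulrA ler_wpM2l//.
set B := J%:R `^ _; have B0 : 0 <= B by exact: powR_ge0.
rewrite -(ger0_norm B0) -sqrtr_sqr -sqrtrM; last first.
  by rewrite divr_ge0 ?mulr_ge0 ?powR_ge0 ?(ltW c10) ?(ltW r00).
rewrite ler_wsqrtr// -(ler_pM2l (powR_gt0 s La0)); apply: le_trans hD.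
apply: (@le_trans _ _ (c1 * r0 * J%:R ^+ (2 * korder k) / 4)); last by rewrite ler_wpM2r.
have BE : (J%:R ^+ 2) `^ s * B ^+ 2 = J%:R ^+ (2 * korder k).
  rewrite -(powR_mulrn 2 B0) -(powR_mulrn 2 (ltW J0)) -!powRrM -powRD_gt0//.
  rewrite -powR_mulrn ?(ltW J0)//; congr (_ `^ _); rewrite natrM; ring.
rewrite /La powRM ?(ltW L0) ?exprn_ge0 ?(ltW J0)// -BE.
have Ls : L `^ s != 0 by rewrite gt_eqF// powR_gt0.
by apply: le_of_eq; field.
Unshelve. all: by end_near.
Qed.

Lemma Hnorm_lower (xi r0 : R) (i0 : 'I_d) (k1 : 'I_d -> nat) : 0 < r0 ->
  exists2 c : R, 0 < c & forall J (a : {ffun 'I_d -> 'I_J} -> R) (t : R), (0 < J)%N ->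
    0 <= t -> (forall l, `|a l| <= 1) -> r0 * J%:R ^+ d <= \sum_l a l ^+ 2 ->
    ((t * c * J%:R `^ (xi + (korder (kinc i0 k1))%:R))%:E <=
     Hnorm lam (Hemb e xi (fun x : ptd => t * Phi a (kinc i0 k1) (rv x))%R))%E.
Proof.
move=> r00; have [x0|x0] := boolP (0 <= xi); last first.
  have s0 : 0 <= - xi by rewrite oppr_ge0 ltW// ltNge.
  have [c c0 hc] := @doth_norm_Phi_lower (- xi) r0 (kinc i0 k1) s0 r00.
  exists c => // J a t J0 t0 a1 ha; rewrite HnormE (negbTE x0).
  by have := hc J a t J0 t0 a1 ha; rewrite opprK [_ + xi]addrC.
have [c c0 hc] := @sobolev_lower R d xi i0 k1 x0.
exists (c * Num.sqrt r0); first by rewrite mulr_gt0 ?sqrtr_gt0.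
move=> J a t J0' t0 a1 ha; have J0 : 0 < J%:R :> R by rewrite ltr0n.
rewrite HnormE x0 (_ : (fun x => _) = (fun x : ptd => Phi (fun l => t * a l) (kinc i0 k1) (rv x))); last first.
  by apply/funext => x; rewrite PhiZ.
apply: le_trans (hc J _ J0'); rewrite lee_fin.
set L := J%:R `^ _; have L0 : 0 <= L by exact: powR_ge0.
rewrite [leLHS](_ : _ = c * L * (t * Num.sqrt r0)); last by ring.
rewrite ler_wpM2l ?mulr_ge0 ?(ltW c0)//.
rewrite -{1}(ger0_norm t0) -sqrtr_sqr -sqrtrM ?sqr_ge0// ler_wsqrtr//.
under eq_bigr do rewrite exprMn.
by rewrite -mulr_sumr -mulrA ler_wpM2l ?sqr_ge0// ler_pdivlMr ?exprn_gt0.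
Qed.

End NegativeNorms.

(** * Distances *)

(* Minkowski's inequality from its pointwise quadratic form, optimizing over k. *)
Lemma triangle_of_sq (R : realType) (x y z : \bar R) : (0 <= x)%E -> (0 <= y)%E -> (0 <= z)%E ->
  (forall k : R, 0 < k -> (z ^+ 2 <= (1 + k)%:E * x ^+ 2 + (1 + k^-1)%:E * y ^+ 2)%E) ->
  (z <= x + y)%E.
Proof.
case: x => [x||] // x0; last by move=> y0 _ _; rewrite addye ?leey// gt_eqF// (lt_le_trans _ y0).
case: y => [y||] // y0; last by move=> _ _; rewrite addey ?leey.
case: z => [z||] // z0 h; last first.
  by have := h 1 ltr01; rewrite expe2 mulyy -!EFin_expe -!EFinM -EFinD leye_eq.
rewrite -EFinD lee_fin; apply/ler_addgt0Pr => e e0.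
have x' : 0 < x + e / 2 by rewrite ltr_wpDl// divr_gt0.
have y' : 0 < y + e / 2 by rewrite ltr_wpDl// divr_gt0.
(* The optimal k is y / x; the shift by e / 2 makes it defined and positive when x or y is zero. *)
have := h ((y + e / 2) / (x + e / 2)) (divr_gt0 y' x').
rewrite -!EFin_expe -!EFinM -EFinD lee_fin => h1.
rewrite -(@ler_pXn2r _ 2%N) ?nnegrE//; last by rewrite !addr_ge0// ltW.
apply: le_trans h1 _; rewrite invf_div.
have -> : x + y + e = (x + e / 2) + (y + e / 2) by lra.
set X := x + e / 2 in x' *; set Y := y + e / 2 in y' *.
have -> : (X + Y) ^+ 2 = (1 + Y / X) * X ^+ 2 + (1 + X / Y) * Y ^+ 2 by field; rewrite !gt_eqF.
rewrite lee_fin in x0; rewrite lee_fin in y0.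
by apply: lerD; rewrite ler_wpM2l ?addr_ge0 ?divr_ge0 ?(ltW x') ?(ltW y')// lerXn2r ?nnegrE ?(ltW x') ?(ltW y')// /X /Y lerDl divr_ge0 ?(ltW e0).
Qed.

Lemma sqrte_triangle (R : realType) (x y z : \bar R) : (0 <= x)%E -> (0 <= y)%E -> (0 <= z)%E ->
  (forall k : R, 0 < k -> (z <= (1 + k)%:E * x + (1 + k^-1)%:E * y)%E) ->
  (sqrte z <= sqrte x + sqrte y)%E.
Proof.
move=> x0 y0 z0 h; apply: triangle_of_sq; rewrite ?sqrte_ge0// => k k0.
by rewrite !sqr_sqrte//; exact: h.
Qed.

Lemma comb_leD (R : realType) (k1 k2 x y a b a' b' : \bar R) :
  (0 <= a)%E -> (0 <= a')%E -> (0 <= b)%E -> (0 <= b')%E ->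
  (x <= k1 * a + k2 * b)%E -> (y <= k1 * a' + k2 * b')%E ->
  (x + y <= k1 * (a + a') + k2 * (b + b'))%E.
Proof.
by move=> a0 a0' b0 b0' h1 h2; rewrite !ge0_muleDr// addeACA; exact: leeD.
Qed.

Lemma sqrB_le (R : realType) (k a b : R) : 0 < k ->
  (a - b) ^+ 2 <= (1 + k) * a ^+ 2 + (1 + k^-1) * b ^+ 2.
Proof.
move=> k0; rewrite -subr_ge0.
have -> : (1 + k) * a ^+ 2 + (1 + k^-1) * b ^+ 2 - (a - b) ^+ 2 = k^-1 * (k * a + b) ^+ 2.
  by field; rewrite gt_eqF.
by rewrite mulr_ge0 ?sqr_ge0// invr_ge0 ltW.
Qed.

Section Triangle.
Context {R : realType} {d : nat}.
Local Notation ptd := (pt R d).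
Implicit Types v w g h : ptd -> R.

Lemma test_mideriv m (b : {ffun 'I_d -> 'I_m.+1}) (phi : 'rV[R]_d -> R) :
  test_fun phi -> test_fun (mideriv b phi).
Proof.
move=> tphi; rewrite /mideriv; elim: (enum _) => //= i s IH.
by elim: (nat_of_ord (b i)) => //= n IHn; exact: test_pderiv.
Qed.

Lemma weak_derivB m (b : {ffun 'I_d -> 'I_m.+1}) v w g h : L2 v -> L2 w -> L2 g -> L2 h ->
  weak_deriv b v g -> weak_deriv b w h ->
  weak_deriv b (fun x => v x - w x) (fun x => g x - h x).
Proof.
move=> L2v L2w L2g L2h vg wh phi tphi.
have L2m : L2 (mideriv b phi \o rv) by apply: L2_test; exact: test_mideriv.
have L2p : L2 (phi \o rv) by exact: L2_test.
by rewrite !innerBl// vg// wh// mulrBr.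
Qed.

Lemma integral_sqB (k : R) v w : 0 < k -> measurable_fun [set: ptd] v -> measurable_fun [set: ptd] w ->
  (\int[vol]_x ((v x - w x) ^+ 2)%:E <= (1 + k)%:E * \int[vol]_x (v x ^+ 2)%:E +
    (1 + k^-1)%:E * \int[vol]_x (w x ^+ 2)%:E)%E.
Proof.
move=> k0 mv mw.
have k1 : 0 <= 1 + k by rewrite addr_ge0// ltW.
have k2 : 0 <= 1 + k^-1 by rewrite addr_ge0// invr_ge0 ltW.
have m2 (u : ptd -> R) : measurable_fun [set: ptd] u -> measurable_fun [set: ptd] (fun x => (u x ^+ 2)%:E).
  by move=> mu; apply/measurable_EFinP; exact: measurable_funX.
rewrite -!ge0_integralZl//; try (by move=> *; rewrite lee_fin sqr_ge0); try exact: m2.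
rewrite -ge0_integralD//; first last.
- by apply: emeasurable_funM => //; exact: m2.
- by move=> x _; rewrite -EFinM lee_fin; apply: mulr_ge0 => //; exact: sqr_ge0.
- by apply: emeasurable_funM => //; exact: m2.
- by move=> x _; rewrite -EFinM lee_fin; apply: mulr_ge0 => //; exact: sqr_ge0.
apply: le_integralT => x; first by rewrite lee_fin sqr_ge0.
by rewrite -!EFinM -EFinD lee_fin sqrB_le.
Qed.

Lemma measurable_edist : measurable_fun [set: ptd * ptd] (fun p => Defs.edist p.1 p.2).
Proof.
apply: measurableT_comp.
  by apply: continuous_measurable_fun; exact: sqrt_continuous.
apply: measurable_sum => i; apply: measurable_funX; apply: measurable_funB.
- exact: (@measurableT_comp _ _ _ _ _ _ (fun x : ptd => tnth x i) _ fst (measurable_tnth i) measurable_fst).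
- exact: (@measurableT_comp _ _ _ _ _ _ (fun x : ptd => tnth x i) _ snd (measurable_tnth i) measurable_snd).
Qed.

Definition slobint (sigma : R) v (p : ptd * ptd) : R :=
  (v p.1 - v p.2) ^+ 2 / Defs.edist p.1 p.2 `^ (d%:R + 2 * sigma).

Lemma slobint_ge0 sigma v p : 0 <= slobint sigma v p.
Proof. by rewrite divr_ge0 ?sqr_ge0 ?powR_ge0. Qed.

Lemma measurable_slobint sigma v : measurable_fun [set: ptd] v ->
  measurable_fun [set: ptd * ptd] (fun p => (slobint sigma v p)%:E).
Proof.
move=> mv; apply/measurable_EFinP; rewrite /slobint.
apply: measurable_funM.
  apply: measurable_funX; apply: measurable_funB.
  - exact: (measurableT_comp mv measurable_fst).
  - exact: (measurableT_comp mv measurable_snd).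
under eq_fun do rewrite -powRN.
exact: (measurableT_comp (@measurable_powR R _) measurable_edist).
Qed.

Lemma slobodeckij_sqB sigma (k : R) v w : 0 < k ->
  measurable_fun [set: ptd] v -> measurable_fun [set: ptd] w ->
  (slobodeckij sigma (fun x => v x - w x)%R <= (1 + k)%:E * slobodeckij sigma v +
    (1 + k^-1)%:E * slobodeckij sigma w)%E.
Proof.
move=> k0 mv mw.
have k1 : 0 <= 1 + k by rewrite addr_ge0// ltW.
have k2 : 0 <= 1 + k^-1 by rewrite addr_ge0// invr_ge0 ltW.
have m2 (u : ptd -> R) x : measurable_fun [set: ptd] u -> measurable_fun [set: ptd] (fun y => (slobint sigma u (x, y))%:E).
  move=> mu; exact: (@measurableT_comp _ _ _ _ _ _ (fun p => (slobint sigma u p)%:E) _ (pair x) (measurable_slobint sigma mu) (measurable_pair1 x)).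
have m1 (u : ptd -> R) : measurable_fun [set: ptd] u -> measurable_fun [set: ptd] (fun x => \int[vol]_y (slobint sigma u (x, y))%:E)%E.
  move=> mu; apply: (@measurable_fun_fubini_tonelli_F _ _ _ _ R vol (fun p => (slobint sigma u p)%:E) (measurable_slobint sigma mu)).
  by move=> p; rewrite lee_fin slobint_ge0.
have i0 (u : ptd -> R) x : (0 <= \int[@vol R d]_y (slobint sigma u (x, y))%:E)%E.
  by apply: integral_ge0 => y _; rewrite lee_fin slobint_ge0.
rewrite /slobodeckij -!ge0_integralZl//; try (exact: m1); try (by move=> *; exact: i0).
rewrite -ge0_integralD//; first last.
- by apply: emeasurable_funM => //; exact: m1.
- by move=> x _; apply: mule_ge0 => //; exact: i0.
- by apply: emeasurable_funM => //; exact: m1.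
- by move=> x _; apply: mule_ge0 => //; exact: i0.
apply: le_integralT => x; first by apply: integral_ge0 => y _; rewrite lee_fin divr_ge0 ?sqr_ge0 ?powR_ge0.
rewrite -!ge0_integralZl//; try (exact: m2);
  try (by move=> *; rewrite lee_fin divr_ge0 ?sqr_ge0 ?powR_ge0).
rewrite -ge0_integralD//; first last.
- by apply: emeasurable_funM => //; exact: m2.
- by move=> y _; apply: mule_ge0 => //; rewrite lee_fin divr_ge0 ?sqr_ge0 ?powR_ge0.
- by apply: emeasurable_funM => //; exact: m2.
- by move=> y _; apply: mule_ge0 => //; rewrite lee_fin divr_ge0 ?sqr_ge0 ?powR_ge0.
apply: le_integralT => y; first by rewrite lee_fin divr_ge0 ?sqr_ge0 ?powR_ge0.
rewrite -!EFinM -EFinD lee_fin.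
set iD := (_ `^ _)^-1; have iD0 : 0 <= iD by rewrite invr_ge0 powR_ge0.
have -> : v x - w x - (v y - w y) = (v x - v y) - (w x - w y) by ring.
apply: le_trans (ler_wpM2r iD0 (sqrB_le _ _ k0)) _.
by apply: le_of_eq; ring.
Qed.

Lemma sume_comb_le (I : finType) (P : pred I) (f g h : I -> \bar R) (k1 k2 : \bar R) :
  (0 <= k1)%E -> (0 <= k2)%E -> (forall i, P i -> 0 <= g i)%E -> (forall i, P i -> 0 <= h i)%E ->
  (forall i, P i -> f i <= k1 * g i + k2 * h i)%E ->
  (\sum_(i | P i) f i <= k1 * (\sum_(i | P i) g i) + k2 * (\sum_(i | P i) h i))%E.
Proof.
move=> k10 k20 g0 h0 fgh; rewrite !ge0_sume_distrr// -big_split/=.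
exact: lee_sum.
Qed.

(** Differences of admissible families are admissible, so near-minimizers of both sides suffice. In
    the form of [sqrte_triangle], linear in the squared norms, the L^2 and Slobodeckij parts are
    handled term by term with the same k. *)
Lemma sobolev_triangle (s : R) v w :
  (sobolev_norm s (fun x => v x - w x)%R <= sobolev_norm s v + sobolev_norm s w)%E.
Proof.
set m := Num.truncn s; set sigma := s - m%:R.
pose S (g : {ffun 'I_d -> 'I_m.+1} -> ptd -> R) :=
  (\sum_(a : {ffun 'I_d -> 'I_m.+1} | (miorder a <= m)%N) L2norm (g a) ^+ 2
     + if (0 < sigma)%R then
         \sum_(a : {ffun 'I_d -> 'I_m.+1} | miorder a == m) slobodeckij sigma (g a)
       else 0)%E.
pose adm v (g : {ffun 'I_d -> 'I_m.+1} -> ptd -> R) := L2 v /\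
   forall a, (miorder a <= m)%N -> L2 (g a) /\ weak_deriv a v (g a).
have NE u : sobolev_norm s u = ereal_inf [set sqrte (S g) | g in adm u] by [].
have S0 (g : {ffun 'I_d -> 'I_m.+1} -> ptd -> R) : (0 <= S g)%E.
  apply: adde_ge0; first by apply: sume_ge0 => a _; exact: sqre_ge0.
  by case: ifP => // _; apply: sume_ge0 => a _; exact: slobodeckij_ge0.
have key (g h : {ffun 'I_d -> 'I_m.+1} -> ptd -> R) : adm v g -> adm w h ->
    (sobolev_norm s (fun x => v x - w x)%R <= sqrte (S g) + sqrte (S h))%E.
  move=> [L2v ag] [L2w ah].
  pose gh a x := g a x - h a x.
  have agh : adm (fun x => v x - w x) gh.
    split; first exact: L2B.
    move=> a am; have [L2g wg] := ag a am; have [L2h wh] := ah a am.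
    by split; [exact: L2B|exact: weak_derivB].
  apply: (@le_trans _ _ (sqrte (S gh))).
    by rewrite NE; apply: ereal_inf_lbound; exists gh.
  apply: (sqrte_triangle (S0 g) (S0 h) (S0 gh)) => k k0; rewrite /S.
  have k1 : (0 <= (1 + k)%:E)%E by rewrite lee_fin addr_ge0// ltW.
  have k2 : (0 <= (1 + k^-1)%:E)%E by rewrite lee_fin addr_ge0// invr_ge0 ltW.
  have ms a : (miorder a <= m)%N -> measurable_fun [set: ptd] (g a) /\ measurable_fun [set: ptd] (h a).
    move=> am; have [L2g _] := ag a am; have [L2h _] := ah a am.
    by split; exact: L2_meas.
  set A := (\sum_(a | _) L2norm (g a) ^+ 2)%E; set B := (\sum_(a | _) L2norm (h a) ^+ 2)%E.
  set A' := (X in (_ <= (1 + k)%:E * (A + X) + _)%E).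
  set B' := (X in (_ <= _ + (1 + k^-1)%:E * (B + X))%E).
  have A0 : (0 <= A)%E by apply: sume_ge0 => a _; exact: sqre_ge0.
  have B0 : (0 <= B)%E by apply: sume_ge0 => a _; exact: sqre_ge0.
  have A0' : (0 <= A')%E by rewrite /A'; case: ifP => // _; apply: sume_ge0 => a _; exact: slobodeckij_ge0.
  have B0' : (0 <= B')%E by rewrite /B'; case: ifP => // _; apply: sume_ge0 => a _; exact: slobodeckij_ge0.
  apply: (comb_leD A0 A0' B0 B0').
    apply: sume_comb_le => // [a _|a _|a am]; try exact: sqre_ge0.
    have [mg mh] := ms a am; rewrite !L2norm_sqr; exact: integral_sqB.
  rewrite /A' /B'; case: ifP => [sp|_]; last by rewrite !mule0 adde0.
  apply: sume_comb_le => // [a _|a _|a /eqP am]; try exact: slobodeckij_ge0.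
  have [mg mh] := ms a (eq_leq am).
  exact: slobodeckij_sqB.
have N0 (u : ptd -> R) : (0 <= sobolev_norm s u)%E.
  by rewrite NE; apply: le_ereal_inf_tmp => _ [g _ <-]; exact: sqrte_ge0.
have [vf|vf] := boolP (sobolev_norm s v \is a fin_num); last first.
  move: vf; rewrite ge0_fin_numE// -leNgt leye_eq => /eqP ->.
  by rewrite addye ?leey// gt_eqF// (lt_le_trans _ (N0 w)).
have [wf|wf] := boolP (sobolev_norm s w \is a fin_num); last first.
  move: wf; rewrite ge0_fin_numE// -leNgt leye_eq => /eqP ->.
  by rewrite addey ?leey// gt_eqF// (lt_le_trans _ (N0 v)).
apply/lee_addgt0Pr => ep ep0.
have [_ [g ag <-] hg] := lb_ereal_inf_adherent (divr_gt0 ep0 (ltr0n R 2)) vf.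
have [_ [h ah <-] hh] := lb_ereal_inf_adherent (divr_gt0 ep0 (ltr0n R 2)) wf.
apply: le_trans (key g h ag ah) _.
rewrite [X in (_ + X%:E)%E](splitr ep) EFinD addeACA.
by apply: leeD; exact: ltW.
Qed.

Lemma doth_triangle (lam : nat -> R) (s : R) (b c : nat -> R) :
  (doth_norm lam s (fun j => b j - c j)%R <= doth_norm lam s b + doth_norm lam s c)%E.
Proof.
apply: triangle_of_sq; rewrite ?sqrte_ge0// => k k0.
have t0 (f : nat -> R) j : (0 <= (lam j `^ s * f j ^+ 2)%:E)%E.
  by rewrite lee_fin mulr_ge0 ?powR_ge0 ?sqr_ge0.
have k1 : (0 <= 1 + k) by rewrite addr_ge0// ltW.
have k2 : (0 <= 1 + k^-1) by rewrite addr_ge0// invr_ge0 ltW.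
rewrite /doth_norm !sqr_sqrte; try by apply: nneseries_ge0 => j _ _; first [exact: t0|exact: (t0 (fun j => b j - c j))].
rewrite -!nneseriesZl// -nneseriesD//; try by move=> j _ _; apply: mule_ge0.
apply: lee_nneseries => [j _ _|j _]; first exact: (t0 (fun j => b j - c j)).
rewrite -!EFinM -EFinD lee_fin.
apply: le_trans (ler_wpM2l (powR_ge0 _ _) (sqrB_le _ _ k0)) _.
by apply: le_of_eq; ring.
Qed.

(** The point w stands on the left in both terms, the order in which distances occur in [Hopen_far]
    and [packing_count]. *)
Lemma Hdist_triangle (lam : nat -> R) (s : R) (z1 z2 w : @Helt R d s) :
  (Hdist lam z1 z2 <= Hdist lam w z2 + Hdist lam w z1)%E.
Proof.
rewrite /Hdist /Hnorm; move: z1 z2 w; rewrite /Helt; case: (0 <= s) => z1 z2 w.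
  rewrite (_ : (fun x => z1 x - z2 x) = (fun x => (w x - z2 x) - (w x - z1 x))).
    exact: sobolev_triangle.
  by apply/funext => x; ring.
rewrite (_ : (fun x => z1 x - z2 x) = (fun x => (w x - z2 x) - (w x - z1 x))).
  exact: doth_triangle.
by apply/funext => x; ring.
Qed.

(** Measurability of an estimator is expressed by open sets; this makes the event of a large error
    measurable. *)
Lemma Hopen_far (lam : nat -> R) (s r : R) (z0 : @Helt R d s) :
  Hopen lam [set z | (r%:E < Hdist lam z z0)%E].
Proof.
(* A finite level [R0] between r and the distance, which may be infinite. *)
move=> z /= rz; have [R0 rR0 R0z] : exists2 R0 : R, r < R0 & (R0%:E <= Hdist lam z z0)%E.
  case: (Hdist lam z z0) rz => [D rD|_|//]; first by exists D; rewrite ?lexx// -lte_fin.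
  by exists (r + 1); rewrite ?leey// ltrDl.
exists (R0 - r); first by rewrite subr_gt0.
move=> w wz; have h := le_trans R0z (Hdist_triangle lam z z0 w).
rewrite ltNge; apply/negP => hr.
case: (Hdist lam w z0) h hr => [x||] //; case: (Hdist lam w z) wz => [y||] //.
by rewrite -EFinD !lee_fin lte_fin; lra.
Qed.
End Triangle.

(** * Testing *)

Section Hamming.
Context {R : realType} {I : finType}.

Definition hamming (x y : {ffun I -> bool}) : nat := #|[pred i | x i != y i]|.

Lemma hamming_sum (x y : {ffun I -> bool}) :
  \sum_i ((x i)%:R - (y i)%:R : R) ^+ 2 = (hamming x y)%:R.
Proof.
rewrite /hamming -sum1_card natr_sum [RHS]big_mkcond/=; apply: eq_bigr => i _.
by rewrite inE; case: (x i); case: (y i); rewrite /= ?subrr ?subr0 ?sub0r ?sqrrN ?expr1n ?expr0n.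
Qed.

(* Chernoff bound: [1 <= rho ^ (8 * hamming - #|I|)] on the ball, with rho = 4/5. *)
Lemma hamming_ball (y : {ffun I -> bool}) :
  (#|[pred x : {ffun I -> bool} | (8 * hamming x y < #|I|)%N]|%:R : R) <= (3 / 2) ^+ #|I|.
Proof.
(* For this value 1 + rho^8 is at most (3/2) rho, which is the inequality needed per coordinate. *)
pose rho : R := 4 / 5.
have rho0 : 0 < rho by rewrite /rho; lra.
have rho1 : rho <= 1 by rewrite /rho; lra.
have gen : \sum_(x : {ffun I -> bool}) rho ^+ (8 * hamming x y) = (1 + rho ^+ 8) ^+ #|I|.
  pose F i (b : bool) := if b != y i then rho ^+ 8 else 1.
  transitivity (\prod_(i : I) \sum_(b : bool) F i b).
    rewrite bigA_distr_bigA/=; apply: eq_bigr => x _.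
    rewrite exprM /hamming -prodr_const big_mkcond/=; apply: eq_bigr => i _.
    by rewrite inE.
  rewrite (eq_bigr (fun=> 1 + rho ^+ 8)); first by rewrite prodr_const.
  by move=> i _; rewrite big_bool /F; case: (y i) => /=; lra.
have h : (#|[pred x : {ffun I -> bool} | (8 * hamming x y < #|I|)%N]|%:R : R) * rho ^+ #|I| <=
    (1 + rho ^+ 8) ^+ #|I|.
  rewrite -gen -sum1_card natr_sum mulr_suml big_mkcond/=.
  apply: ler_sum => x _; case: ifP => [|_]; last exact: exprn_ge0 (ltW rho0).
  by rewrite inE mul1r => h; apply: ler_wiXn2l; rewrite ?(ltW rho0)// ltnW.
have hr : rho ^+ #|I| > 0 by rewrite exprn_gt0.
rewrite -(ler_pM2r hr); apply: le_trans h _; rewrite -exprMn.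
rewrite lerXn2r ?nnegrE//; rewrite /rho.
- by rewrite addr_ge0// exprn_ge0//; lra.
- lra.
- rewrite !exprS expr0; lra.
Qed.

End Hamming.

Lemma exists_le_average d (W : measurableType d) (R : realType) (Q : probability W R)
    (I : finType) (G : I -> W -> R) (V : R) :
  (0 < #|I|)%N -> (forall i, measurable_fun [set: W] (G i)) -> (forall i w, 0 <= G i w) ->
  (forall w, \sum_i G i w <= V) ->
  exists i, (\int[Q]_w (G i w)%:E <= (V / #|I|%:R)%:E)%E.
Proof.
move=> I0 mG G0 hV; apply/not_existsP => h.
have {}h i : ((V / #|I|%:R)%:E < \int[Q]_w (G i w)%:E)%E by rewrite ltNge; apply/negP; exact: h.
have I0' : 0 < #|I|%:R :> R by rewrite ltr0n.
have hs : (\int[Q]_w (\sum_i G i w)%:E <= V%:E)%E.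
  apply: (@le_trans _ _ (\int[Q]_w V%:E)%E).
    by apply: le_integralT => w; rewrite lee_fin ?sumr_ge0.
  by rewrite integral_prob_cst.
have := hs; under eq_integral do rewrite -sumEFin.
rewrite ge0_integral_sum//; last 2 first.
- by move=> i; apply/measurable_EFinP.
- by move=> i w _; rewrite lee_fin.
move=> hs'; have [i0 _] : exists i : I, true by move/card_gt0P : I0 => [i _]; exists i.
have : (V%:E < \sum_i \int[Q]_w (G i w)%:E)%E.
  have -> : V%:E = (\sum_(i : I) (V / #|I|%:R)%:E)%E.
    rewrite sumEFin sumr_const -[RHS]/((_ *+ #|I|)%:E) -mulr_natr; congr EFin.
    by field; rewrite gt_eqF.
  rewrite (bigD1 i0)//= [X in (_ < X)%E](bigD1 i0)//=.
  apply: lte_leD; [by rewrite sumEFin|exact: h|].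
  by apply: lee_sum => i _; apply: ltW; exact: h.
by rewrite ltNge hs'.
Qed.

Section Testing.
Context {R : realType} {d : nat}.
Variables (T : R) (T_gt0 : 0 < T) (N : nat).
Local Notation RM := (measurableTypeR R).

Lemma measurable_observed (u : R -> pt R d -> R) :
  measurable_fun [set: RM * pt R d] (fun q => u q.1 q.2) ->
  measurable_fun [set: N.-tuple (obs R d)]
    (fun w : N.-tuple (obs R d) => map_tuple (observe u) w : N.-tuple (obs R d)).
Proof. by move=> mu; apply: measurable_map_tuple; exact: measurable_observe. Qed.

Lemma measurable_observed_preimage (u : R -> pt R d -> R) (S : set (N.-tuple (obs R d))) :
  measurable_fun [set: RM * pt R d] (fun q => u q.1 q.2) -> measurable S ->
  measurable ((fun w : N.-tuple (obs R d) => map_tuple (observe u) w) @^-1` S).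
Proof.
by move=> mu mS; rewrite -[X in measurable X]setTI; exact: (measurable_observed mu).
Qed.

Lemma data_lawE (u : R -> pt R d -> R) (S : set (N.-tuple (obs R d))) :
  measurable_fun [set: RM * pt R d] (fun q => u q.1 q.2) -> measurable S ->
  data_law T_gt0 u S = (\int[iid (sampling_with T_gt0 (normal_prob 0 1)) N]_w
     ((\1_S (map_tuple (observe u) w) : R)%:E))%E.
Proof.
move=> mu mS; rewrite /data_law /pushforward.
have mA := measurable_observed_preimage mu mS.
transitivity (\int[iid (sampling_with T_gt0 (normal_prob 0 1)) N]_w
   (\1_((fun w : N.-tuple (obs R d) => map_tuple (observe u) w) @^-1` S) w)%:E)%E.
  by rewrite integral_indic// setIT.
by apply: eq_integral => w _; rewrite !indicE.
Qed.

(* Under the law where every u i is replaced by u0, the average over i of the probability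
   of A i is at most V / #|I|. *)
Lemma some_small_success (eta s K E V : R) (u0 : R -> pt R d -> R) (I : finType)
    (u : I -> R -> pt R d -> R) (A : I -> set (N.-tuple (obs R d))) :
  0 < eta -> eta <= 1 / 2 -> 0 < s < 1 -> eta `^ (- s) <= K -> 0 <= E -> 0 <= V -> (0 < #|I|)%N ->
  measurable_fun [set: RM * pt R d] (fun q => u0 q.1 q.2) ->
  (forall i, measurable_fun [set: RM * pt R d] (fun q => u i q.1 q.2)) ->
  (forall i, measurable (A i)) ->
  (forall i, (\int[uniform_prob T_gt0]_t \int[vol]_x ((u i t x - u0 t x) ^+ 2)%:E <= E%:E)%E) ->
  (forall D, \sum_i (\1_(A i) D : R) <= V) ->
  exists i, (data_law T_gt0 (u i) (A i) <=
    (step_const eta s K E ^+ N * (V / #|I|%:R) `^ (s / (1 + s)))%:E)%E.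
Proof.
move=> eta0 eta2 s01 etaK E0 V0 I0 mu0 mu mA hE hV.
have eta01 : 0 <= eta <= 1 by apply/andP; split; lra.
pose Q := iid (@sampling_with R d T T_gt0 (heavy_prob eta01)) N.
pose G i (w : N.-tuple (obs R d)) : R := \1_(A i) (map_tuple (observe u0) w).
have mG i : measurable_fun [set: N.-tuple (obs R d)] (G i).
  rewrite (_ : G i = \1_((fun w : N.-tuple (obs R d) => map_tuple (observe u0) w) @^-1` A i)).
    by apply: measurable_indic; exact: measurable_observed_preimage.
  by apply/funext => w; rewrite /G !indicE.
have G0 i w : 0 <= G i w by rewrite /G indicE ler0n.
have [i hi] := @exists_le_average _ _ R Q I G V I0 mG G0 (fun w => hV _).
exists i; rewrite data_lawE//.
have /andP[s0 s1] := s01.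
pose p := (1 + s) / s.
have p1 : 1 < p by rewrite /p ltr_pdivlMr// mul1r ltrDr.
have c0 : 0 <= step_const eta s K E.
  have kc := ltW (kernel_const_gt0 eta0 etaK); rewrite /step_const.
  apply: addr_ge0 => //; apply: mulr_ge0; first by apply: mulr_ge0 => //; exact: ltW.
  by apply: addr_ge0 => //; apply: mulr_ge0 => //; exact: ltW.
have os := one_step eta01 eta0 eta2 s01 etaK mu0 (mu i) (hE i).
have mI : measurable_fun [set: N.-tuple (obs R d)] (\1_(A i) : N.-tuple (obs R d) -> R).
  exact: measurable_indic.
have := iid_hoelder (measurable_observe (mu i)) (measurable_observe mu0) p1 c0 os mI.
move=> H; apply: le_trans (H _) _.
  by move=> D; rewrite indicE; case: (_ \in _); rewrite /= ?lexx ?ler01.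
rewrite EFinM; apply: lee_wpmul2l; first by rewrite lee_fin exprn_ge0.
have -> : (\int[Q]_w (\1_(A i) (map_tuple (observe u0) w) `^ p)%:E = \int[Q]_w (G i w)%:E)%E.
  apply: eq_integral => w _; rewrite /G indicE; case: (_ \in _); rewrite /= ?powR1//.
  by rewrite powR0// gt_eqF// (lt_trans _ p1).
have -> : s / (1 + s) = p^-1 by rewrite /p invf_div.
rewrite -poweR_EFin; apply: gt0_ler_poweR => //.
- by rewrite invr_ge0 ltW// (lt_trans _ p1).
- by rewrite in_itv/= leey andbT; apply: integral_ge0 => w _; rewrite lee_fin.
- by rewrite in_itv/= leey andbT lee_fin divr_ge0.
Qed.

End Testing.

(** * The family of hypotheses indexed by the hypercube *)

Section Hypercube.
Context {R : realType} {d : nat}.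
Local Notation ptd := (pt R d).
Variables (lam : nat -> R) (e : nat -> ptd -> R).
Hypothesis heig : dirichlet_eigenpairs lam e.

Lemma HdistE s (v w : ptd -> R) : L2 v -> L2 w ->
  Hdist lam (Hemb e s v) (Hemb e s w) = Hnorm lam (Hemb e s (fun x => v x - w x)).
Proof.
have [[L2e _ _] _] := heig; move=> L2v L2w; rewrite /Hdist /Hnorm /Hemb.
case: (0 <= s) => //; congr doth_norm; apply/funext => j.
by rewrite /coef innerBl.
Qed.

Local Notation cells j := {ffun 'I_d -> 'I_(2 ^ j)%N}.

Lemma hypercube (gam mu xi B : R) : (0 < d)%N -> 0 <= gam -> 0 <= mu <= 1 -> 0 < B ->
  exists K c : R, exists theta : forall j, {ffun cells j -> bool} -> ptd -> R,
  [/\ 0 < K, 0 < c,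
    forall j b, (sobolev_norm gam (theta j b) <= B%:E)%E,
    forall j b b', (Hnorm lam (Hemb e (- mu) (fun x => theta j b x - theta j b' x)%R) <=
      (K * (2 ^ j)%:R `^ (- (gam + mu)))%:E)%E &
    forall j b b', (#|{: cells j}| <= 8 * hamming b b')%N ->
      ((c * (2 ^ j)%:R `^ (- (gam - xi)))%:E <=
       Hdist lam (Hemb e xi (theta j b)) (Hemb e xi (theta j b')))%E].
Proof.
move=> d0 gam0 mu01 B0.
pose i0 := Ordinal d0; pose k1 (_ : 'I_d) := 0%N; pose k := kinc i0 k1.
have kord : korder k = 1%N by rewrite korder_kinc /korder big1.
have [K1 K10 hK1] := @sobolev_upper R d gam k gam0.
have [K2 K20 hK2] := Hnorm_neg_upper heig i0 k1 mu01.
have r00 : 0 < 8^-1 :> R by rewrite invr_gt0.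
have [c c0 hc] := Hnorm_lower heig xi i0 k1 r00.
(* This makes the upper bound of the H^gam norm equal to B: in [t] below, the exponent gam + 1
   compensates the smoothness gam and the one differentiation of the bump. *)
pose del := B / K1; have del0 : 0 < del by rewrite divr_gt0.
pose t j : R := del * (2 ^ j)%:R `^ (- (gam + 1)).
have t0 j : 0 <= t j by rewrite mulr_ge0 ?powR_ge0 ?(ltW del0).
pose a j (b : {ffun cells j -> bool}) l : R := (b l)%:R.
have a1 j b l : `|a j b l| <= 1 by rewrite /a; case: (b l); rewrite /= ?normr1 ?normr0.
pose theta j b (x : ptd) := t j * Phi (a j b) k (rv x).
have L2t j b : L2 (theta j b) by apply: L2Z; exact: L2_Phi.
pose ab j b b' l := a j b l - a j b' l.
have ab1 j b b' l : `|ab j b b' l| <= 1.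
  by rewrite /ab /a; case: (b l); case: (b' l); rewrite /= ?subrr ?subr0 ?sub0r ?normrN ?normr1 ?normr0.
have thB j b b' : (fun x => theta j b x - theta j b' x) =
    (fun x : ptd => t j * Phi (ab j b b') k (rv x)).
  by apply/funext => x; rewrite /theta -mulrBr PhiB.
have J0 j : 0 < (2 ^ j)%:R :> R by rewrite ltr0n expn_gt0.
have tE j r : t j * (2 ^ j)%:R `^ (r + 1) = del * (2 ^ j)%:R `^ (- (gam - r)).
  by rewrite /t -mulrA -powRD_gt0//; congr (_ * _ `^ _); ring.
exists (del * K2), (del * c), theta; split; [exact: mulr_gt0|exact: mulr_gt0| | |].
- move=> j b; apply: le_trans (hK1 j (a j b) (t j) (t0 j) (a1 j b)) _.
  rewrite lee_fin kord mulrAC tE subrr oppr0 powRr0 mulr1 /del mulfVK// gt_eqF//.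
- move=> j b b'; rewrite thB.
  apply: le_trans (hK2 j (ab j b b') (t j) (t0 j) (ab1 j b b')) _.
  rewrite lee_fin -/k kord mulrAC [1 - mu]addrC tE mulrAC.
  by rewrite opprK; apply: le_of_eq; congr (_ * _ `^ _).
- move=> j b b' hb; rewrite HdistE// thB.
  apply: le_trans (hc _ (ab j b b') (t j) _ (t0 j) (ab1 j b b') _).
  + rewrite lee_fin -/k kord [leRHS]mulrAC tE [leRHS]mulrAC//.
  + by rewrite expn_gt0.
  + rewrite hamming_sum mulrC ler_pdivrMr//.
    move: hb; rewrite card_ffun !card_ord => hb.
    by rewrite -natrX mulrC -natrM ler_nat.
Qed.

End Hypercube.

Section ForwardBound.
Context {R : realType} {d : nat}.
Local Notation ptd := (pt R d).

Lemma uniform_L2L2norm (T : R) (T_gt0 : 0 < T) (h : R -> ptd -> R) (X : R) :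
  measurable_fun [set: measurableTypeR R * ptd] (fun q => h q.1 q.2) -> 0 <= X ->
  (L2L2norm T h <= X%:E)%E ->
  (\int[uniform_prob T_gt0]_t \int[vol]_x ((h t x) ^+ 2)%:E <= (X ^+ 2 / T)%:E)%E.
Proof.
move=> mh X0 hX.
pose G t := (\int[@vol R d]_x ((h t x) ^+ 2)%:E)%E.
have G0 t : (0 <= G t)%E by apply: integral_ge0 => x _; rewrite lee_fin sqr_ge0.
have mG : measurable_fun [set: measurableTypeR R] G.
  apply: (@measurable_fun_fubini_tonelli_F _ _ _ _ R vol
    (fun q : measurableTypeR R * ptd => ((h q.1 q.2) ^+ 2)%:E)).
    by apply/measurable_EFinP; exact: measurable_funX.
  by move=> q; rewrite lee_fin sqr_ge0.
have hI : (\int[lebesgue_measure]_(t in `]0%R, T]) G t <= (X ^+ 2)%:E)%E.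
  have -> : (\int[lebesgue_measure]_(t in `]0%R, T]) G t =
      \int[lebesgue_measure]_(t in `]0%R, T]) L2norm (h t) ^+ 2)%E.
    by apply: eq_integral => t _; rewrite L2norm_sqr.
  have i0 : (0 <= \int[lebesgue_measure]_(t in `]0%R, T]) L2norm (h t) ^+ 2)%E.
    by apply: integral_ge0 => t _; exact: sqre_ge0.
  rewrite -lee_sqrt ?lee_fin ?sqr_ge0//; apply: le_trans hX _.
  by rewrite /= sqrtr_sqr ger0_norm.
rewrite integral_uniform// subr0 -integral_itv_obnd_cbnd; last exact: measurable_funTS.
rewrite mulrC EFinM; apply: lee_wpmul2l => //.
by rewrite lee_fin invr_ge0 ltW.
Qed.

End ForwardBound.

(** * Choice of the parameters as functions of the scale *)

Section Numeric.
Context {R : realType}.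

(** With N at most kap J^p, the expected number of Cauchy errors in the reference sample stays
    bounded. *)
Definition noise_mix (p : R) j : R := 2^-1 * (2 ^ j)%:R `^ (- p).

(** Of the order of 1/log (1/eta) for eta the weight [noise_mix], so that eta^(-s) stays bounded;
    the summand 2 keeps s below 1 at j = 0. *)
Definition conj_exp j : R := (j%:R + 2)^-1.

Lemma noise_mixE p j : noise_mix p j = 2 `^ (- (1 + j%:R * p)).
Proof.
rewrite /noise_mix opprD powRD_gt0// powR_inv1//; congr (_ * _).
by rewrite natrX -powR_mulrn// -powRrM mulrN.
Qed.

Lemma noise_mix_gt0 p j : 0 < noise_mix p j.
Proof. by rewrite noise_mixE powR_gt0. Qed.

Lemma noise_mix_le p j : 0 <= p -> noise_mix p j <= 1 / 2.
Proof.
move=> p0; rewrite /noise_mix mul1r -[leRHS]mulr1 ler_wpM2l//.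
rewrite natrX -powR_mulrn// -powRrM mulrN -[leRHS](_ : 2 `^ 0 = 1); last by rewrite powRr0.
by rewrite ler_powR ?ler1n// oppr_le0 mulr_ge0.
Qed.

Lemma conj_exp01 j : 0 < conj_exp j < 1.
Proof.
have j0 : 0 <= j%:R :> R by [].
by rewrite /conj_exp invr_gt0 invf_lt1; lra.
Qed.

Lemma noise_mix_powR p j : 0 <= p -> noise_mix p j `^ (- conj_exp j) <= 2 `^ (1 + p).
Proof.
move=> p0; rewrite noise_mixE -powRrM ler_powR ?ler1n// mulrNN /conj_exp.
have j0 : 0 <= j%:R :> R by [].
rewrite ler_pdivrMr; last lra.
by rewrite mulrDr mulrDl; nra.
Qed.

(** Although s decreases like 1/j, the product s J^d grows at least linearly in j. This is the
    exponent available in [success_bound]. *)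
Lemma conj_exp_pow d j : (0 < d)%N -> j%:R / 4 <= conj_exp j * (2 ^ j)%:R ^+ d :> R.
Proof.
move=> d0; have j0 : 0 <= j%:R :> R by [].
rewrite /conj_exp [leRHS]mulrC ler_pdivlMr; last lra.
apply: (@le_trans _ _ (2 ^ j)%:R); last by rewrite ler_eXnr// ler1n expn_gt0.
have h : (j * (j + 2) <= 4 * 2 ^ j)%N.
  have h2 : (2 * j + 3 <= 4 * 2 ^ j)%N.
    by elim: j {j0} => // j IH; rewrite expnS; lia.
  by elim: j {j0} h2 => // j IH h2; rewrite expnS in h2 *; have : (2 * j + 3 <= 4 * 2 ^ j)%N; [elim: j {IH h2} => // j IH; rewrite expnS; lia|lia].
move: h; rewrite -(ler_nat R) !natrM natrD; lra.
Qed.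

(** With c2 = ln (4/3): since N (2 eta + E) is at most kap (1 + E0) J^d, the choice of kap bounds
    the first factor by exp (c2/4 s J^d). The second is at most exp (- c2/2 s J^d), as s/(1+s) >=
    s/2. The remaining c2/4 s J^d is at least (c2/16) j by [conj_exp_pow]. *)
Lemma success_bound (d : nat) (p E0 : R) : (0 < d)%N -> 0 <= p -> 0 <= E0 ->
  exists2 kap : R, 0 < kap <= 1 & exists2 c : R, 0 < c &
  forall j N, N%:R <= kap * (2 ^ j)%:R `^ p ->
    step_const (noise_mix p j) (conj_exp j) (2 `^ (1 + p))
        (E0 * (2 ^ j)%:R `^ (d%:R - p)) ^+ N *
      ((3 / 2) ^+ ((2 ^ j) ^ d)%N / 2 ^+ ((2 ^ j) ^ d)%N) `^ (conj_exp j / (1 + conj_exp j)) <=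
    expR (- (c * j%:R)).
Proof.
move=> d0 p0 E00; set KK := kernel_const (2 `^ (1 + p)).
have KK0 : 0 < KK.
  by apply: (@kernel_const_gt0 _ (noise_mix p 0) (conj_exp 0));
    [exact: noise_mix_gt0|exact: noise_mix_powR].
pose c2 : R := ln (4 / 3).
have c20 : 0 < c2 by rewrite ln_gt0//; lra.
pose kap := Num.min 1 (c2 / (4 * (KK * (1 + E0)))).
have D0 : 0 < KK * (1 + E0) by rewrite mulr_gt0//; lra.
have kap0 : 0 < kap by rewrite lt_min ltr01/= divr_gt0// mulr_gt0.
exists kap; first by rewrite kap0/= /kap ge_min lexx.
exists (c2 / 16); first by rewrite divr_gt0.
move=> j N hN; set s := conj_exp j; set J : R := (2 ^ j)%:R in hN *.
have /andP[s0 s1] := conj_exp01 j; rewrite -/s in s0 s1.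
have J1 : 1 <= J by rewrite /J ler1n expn_gt0.
have J0 : 0 < J by exact: lt_le_trans J1.
pose E := E0 * J `^ (d%:R - p).
have Ee0 : 0 <= E by rewrite mulr_ge0 ?powR_ge0.
have eta0 := noise_mix_gt0 p j; set eta := noise_mix p j in eta0 *.
have x0 : 0 <= KK * s * (2 * eta + E).
  by rewrite mulr_ge0 ?mulr_ge0 ?(ltW KK0) ?(ltW s0)// addr_ge0// mulr_ge0// ltW.
have h1 : step_const eta s (2 `^ (1 + p)) E ^+ N <= expR (c2 / 4 * (s * J ^+ d)).
  apply: (@le_trans _ _ (expR (KK * s * (2 * eta + E)) ^+ N)).
    rewrite lerXn2r ?nnegrE ?expR_ge0//; last exact: expR_ge1Dx.
    by rewrite /step_const addr_ge0.
  rewrite -expRM_natl ler_expR.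
  have e1 : J `^ p * (2 * eta + E) = 1 + E0 * J ^+ d.
    rewrite /eta /noise_mix -/J mulrA mulfV// mul1r mulrDr -powRD_gt0// subrr powRr0.
    rewrite /E mulrCA -powRD_gt0// addrCA subrr addr0 powR_mulrn//; exact: ltW.
  apply: (@le_trans _ _ (kap * J `^ p * (KK * s * (2 * eta + E)))).
    by rewrite ler_wpM2r.
  have -> : kap * J `^ p * (KK * s * (2 * eta + E)) = kap * KK * s * (J `^ p * (2 * eta + E)) by ring.
  rewrite e1.
  have Jd1 : 1 <= J ^+ d by rewrite exprn_ege1.
  apply: (@le_trans _ _ (kap * KK * s * ((1 + E0) * J ^+ d))).
    by rewrite ler_wpM2l ?mulr_ge0 ?(ltW kap0) ?(ltW KK0) ?(ltW s0)//; nra.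
  have -> : kap * KK * s * ((1 + E0) * J ^+ d) = kap * (KK * (1 + E0)) * (s * J ^+ d) by ring.
  rewrite ler_wpM2r ?mulr_ge0 ?exprn_ge0 ?(ltW s0) ?(ltW J0)//.
  have : kap <= c2 / (4 * (KK * (1 + E0))) by rewrite /kap ge_min lexx orbT.
  by rewrite ler_pdivlMr ?mulr_gt0//; lra.
have h2 : ((3 / 2) ^+ ((2 ^ j) ^ d)%N / 2 ^+ ((2 ^ j) ^ d)%N) `^ (s / (1 + s)) <= expR (- (c2 / 2 * (s * J ^+ d))).
  have -> : (3 / 2) ^+ ((2 ^ j) ^ d)%N / 2 ^+ ((2 ^ j) ^ d)%N = expR (- (c2 * J ^+ d)).
    rewrite -exprVn -exprMn /J -natrX /c2.
    have -> : (3 / 2) * 2^-1 = (4 / 3)^-1 :> R by field.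
    by rewrite -mulNr [- _ * _]mulrC expRM_natl expRN lnK// posrE; lra.
  rewrite -expRM ler_expR mulNr lerN2.
  have hs : s / 2 <= s / (1 + s) by rewrite ler_pM2l// lef_pV2 ?posrE//; lra.
  have cJ : 0 <= c2 * J ^+ d by rewrite mulr_ge0 ?exprn_ge0 ?(ltW c20) ?(ltW J0).
  by have := ler_wpM2l cJ hs; lra.
apply: (@le_trans _ _ (expR (c2 / 4 * (s * J ^+ d)) * expR (- (c2 / 2 * (s * J ^+ d))))).
  by apply: ler_pM; rewrite ?powR_ge0// exprn_ge0// /step_const addr_ge0.
rewrite -expRD ler_expR; have := conj_exp_pow j d0; rewrite -/s -/J => h3.
by nra.
Qed.

(** The least scale compatible with N observations; its minimality gives the converse bound, with
    the ratio 2^p of consecutive scales as loss. *)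
Lemma dyadic_scale (kap p : R) (N : nat) : 0 < kap <= 1 -> 1 <= p -> (0 < N)%N ->
  exists j, N%:R <= kap * (2 ^ j)%:R `^ p /\ (2 ^ j)%:R `^ p <= 2 `^ p / kap * N%:R.
Proof.
move=> /andP[k0 k1] p1 N0; have N1 : 1 <= N%:R :> R by rewrite ler1n.
have p0 : 0 <= p by lra.
have [j0 hj0] : exists j, N%:R <= kap * (2 ^ j)%:R `^ p.
  (* 2^j exceeds N / kap for this j, and raising to the power p >= 1 only increases it. *)
  exists (Num.bound (N%:R / kap)).
  rewrite mulrC -ler_pdivrMr//; set x := N%:R / kap.
  have h := upper_nthrootP (leqnn (Num.bound x)).
  apply: le_trans (ltW h) _; rewrite natrX.
  set y := 2 ^+ _; have y1 : 1 <= y by rewrite exprn_ege1// ler1n.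
  by rewrite -[leLHS]powRr1 ?(le_trans ler01 y1)// ler_powR.
have [j hj jmin] := ex_minnP (ex_intro (fun j => N%:R <= kap * (2 ^ j)%:R `^ p) j0 hj0).
exists j; split=> //.
case: j hj jmin => [|j] hj jmin.
  rewrite expn0 powR1 mulrAC ler_pdivlMr// mul1r.
  apply: le_trans k1 _; rewrite -[leLHS]mulr1; apply: ler_pM => //.
  apply: (@le_trans _ _ (2 `^ 0)); first by rewrite powRr0.
  by rewrite ler_powR// ler1n.
have : kap * (2 ^ j)%:R `^ p < N%:R.
  by rewrite ltNge; apply/negP => /jmin; rewrite ltnn.
move=> h; rewrite expnS natrM powRM// -mulrA ler_wpM2l ?powR_ge0// mulrC ler_pdivlMr// mulrC.
exact: ltW.
Qed.

Lemma dyadic_scale_ge (kap p : R) (N j j0 : nat) : 0 < kap -> 0 <= p ->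
  N%:R <= kap * (2 ^ j)%:R `^ p -> kap * (2 ^ j0)%:R `^ p < N%:R -> (j0 < j)%N.
Proof.
move=> k0 p0 hj hN; rewrite ltnNge; apply/negP => jj0.
move: (lt_le_trans hN hj); rewrite ltNge ler_wpM2l ?(ltW k0)//.
by apply: ge0_ler_powR; rewrite ?nnegrE// ler_nat leq_exp2l.
Qed.

End Numeric.

Lemma limn_einf_ge (R : realType) (v : nat -> \bar R) (l : \bar R) n0 :
  (forall n, (n0 <= n)%N -> (l <= v n)%E) -> (l <= limn_einf v)%E.
Proof.
move=> h; rewrite limn_einf_lim (cvg_lim _ (@cvg_einfs_sup R v))//.
apply: (@le_trans _ _ (einfs v n0)); last by apply: ereal_sup_ubound; exists n0.
by apply: le_ereal_inf_tmp => _ [n /= hn <-]; exact: h.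
Qed.

Section Packing.
Context {R : realType} {d : nat}.

Lemma Hnorm_ge0 (lam : nat -> R) (s : R) (z : @Helt R d s) : (0 <= Hnorm lam z)%E.
Proof.
rewrite /Hnorm; move: z; rewrite /Helt; case: (0 <= s) => z.
  by apply: le_ereal_inf_tmp => _ [g _ <-]; exact: sqrte_ge0.
exact: sqrte_ge0.
Qed.

(** By the triangle inequality, the hypotheses within r of w all lie in the Hamming ball around any
    one of them, which [hamming_ball] counts. *)
Lemma packing_count (lam : nat -> R) (s r c : R) (I : finType)
    (z : {ffun I -> bool} -> @Helt R d s) (w : @Helt R d s) :
  r + r < c ->
  (forall b b', (#|I| <= 8 * hamming b b')%N -> (c%:E <= Hdist lam (z b) (z b'))%E) ->
  \sum_b ((Hdist lam w (z b) <= r%:E)%E%:R : R) <= (3 / 2) ^+ #|I|.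
Proof.
move=> rc hz.
have [[b0 hb0]|/forallNP none] := pselect (exists b, (Hdist lam w (z b) <= r%:E)%E); last first.
  rewrite big1; first by apply: exprn_ge0; lra.
  by move=> b _; have /negP/negbTE -> := none b.
apply: le_trans (hamming_ball b0).
rewrite -sum1_card natr_sum [leRHS]big_mkcond/=; apply: ler_sum => b _.
case: (boolP (Hdist lam w (z b) <= r%:E)%E) => [hb|_]; last by case: ifP.
rewrite inE ifT// ltnNge; apply/negP => /hz h.
have := le_trans h (Hdist_triangle lam (z b) (z b0) w).
move=> /le_trans /(_ (leeD hb0 hb)); rewrite -EFinD lee_fin.
by rewrite leNgt rc.
Qed.

Lemma estimator_measurable (lam : nat -> R) (s : R) N
    (est : N.-tuple (obs R d) -> @Helt R d s) (z : @Helt R d s) (r : R) :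
  estimator lam est -> measurable [set D | (r%:E < Hdist lam (est D) z)%E].
Proof.
by move=> [_ h]; exact: (h _ (@Hopen_far R d lam s r z)).
Qed.

Lemma data_law_setC (T : R) (T_gt0 : 0 < T) N (u : R -> pt R d -> R)
    (S : set (N.-tuple (obs R d))) (x : R) :
  measurable_fun [set: measurableTypeR R * pt R d] (fun q => u q.1 q.2) -> measurable S ->
  (data_law T_gt0 u (~` S) <= x%:E)%E -> ((1 - x)%:E <= data_law T_gt0 u S)%E.
Proof.
move=> mu mS; rewrite /data_law /pushforward.
have mA := measurable_observed_preimage mu mS.
rewrite preimage_setC probability_setC//; set Q := iid _ _ _ => h.
have Qf : Q \is a fin_num by exact: fin_num_measure.
by rewrite EFinB leeBlDr// addeC -leeBlDr.
Qed.

End Packing.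

Theorem theorem3 (R : realType) (d : nat) (hd : (1 <= d <= 3)%N)
  (lam : nat -> R) (e : nat -> pt R d -> R)
  (heig : dirichlet_eigenpairs lam e)
  (alpha : R) (halpha : 0 < alpha < 1) (T : R) (hT : 0 < T)
  (beta tau : R) (hbeta : pi / 2 < beta < pi) (htau : 0 <= tau)
  (f : R -> R) (u : (pt R d -> R) -> R -> pt R d -> R)
  (B : R) (hB : 0 < B) (gam : R) (hgam : 1 + d%:R / 2 < gam)
  (mu : R) (hmu : 0 <= mu <= 1)
  (hu : forall theta : pt R d -> R, (sobolev_norm gam theta < +oo)%E ->
    mild_solution alpha beta tau T lam e f theta (u theta))
  (hLip : forall M : R, exists C0 : R, forall nu : R, 0 <= nu <= 1 ->
    forall theta vartheta : pt R d -> R,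
      (sobolev_norm gam theta <= M%:E)%E ->
      (sobolev_norm gam vartheta <= M%:E)%E ->
      (L2L2norm T (fun t x => u theta t x - u vartheta t x)%R <=
       C0%:E * Hnorm lam (Hemb e (- nu) (fun x => theta x - vartheta x)%R))%E)
  (xi : R) (hxi : -1 <= xi < gam) :
  exists2 C : R, 0 < C & exists2 eps0 : R, 0 < eps0 &
    forall eps : R, 0 < eps < eps0 ->
    ((1 - eps)%:E <=
     limn_einf (fun N : nat =>
       minimax_prob hT lam e u
         [set theta : pt R d -> R | (sobolev_norm gam theta <= B%:E)%E]
         xi N
         (C * N%:R `^ (- ((gam - xi) / (2 * gam + 2 * mu + d%:R))))))%E.

Proof.
have d0 : (0 < d)%N by case/andP: hd.
have dR : 0 < d%:R :> R by rewrite ltr0n.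
have [/andP[mu0 mu1] /andP[xi1 xig]] := (hmu, hxi).
have gam0 : 0 <= gam by lra.
set p := 2 * gam + 2 * mu + d%:R.
have p1 : 1 <= p by rewrite /p; lra.
have p0 : 0 < p by lra.
have [K [c [theta [K0 c0 thB thK thc]]]] := hypercube heig xi d0 gam0 hmu hB.
have [C0 hC0] := hLip B.
have mu_u j b : measurable_fun [set: measurableTypeR R * pt R d]
    (fun q => u (theta j b) q.1 q.2).
  by have [] := hu (theta j b) (le_lt_trans (thB j b) (ltry _)).
(* The absolute value covers a constant [C0] of unknown sign; 1/T is the density of the design
   times. *)
pose E0 := (`|C0| * K) ^+ 2 / T.
have E00 : 0 <= E0 by rewrite divr_ge0 ?sqr_ge0 ?(ltW hT).
(* The exponent d - p is - 2 (gam + mu), in the form that makes N times this bound of order J^d when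
   N is of order J^p. *)
have hE j b b' : (\int[uniform_prob hT]_t \int[vol]_x
    ((u (theta j b) t x - u (theta j b') t x) ^+ 2)%:E <= (E0 * (2 ^ j)%:R `^ (d%:R - p))%:E)%E.
  set J : R := (2 ^ j)%:R.
  have J0 : 0 < J by rewrite /J ltr0n expn_gt0.
  have -> : E0 * J `^ (d%:R - p) = (`|C0| * (K * J `^ (- (gam + mu)))) ^+ 2 / T.
    have -> : J `^ (d%:R - p) = (J `^ (- (gam + mu))) ^+ 2.
      by rewrite -powR_mulrn ?powR_ge0// -powRrM; congr (_ `^ _); rewrite /p; ring.
    by rewrite /E0; field; rewrite gt_eqF.
  apply: uniform_L2L2norm.
  - by apply: measurable_funB; exact: mu_u.
  - by rewrite mulr_ge0// mulr_ge0 ?powR_ge0// ltW.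
  apply: le_trans (hC0 mu hmu _ _ (thB j b) (thB j b')) _.
  apply: (@le_trans _ _ (`|C0|%:E * Hnorm lam (Hemb e (- mu) (fun x => theta j b x - theta j b' x)%R))%E).
    by apply: lee_wpmul2r; [exact: Hnorm_ge0|rewrite lee_fin ler_norm].
  by rewrite EFinM; apply: lee_wpmul2l => //; rewrite lee_fin.
have [kap hk [c' c'0 hS]] := success_bound d0 (ltW p0) E00.
have /andP[kap0 kap1] := hk.
set q := (gam - xi) / p; have q0 : 0 < q by rewrite divr_gt0// subr_gt0.
pose C := c / 4 * (2 `^ p / kap) `^ (- q).
have F0 : 0 < 2 `^ p / kap by rewrite divr_gt0// powR_gt0.
exists C; first by rewrite mulr_gt0 ?powR_gt0// divr_gt0.
exists 1 => // eps /andP[eps0 eps1].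
(* Beyond the scale [j0] the success probability is below [eps], and [n0] forces the scale attached
   to N beyond [j0]. Neither affects [C]. *)
pose j0 := Num.bound (- ln eps / c').
have hj0 : - ln eps < c' * j0%:R.
  rewrite mulrC -ltr_pdivrMr//; apply: archi_boundP.
  by rewrite divr_ge0 ?(ltW c'0)// oppr_ge0 ln_le0// ltW.
pose n0 := Num.bound (kap * (2 ^ j0)%:R `^ p).
have hn0 : kap * (2 ^ j0)%:R `^ p < n0%:R.
  by apply: archi_boundP; rewrite mulr_ge0 ?powR_ge0// ltW.
apply: (@limn_einf_ge _ _ _ n0.+1) => N n0N.
have N0 : (0 < N)%N by exact: leq_trans n0N.
have NR : 0 < N%:R :> R by rewrite ltr0n.
have [j [hj1 hj2]] := dyadic_scale hk p1 N0.
have j0j : (j0 < j)%N.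
  apply: (dyadic_scale_ge kap0 (ltW p0) hj1).
  by apply: lt_le_trans hn0 _; rewrite ler_nat ltnW.
set J : R := (2 ^ j)%:R in hj1 hj2.
have J0 : 0 < J by rewrite /J ltr0n expn_gt0.
set r := C * N%:R `^ (- q).
have rc : r + r < c * J `^ (- (gam - xi)).
  have h : N%:R `^ (- q) * (2 `^ p / kap) `^ (- q) <= J `^ (- (gam - xi)).
    have -> : J `^ (- (gam - xi)) = (J `^ p) `^ (- q).
      by rewrite -powRrM; congr (_ `^ _); rewrite /q; field; rewrite gt_eqF.
    rewrite -powRM ?(ltW NR) ?(ltW F0)// !powRN lef_pV2 ?posrE ?powR_gt0 ?mulr_gt0//.
      by apply: ge0_ler_powR; [exact: ltW|rewrite nnegrE powR_ge0|
        rewrite nnegrE mulr_ge0// ltW|rewrite mulrC].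
    by rewrite invr_gt0.
  have JP : 0 < J `^ (- (gam - xi)) by rewrite powR_gt0.
  rewrite /r /C; set x := N%:R `^ _ in h *; set y := (_ / kap) `^ _ in h *.
  have h' : c * (x * y) <= c * J `^ (- (gam - xi)) by rewrite ler_wpM2l// ltW.
  by nra.
apply: le_ereal_inf_tmp => _ [est hest <-].
pose S b := [set D : N.-tuple (obs R d) | (r%:E < Hdist lam (est D) (Hemb e xi (theta j b)))%E].
have mS b : measurable (S b) by exact: estimator_measurable.
pose n := #|{: {ffun 'I_d -> 'I_(2 ^ j)%N}}|.
have nE : n = ((2 ^ j) ^ d)%N by rewrite /n card_ffun !card_ord.
have V0 : 0 <= (3 / 2) ^+ n :> R by apply: exprn_ge0; lra.
have cardI : #|{: {ffun {ffun 'I_d -> 'I_(2 ^ j)%N} -> bool}}| = (2 ^ n)%N.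
  by rewrite card_ffun card_bool.
have I0 : (0 < #|{: {ffun {ffun 'I_d -> 'I_(2 ^ j)%N} -> bool}}|)%N.
  by rewrite cardI expn_gt0.
have hV D : \sum_(b : {ffun {ffun 'I_d -> 'I_(2 ^ j)%N} -> bool}) (\1_(~` S b) D : R) <= (3 / 2) ^+ n.
  apply: le_trans (packing_count (est D) rc (thc j)).
  apply: ler_sum => b _; rewrite indicE; case: (boolP (D \in ~` S b)) => // /set_mem/negP.
  by rewrite -leNgt => ->.
(* The vertex of the initial state 0; its solution serves as the regression function of the
   reference law. *)
pose b0 : {ffun {ffun 'I_d -> 'I_(2 ^ j)%N} -> bool} := [ffun=> false].
have [b hb] := @some_small_success R d T hT N (noise_mix p j) (conj_exp j) (2 `^ (1 + p))
  (E0 * J `^ (d%:R - p)) ((3 / 2) ^+ n) (u (theta j b0)) _ (fun b => u (theta j b))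
  (fun b => ~` S b) (noise_mix_gt0 p j) (noise_mix_le j (ltW p0)) (conj_exp01 j)
  (noise_mix_powR j (ltW p0)) (mulr_ge0 E00 (powR_ge0 _ _)) V0 I0 (mu_u j b0) (mu_u j)
  (fun b => measurableC (mS b)) (fun b => hE j b b0)
  hV.
apply: (@le_trans _ _ (data_law hT (u (theta j b)) (S b))); last first.
  by apply: ereal_sup_ubound; exists (theta j b) => //; exact: thB.
apply: (data_law_setC (mu_u j b) (mS b)); apply: le_trans hb _.
rewrite lee_fin cardI nE natrX; apply: le_trans (hS j N hj1) _.
rewrite -[leRHS]lnK ?posrE// ler_expR.
have : c' * j0%:R <= c' * j%:R by rewrite ler_wpM2l ?(ltW c'0)// ler_nat ltnW.
by move=> h; rewrite lerNl ltW// (lt_le_trans hj0 h).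
Qed.
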